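(* Let $A(u,v)=\frac12 v^2-u$, and let $Z=\exp\sum_{n\ge 0}\hbar^{n-1}S_n$ be the formal expression built from the functions $S_n$ of the Airy curve $A(u,v)=0$ (as defined in the context), regarded as a function of $u$ through $u=\frac12 p^2$. Let $\hat A=\frac12\hat v^2-\hat u$ be the quantization of the polynomial $A(u,v)$, where $\hat u=u\,\cdot$ (multiplication by $u$) and $\hat v=\hbar\,\partial_u$. Then $$\hat A Z=0,\qquad\text{i.e.}\qquad \Bigl(\tfrac12\hbar^2\partial_u^2-u\Bigr)Z=0 .$$
   Context: The Airy curve is the plane curve $\frac12 v^2-u=0$, parametrized by $u(p)=\frac12p^2$, $v(p)=p$. Eynard-Orantin functions. The functions $\mathcal W_{g,n}(z_1,\dots,z_n)$ ($g\ge 0$, $n\ge 1$) are defined recursively by the initial values $$\mathcal W_{0,1}(z)=0,\qquad \mathcal W_{0,2}(z_1,z_2)=\frac{1}{(z_1-z_2)^2},$$ and, for $2g-1+n>0$ ($g,n\ge 0$), by $$\mathcal W_{g,n+1}(z_0,z_1,\dots,z_n)=\frac12\operatorname{Res}_{z=0}\Biggl(\frac{1}{z(z_0^2-z^2)}\Bigl(\mathcal W_{g-1,n+2}(z,-z,z_{[n]})+\sum_{\substack{g_1+g_2=g\\ A_1\sqcup A_2=[n]}}\mathcal W_{g_1,|A_1|+1}(z,z_{A_1})\,\mathcal W_{g_2,|A_2|+1}(-z,z_{A_2})\Bigr)\Biggr),$$ where $[n]=\{1,\dots,n\}$, $z_A=(z_i)_{i\in A}$, the sum runs over ordered pairs $(g_1,g_2)$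 of nonnegative integers and ordered pairs $(A_1,A_2)$ of disjoint (possibly empty) sets with union $[n]$, and terms with negative genus are zero. The residue is taken at $z=0$ with $z_0,\dots,z_n$ nonzero parameters. The functions $S_n$. As functions of $p\neq 0$, $$S_0=\int^p v(p)\,du(p)=\tfrac13p^3,\qquad S_1=-\tfrac12\log\frac{du}{dp}=-\tfrac12\log p,$$ $$S_n(p)=\sum_{2g-1+k=n}\frac{(-1)^k}{k!}\int^p\cdots\int^p\mathcal W_{g,k}(p_1',\dots,p_k')\,dp_1'\cdots dp_k'\qquad(n\ge 2),$$ where the sum is over integers $g\ge0$, $k\ge1$ and the iterated antiderivatives are normalized to have no integration constants, i.e. each integration starts at $\infty$ (for $2g-2+k>0$, $\mathcal W_{g,k}$ is a polynomial in the $(p_i')^{-1}$ with every exponent at least $2$). Meaning of the equation. One expresses the $S_n$ in terms of $u$ by choosing a branch $p=(2u)^{1/2}$ or $p=-(2u)^{1/2}$ (and a local branch of $\log p$), so that $\partial_u=p^{-1}\partial_p$; the assertion holds for either choice. $Z=e^{S_0/\hbar}\,e^{S_1}\exp\bigl(\sum_{n\ge2}\hbar^{n-1}S_n\bigr)$ is $e^{S_0/\hbar}$ times a formal power series in $\hbar$ whose coefficients are functions of $u$ (locally analytic away from $u=0$); $\partial_u$ acts by the usual rule $\partial_u(e^{S_0/\hbar}f)=e^{S_0/\hbar}\bigl(\partial_uf+\hbar^{-1}(\partial_uS_0)f\bigr)$, and the equation is an identity of formal power series in $\hbar$ after dividing by $e^{S_0/\hbar}$. *)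

(* Defs.v *)
From HB Require Import structures.
From mathcomp Require Import all_boot all_order all_algebra.
From mathcomp Require Import all_classical all_reals all_analysis.
From mathcomp Require Import complex zify.
Set Implicit Arguments.
Unset Strict Implicit.
Unset Printing Implicit Defensive.
Import Order.TTheory GRing.Theory Num.Theory numFieldNormedType.Exports.
Local Open Scope classical_set_scope.
Local Open Scope ring_scope.

(* Everything that makes sense over an arbitrary numFieldType C is defined at
   that generality: MathComp-Analysis puts on it the topology of its norm, so
   for C the complex numbers (see [CC] below) [derivable f z 1] and [derive1 f z]
   are complex differentiability and the complex derivative. *)
Section Airy.
Variable C : numFieldType.

Definition holomorphic_on (U : set C) (f : C -> C) : Prop :=
  forall z, U z -> derivable f z 1.

(* On a punctured neighbourhood of 0, f is a finite principal part
   \sum_k a_k z^-(k+1) plus a function holomorphic near 0; the residue is the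
   coefficient a_0 of z^-1. *)
Definition is_residue0 (f : C -> C) (r : C) : Prop :=
  exists (N : nat) (a : nat -> C) (h : C -> C),
    [/\ a 0%N = r,
        \forall z \near (0 : C), derivable h z 1 &
        \forall z \near (0 : C)^',
          f z = \sum_(k < N.+1) a k * (z ^+ k.+1)^-1 + h z].

Definition residue0 (f : C -> C) : C := xget 0 [set r | is_residue0 f r].

Definition subtuple (zs : seq C) (A : {set 'I_(size zs)}) : seq C :=
  [seq zs`_(val i) | i <- enum A].

(* A pair A_1 \sqcup A_2 = [n] is given by A_1 = A and A_2 = ~: A. *)
Definition EO_integrand (W : nat -> seq C -> C) (g : nat) (z0 : C)
    (zs : seq C) (z : C) : C :=
  (z * (z0 ^+ 2 - z ^+ 2))^-1 *
  ((if g is g'.+1 then W g' [:: z, - z & zs] else 0) +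
   \sum_(g1 < g.+1) \sum_(A : {set 'I_(size zs)})
      W g1 (z :: subtuple A) * W (g - g1)%N (- z :: subtuple (~: A))).

(* W_{g,n}(z_1, ..., z_n) is [EO_W g [:: z_1; ...; z_n]].  The right-hand side
   of the recursion mentions W_{g,n+1} itself, multiplied by W_{0,1} = 0, so the
   recursion is run with a fuel k; 2g + n units are enough, see [EO_W_rec].
   The value 0 at n = 0 is a convention and is never used. *)
Fixpoint EO_fuel (k g : nat) (zs : seq C) : C :=
  if k is k'.+1 then
    match g, zs with
    | _, [::] => 0
    | 0%N, [:: _] => 0
    | 0%N, [:: z1; z2] => ((z1 - z2) ^+ 2)^-1
    | _, z0 :: zs' => 2^-1 * residue0 (EO_integrand (EO_fuel k') g z0 zs')
    end
  else 0.

Definition EO_W (g : nat) (zs : seq C) : C := EO_fuel (2 * g + size zs) g zs.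

Lemma EO_fuel01 k z : EO_fuel k 0 [:: z] = 0.
Proof. by case: k. Qed.

Lemma EO_fuelS k g z0 zs : (0 < 2 * g + size zs)%N -> (g, size zs) != (0, 1)%N ->
  EO_fuel k.+1 g (z0 :: zs) = 2^-1 * residue0 (EO_integrand (EO_fuel k) g z0 zs).
Proof. by case: g => [|g]; case: zs => [|z1 [|z2 zs]]. Qed.

Lemma size_subtuple (zs : seq C) (A : {set 'I_(size zs)}) :
  size (subtuple A) = #|A|.
Proof. by rewrite size_map cardE. Qed.

Lemma EO_fuel_stable k k' g zs :
  (2 * g + size zs <= k)%N -> (2 * g + size zs <= k')%N ->
  EO_fuel k g zs = EO_fuel k' g zs.
Proof.
elim: k k' g zs => [|k IH] [|k'] g zs.
- by [].
- by case: g zs => [|g] [|z zs].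
- by case: g zs => [|g] [|z zs].
case: zs => [|z0 zs]; first by case: g.
move=> mk mk'; rewrite /= in mk mk'.
have [st|] := boolP ((0 < 2 * g + size zs)%N && ((g, size zs) != (0, 1)%N)).
  case/andP: st => s1 s2; rewrite !EO_fuelS //.
  congr (_ * residue0 _); apply/funext => z; rewrite /EO_integrand.
  congr (_ * (_ + _)).
    by case: g mk mk' {s1 s2} => // g mk mk'; apply: IH => /=; lia.
  apply: eq_bigr => -[g1 /= lg1] _; apply: eq_bigr => A _.
  have cA := cardsC A; rewrite card_ord in cA.
  have sA := size_subtuple A; have sB := size_subtuple (~: A).
  move: cA sA sB; move: (#|A|) (#|~: A|) => a b cA sA sB.
  case: (posnP (2 * g1 + a)%N) => [e|ne].
    have [-> a0] : g1 = 0%N /\ a = 0%N by lia.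
    have -> : subtuple A = [::] by apply: size0nil; rewrite sA.
    by rewrite !EO_fuel01 !mul0r.
  case: (posnP (2 * (g - g1) + b)%N) => [e|ne'].
    have [-> b0] : (g - g1 = 0)%N /\ b = 0%N by lia.
    have -> : subtuple (~: A) = [::] by apply: size0nil; rewrite sB.
    by rewrite !EO_fuel01 !mulr0.
  by congr (_ * _); apply: IH; rewrite /= ?sA ?sB; lia.
by case: g zs {mk mk'} => [|g] [|z1 [|z2 zs]].
Qed.

Lemma EO_W01 z : EO_W 0 [:: z] = 0.
Proof. by []. Qed.

Lemma EO_W02 z1 z2 : EO_W 0 [:: z1; z2] = ((z1 - z2) ^+ 2)^-1.
Proof. by []. Qed.

Lemma EO_W_rec g z0 zs : (1 < 2 * g + size zs)%N ->
  EO_W g (z0 :: zs) = 2^-1 * residue0 (EO_integrand EO_W g z0 zs).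
Proof.
move=> st; have [k kE] : exists k, k = (2 * g + size zs).+1 by eexists.
have -> : EO_W g (z0 :: zs) = EO_fuel k.+1 g (z0 :: zs).
  by apply: EO_fuel_stable; rewrite ?kE /= ?addnS ?leqnSn ?leqnn.
have st0 : (g, size zs) != (0, 1)%N.
  by apply/eqP => -[g0 s1]; move: st; rewrite g0 s1.
rewrite EO_fuelS //; last by apply: ltn_trans st.
congr (_ * residue0 _); apply/funext => z; rewrite /EO_integrand.
congr (_ * (_ + _)).
  by case: g kE {st st0} => // g kE; apply: EO_fuel_stable => /=; lia.
apply: eq_bigr => -[g1 /= lg1] _; apply: eq_bigr => A _.
have cA := cardsC A; rewrite card_ord in cA.
have sA := size_subtuple A; have sB := size_subtuple (~: A).
move: cA sA sB; move: (#|A|) (#|~: A|) => a b cA sA sB.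
by congr (_ * _); apply: EO_fuel_stable; rewrite /= ?sA ?sB; lia.
Qed.

(* F is the antiderivative of f on C \ {0} that vanishes at infinity. *)
Definition is_int_from_infty (f F : C -> C) : Prop :=
  (forall p : C, p != 0 -> is_derive p 1 F (f p)) /\
  F (x^-1) @[x --> (0 : C)^'] --> (0 : C).

Definition int_from_infty (f : C -> C) (p : C) : C :=
  xget 0 [set y | exists2 F, is_int_from_infty f F & F p = y].

(* \int^p ... \int^p f(p_1, ..., p_k) dp_1 ... dp_k *)
Fixpoint iterated_int (k : nat) (f : seq C -> C) (p : C) : C :=
  if k is k'.+1 then
    iterated_int k' (fun s => int_from_infty (fun x => f (x :: s)) p) p
  else f [::].

(* S_n at the point p of the curve u = p^2/2, v = p; logp is the chosen value of
   log p.  S_0 = \int^p v du and S_1 = - (1/2) log (du/dp).  In the sum,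
   2g - 1 + k = n bounds both g and k by n + 1. *)
Definition airy_S (p logp : C) (n : nat) : C :=
  match n with
  | 0%N => 3^-1 * p ^+ 3
  | 1%N => - (2^-1 * logp)
  | _ => \sum_(0 <= g < n.+2) \sum_(1 <= k < n.+2 | (2 * g + k == n.+1)%N)
           (-1) ^+ k / k`!%:R * iterated_int k (EO_W g) p
  end.

(* Coefficient of hbar^n in exp(\sum_(j >= 1) a_j hbar^j); a_0 is meant to be 0,
   so that the truncations are exact. *)
Definition fps_exp (a : nat -> C) (n : nat) : C :=
  (\sum_(m < n.+1) m`!%:R^-1 *: (\poly_(j < n.+1) a j) ^+ m)`_n.

(* The operators act on e^(S0/hbar) * \sum_n hbar^n f_n; they are given by their
   action on the sequence f of coefficients. *)
Definition uhat (f : nat -> C -> C) (n : nat) (u : C) : C := u * f n u.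

Definition vhat (S0 : C -> C) (f : nat -> C -> C) (n : nat) (u : C) : C :=
  (if n is m.+1 then derive1 (f m) u else 0) + derive1 S0 u * f n u.

Definition Ahat (S0 : C -> C) (f : nat -> C -> C) (n : nat) (u : C) : C :=
  2^-1 * vhat S0 (vhat S0 f) n u - uhat f n u.

End Airy.

Definition CC (R : realType) : numFieldType := R[i].

Section AiryComplex.
Variable R : realType.
Local Notation C := (CC R).

Definition expC (z : C) : C :=
  let: Complex x y := z in Complex (expR x * cos y) (expR x * sin y).

(* Z = e^(S_0/hbar) * \sum_n hbar^n (wkb_amplitude S n). *)
Definition wkb_amplitude (S : nat -> C -> C) (n : nat) (u : C) : C :=
  expC (S 1%N u) * fps_exp (fun j => if j is 0%N then 0 else S j.+1 u) n.

(* p is a branch of (2u)^(1/2) (either sign) on U, and logp one of log p. *)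
Record airy_branch (U : set C) (p logp : C -> C) : Prop := AiryBranch {
  branch_open : open U;
  branch_neq0 : forall u, U u -> u != 0;
  branch_sqr : forall u, U u -> p u ^+ 2 = 2 * u;
  branch_continuous : forall u, U u -> {for u, continuous p};
  branch_exp : forall u, U u -> expC (logp u) = p u;
  branch_log_continuous : forall u, U u -> {for u, continuous logp} }.

End AiryComplex.

(* Main.v *)
Require Import Defs.
From HB Require Import structures.
From mathcomp Require Import all_boot all_order all_algebra.
From mathcomp Require Import all_classical all_reals all_analysis.
From mathcomp Require Import complex ring lra zify.
(** Topological recursion on the Airy curve is a set of Virasoro constraints in
disguise, and the wave function Z sees the solution of these constraints on a
single curve in the space of its times, where they become the Airy equation.

Away from the diagonals every stable W_{g,n} is a finite sum
\sum F_g(d_1, ..., d_n) \prod_i z_i^(-2 (d_i + 1)).  Evaluating the residue by even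
Taylor expansions turns the recursion for W into a quadratic recursion for the
numbers F_g(d_1, ..., d_n).  The genus can be forgotten, because F_g is nonzero only if
\sum_i (2 d_i + 1) = 6 g - 6 + 3 n.  So there is one function [corr] on words
d_1 ... d_n of natural numbers, and [EO_W_lsum] expresses W by it.

A function on words is read as an exponential generating function in times t_d:
prefixing the letter d is the partial derivative D_d = d/dt_d and the shuffle product is
the product of generating functions.  If [corr] generates F, then Z = exp F ([dcorr])
satisfies the linear equations D_d Z = H_d Z ([dcorr_vir]), where
  H_d = \sum_j (2j + 1) t_j D_{d+j-1} + 1/2 \sum_{b + c = d - 2} D_b D_c
        + [d = 0] t_0^2 / 2 + [d = 1] / 8.
A word function is a generating function in commuting times only if it is symmetric,
and the recursion singles out the first letter.  The symmetry follows from the relation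
[H_d, H_k] = 2 (d - k) H_{d+k-1} ([vir_comm]), the integrability condition of the linear
equations.

Integrating each variable of W_{g,k} from infinity to p and dividing by k! amounts to
the specialization t_d = p^-(2d+1) / (2d+1); the signs of the k integrations cancel the
factor (-1)^k in S_n.  With t = p^-1, the operator t d/dt on the specialization is
\sum_d t^(2d+1) D_d, and \sum_d t^(2d+1) H_d can be rewritten by means of t d/dt and its
square alone.  Hence the coefficient z_n of t^(3n) in exp F satisfies
  24 (n + 1) z_{n+1} = (6n + 1) (6n + 5) z_n ([airy_coefS]).
On the other hand the coefficient of hbar^n in Z is z_n q p^(-3n), where q = e^(S_1) has
square 1/p.  Since dp/du = 1/p, the equation (hbar^2/2 d^2/du^2 - u) Z = 0 becomes, order
by order, this same recursion.

Two uniqueness facts make the definitions computable: a finite principal part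
is determined by the function, and the antiderivative that vanishes at infinity is
unique ([derive0_vanish]). *)

Set Implicit Arguments.
Unset Strict Implicit.
Unset Printing Implicit Defensive.
Import Order.TTheory GRing.Theory Num.Theory numFieldNormedType.Exports.
Local Open Scope ring_scope.

(** * Splittings of sequences and generating functions on words *)

Section Splits.
Variable T : Type.
Implicit Types (x : T) (s : seq T).

(** All ways to distribute the entries of a sequence over two subsequences; the sums over
A_1 \sqcup A_2 = [n] are sums over this list. *)
Fixpoint splits s : seq (seq T * seq T) :=
  if s is x :: s' then
    [seq (x :: p.1, p.2) | p <- splits s'] ++ [seq (p.1, x :: p.2) | p <- splits s']
  else [:: ([::], [::])].

Fixpoint picks s : seq (T * seq T) :=
  if s is x :: s' then (x, s') :: [seq (p.1, x :: p.2) | p <- picks s'] else [::].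

Lemma sum_splits_nil (V : nmodType) (G : seq T -> seq T -> V) :
  \sum_(p <- splits [::]) G p.1 p.2 = G [::] [::].
Proof. by rewrite big_seq1. Qed.

Lemma sum_splits_cons (V : nmodType) (G : seq T -> seq T -> V) x s :
  \sum_(p <- splits (x :: s)) G p.1 p.2 =
  \sum_(p <- splits s) G (x :: p.1) p.2 + \sum_(p <- splits s) G p.1 (x :: p.2).
Proof. by rewrite /= big_cat !big_map. Qed.

Lemma sum_picks_cons (V : nmodType) (G : T -> seq T -> V) x s :
  \sum_(p <- picks (x :: s)) G p.1 p.2 =
  G x s + \sum_(p <- picks s) G p.1 (x :: p.2).
Proof. by rewrite /= big_cons big_map. Qed.

(** Choosing an element of the first part after splitting is the same as choosing an
element first and then splitting the rest. *)
Lemma sum_splits_picks (V : nmodType) (G : T -> seq T -> seq T -> V) s :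
  \sum_(p <- splits s) \sum_(q <- picks p.1) G q.1 q.2 p.2 =
  \sum_(q <- picks s) \sum_(p <- splits q.2) G q.1 p.1 p.2.
Proof.
elim: s G => [|x s IH] G; first by rewrite big_seq1 !big_nil.
rewrite (sum_splits_cons (fun a b => \sum_(q <- picks a) G q.1 q.2 b)).
rewrite (sum_picks_cons (fun y r => \sum_(p <- splits r) G y p.1 p.2)).
under [X in X + _ = _]eq_bigr do rewrite (sum_picks_cons (fun y r => G y r _)).
rewrite big_split /= -addrA; congr (_ + _).
under [X in _ = X]eq_bigr do rewrite (sum_splits_cons (fun a b => G _ a b)).
by rewrite big_split /= (IH (fun y a b => G y (x :: a) b)) (IH (fun y a b => G y a (x :: b))).
Qed.

Lemma sum_splits_swap (V : nmodType) (G : seq T -> seq T -> V) s :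
  \sum_(p <- splits s) G p.1 p.2 = \sum_(p <- splits s) G p.2 p.1.
Proof.
elim: s G => [|x s IH] G; first by rewrite !big_seq1.
rewrite sum_splits_cons (sum_splits_cons (fun a b => G b a)) addrC.
by rewrite (IH (fun a b => G a (x :: b))) (IH (fun a b => G (x :: a) b)).
Qed.
End Splits.

(** The degree in t of \prod_i t_(d_i) under t_d = t^(2d+1) / (2d+1). *)
Definition wt (I : seq nat) : nat := sumn [seq d.*2.+1 | d <- I].

Arguments wt : simpl never.

Lemma wt_cons d I : wt (d :: I) = (d.*2.+1 + wt I)%N. Proof. by []. Qed.

Lemma splits_wt I p : p \in splits I -> (wt p.1 + wt p.2 = wt I)%N.
Proof.
elim: I p => [|x I IH] p /=; first by rewrite inE => /eqP ->.
rewrite mem_cat => /orP[] /mapP[q qI ->] /=; rewrite !wt_cons -(IH q qI).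
  by rewrite addnA.
by rewrite addnCA.
Qed.

Lemma splits_size (T : eqType) (I : seq T) p :
  p \in splits I -> (size p.1 + size p.2 = size I)%N.
Proof.
elim: I p => [|x I IH] p /=; first by rewrite inE => /eqP ->.
by rewrite mem_cat => /orP[] /mapP[q qI ->] /=; rewrite -(IH q qI) ?addSn ?addnS.
Qed.

Lemma picks_wt I p : p \in picks I -> (p.1.*2.+1 + wt p.2 = wt I)%N.
Proof.
elim: I p => [|x I IH] p //=; rewrite inE => /orP[/eqP -> //|].
by move=> /mapP[q qI ->] /=; rewrite !wt_cons -(IH q qI) addnCA.
Qed.

Lemma picks_size (T : eqType) (I : seq T) p :
  p \in picks I -> (size p.2).+1 = size I.
Proof.
elim: I p => [|x I IH] p //=; rewrite inE => /orP[/eqP -> //|].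
by move=> /mapP[q qI ->] /=; rewrite (IH q qI).
Qed.

Section WordFunctions.
Variable C : numFieldType.
Implicit Types (phi psi chi : seq nat -> C) (I J : seq nat).

Definition der k phi I : C := phi (k :: I).
Definition shuf phi psi I : C := \sum_(p <- splits I) phi p.1 * psi p.2.

(** As exponential generating functions, [single [:: 0]] is t_0 and [single [:: 0; 0]] is t_0^2 / 2. *)
Definition single J I : C := (I == J)%:R.

Lemma shuf_nil phi psi : shuf phi psi [::] = phi [::] * psi [::].
Proof. exact: sum_splits_nil (fun a b => phi a * psi b). Qed.

Lemma shuf_cons phi psi k I :
  shuf phi psi (k :: I) = shuf (der k phi) psi I + shuf phi (der k psi) I.
Proof. exact: sum_splits_cons (fun a b => phi a * psi b) k I. Qed.

Lemma shufDl phi psi chi I :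
  shuf (phi \+ psi) chi I = shuf phi chi I + shuf psi chi I.
Proof. by rewrite -big_split; apply: eq_bigr => p _; rewrite mulrDl. Qed.

Lemma shufC phi psi I : shuf phi psi I = shuf psi phi I.
Proof.
by rewrite /shuf (sum_splits_swap (fun a b => phi a * psi b)); apply: eq_bigr => p _; rewrite mulrC.
Qed.

Lemma shufDr phi psi chi I :
  shuf phi (psi \+ chi) I = shuf phi psi I + shuf phi chi I.
Proof. by rewrite -big_split; apply: eq_bigr => p _; rewrite mulrDr. Qed.

Lemma der_shuf k phi psi :
  der k (shuf phi psi) = shuf (der k phi) psi \+ shuf phi (der k psi).
Proof. by apply/funext => I; rewrite /der shuf_cons. Qed.

Lemma shufA phi psi chi I :
  shuf phi (shuf psi chi) I = shuf (shuf phi psi) chi I.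
Proof.
elim: I phi psi chi => [|k I IH] phi psi chi; first by rewrite !shuf_nil mulrA.
by rewrite !shuf_cons !der_shuf shufDl shufDr !IH addrA.
Qed.

Lemma shuf0l phi I : shuf (fun=> 0) phi I = 0.
Proof. by rewrite /shuf big1 // => p _; rewrite mul0r. Qed.

Lemma shufZl (a : C) phi psi I : shuf (fun J => a * phi J) psi I = a * shuf phi psi I.
Proof. by rewrite /shuf mulr_sumr; apply: eq_bigr => p _; rewrite mulrA. Qed.

Lemma shuf_suml n (F : 'I_n -> seq nat -> C) psi I :
  shuf (fun J => \sum_(i < n) F i J) psi I = \sum_(i < n) shuf (F i) psi I.
Proof.
by rewrite /shuf exchange_big /=; apply: eq_bigr => p _; rewrite mulr_suml.
Qed.

Lemma shuf1l phi I : shuf (single [::]) phi I = phi I.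
Proof.
elim: I phi => [|k I IH] phi; first by rewrite shuf_nil /single eqxx mul1r.
by rewrite shuf_cons IH (_ : der k _ = fun=> 0) ?shuf0l ?add0r.
Qed.

Lemma eq_shuf phi psi phi' psi' I :
  (forall p, p \in splits I -> phi p.1 = phi' p.1 /\ psi p.2 = psi' p.2) ->
  shuf phi psi I = shuf phi' psi' I.
Proof. by move=> e; apply: eq_big_seq => p /e[-> ->]. Qed.

Definition mul_t0 phi := shuf (single [:: 0%N]) phi.

Lemma der_single1 l : der l (single [:: 0%N]) = fun I => (l == 0%N)%:R * single [::] I.
Proof.
by apply/funext => I; rewrite /der /single eqseq_cons; case: l => [|l] /=; rewrite ?mul1r ?mul0r.
Qed.

Lemma der_single2 l :
  der l (single [:: 0%N; 0%N]) = fun I => (l == 0%N)%:R * single [:: 0%N] I.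
Proof.
by apply/funext => I; rewrite /der /single eqseq_cons; case: l => [|l] /=; rewrite ?mul1r ?mul0r.
Qed.

Lemma mul_t0_nil phi : mul_t0 phi [::] = 0.
Proof. by rewrite /mul_t0 shuf_nil mul0r. Qed.

Lemma mul_t0_cons phi l I : mul_t0 phi (l :: I) = (l == 0%N)%:R * phi I + mul_t0 (der l phi) I.
Proof. by rewrite /mul_t0 shuf_cons der_single1 shufZl shuf1l. Qed.

(** The derivative D_{n-1}, with D_{-1} = 0. *)
Definition lower n phi I : C := if n is e.+1 then phi (e :: I) else 0.

(** The derivative D_{n-1} again, now with D_{-1} read as multiplication by t_0: with this
convention the commutator of D_l and H_d is (2l+1) D_{d+l-1} in every case. *)
Definition lower0 n phi I : C := if n is e.+1 then phi (e :: I) else mul_t0 phi I.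

(** The operator \sum_j (2j+1) t_j D_{d+j-1}: multiplying by t_j sums over the ways to
remove a letter j from the word. *)
Definition linpart d phi I : C :=
  \sum_(p <- picks I) p.1.*2.+1%:R * lower (d + p.1) phi p.2.

(** The Virasoro operator H_d. *)
Definition vir d phi I : C :=
  linpart d phi I + 2^-1 * \sum_(b < d.-1) phi [:: nat_of_ord b, (d - 2 - b)%N & I]
  + (d == 0%N)%:R * shuf (single [:: 0%N; 0%N]) phi I + (d == 1%N)%:R / 8 * phi I.

(** Invariance under adjacent transpositions, i.e. commuting times. *)
Definition sym phi := forall I k l J, phi (I ++ [:: k, l & J]) = phi (I ++ [:: l, k & J]).

Lemma sym_der phi k : sym phi -> sym (der k phi).
Proof. by move=> s I; apply: (s (k :: I)). Qed.

Lemma symE phi k l I : sym phi -> phi [:: k, l & I] = phi [:: l, k & I].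
Proof. by move=> s; apply: (s [::]). Qed.

Lemma sym_derC phi k l : sym phi -> der k (der l phi) = der l (der k phi).
Proof. by move=> s; apply/funext => I; apply: symE. Qed.

Lemma linpart_cons d phi l I : sym phi ->
  linpart d phi (l :: I) = l.*2.+1%:R * lower (d + l) phi I + linpart d (der l phi) I.
Proof.
move=> s; rewrite /linpart (sum_picks_cons (fun a b => a.*2.+1%:R * lower (d + a) phi b)).
congr (_ + _); apply: eq_bigr => p _; congr (_ * _).
by rewrite /lower; case: (d + _)%N => // e; rewrite symE.
Qed.

(** D_l H_d = H_d D_l + (2l+1) D_{d+l-1}.  This lets identities between the H_d be proved by
induction on the word. *)
Lemma vir_cons d phi l I : sym phi ->
  vir d phi (l :: I) = vir d (der l phi) I + l.*2.+1%:R * lower0 (d + l) phi I.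
Proof.
move=> s; rewrite /vir linpart_cons // shuf_cons der_single2 shufZl.
rewrite (eq_bigr (fun b : 'I_d.-1 => der l phi [:: nat_of_ord b, (d - 2 - b)%N & I])); last first.
  by move=> b _; rewrite /der (s [:: nat_of_ord b]) symE.
rewrite {}/der /lower /lower0 -/(mul_t0 phi I).
by case: d => [|d]; case: l => [|l] //=; rewrite ?mul0r ?mul1r ?add0r ?addr0 ?mulr0; ring.
Qed.

Lemma der_vir d phi l : sym phi -> der l (vir d phi) =
  vir d (der l phi) \+ (fun I => l.*2.+1%:R * lower0 (d + l) phi I).
Proof. by move=> s; apply/funext => I; rewrite /der vir_cons. Qed.

Lemma virD d phi psi I : vir d (phi \+ psi) I = vir d phi I + vir d psi I.
Proof.
rewrite /vir shufDr.
have -> : linpart d (phi \+ psi) I = linpart d phi I + linpart d psi I.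
  rewrite -big_split; apply: eq_bigr => p _ /=; rewrite /lower.
  by case: (d + _)%N => [|e]; rewrite ?mulr0 ?addr0 ?mulrDr.
by rewrite big_split /=; ring.
Qed.

Lemma virZ d (a : C) phi I : vir d (fun J => a * phi J) I = a * vir d phi I.
Proof.
rewrite /vir.
have -> : linpart d (fun J => a * phi J) I = a * linpart d phi I.
  rewrite mulr_sumr; apply: eq_bigr => p _ /=; rewrite /lower.
  by case: (d + _)%N => [|e]; rewrite ?mulr0 ?addr0 //; ring.
rewrite -mulr_sumr shufC shufZl shufC; ring.
Qed.

Lemma vir_nil d phi : vir d phi [::] =
  2^-1 * (\sum_(b < d.-1) phi [:: nat_of_ord b; (d - 2 - b)%N])
  + (d == 1%N)%:R / 8 * phi [::].
Proof. by rewrite /vir /linpart big_nil shuf_nil mul0r mulr0 add0r addr0. Qed.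

End WordFunctions.

(** * Symmetry of the Virasoro operators *)

Section VirasoroSymmetry.
Variable C : numFieldType.
Implicit Types (phi psi chi : seq nat -> C) (I J : seq nat).

Lemma sym_shuf phi psi : sym phi -> sym psi -> sym (shuf phi psi).
Proof.
move=> sp sq I; elim: I phi psi sp sq => [|i I IH] phi psi sp sq k l J /=.
  rewrite !shuf_cons.
  rewrite (sym_derC k l sp) (sym_derC k l sq) -!addrA; congr (_ + _).
  by rewrite addrCA.
by rewrite !shuf_cons !(IH _ _ _ _ k l) //; apply: sym_der.
Qed.

Lemma sym_single0 : sym (single C [:: 0%N]).
Proof. by case=> [|i [|j I]] k l J; rewrite /single !eqseq_cons /= ?andbF. Qed.

Lemma sym_mul_t0 phi : sym phi -> sym (mul_t0 phi).
Proof. by move=> s; apply: sym_shuf => //; apply: sym_single0. Qed.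

Lemma lower0_cons n phi l I :
  sym phi -> lower0 n phi (l :: I) =
    lower0 n (der l phi) I + ((n == 0%N) && (l == 0%N))%:R * phi I.
Proof.
move=> s; case: n => [|n] /=; last by rewrite mul0r addr0 /der symE.
by rewrite mul_t0_cons addrC.
Qed.

Lemma sym_lower0 n phi : sym phi -> sym (lower0 n phi).
Proof. by case: n => [|n] s; [apply: sym_mul_t0|apply: sym_der]. Qed.

Lemma vir_cons2 d phi k l J : sym phi -> vir d phi [:: k, l & J] =
  vir d (der l (der k phi)) J + l.*2.+1%:R * lower0 (d + l) (der k phi) J +
  k.*2.+1%:R * (lower0 (d + k) (der l phi) J +
     ((d + k == 0)%N && (l == 0%N))%:R * phi J).
Proof.
by move=> s; rewrite !vir_cons ?lower0_cons //; apply: sym_der.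
Qed.

(** Commuting two derivatives past H_d produces terms that are symmetric in the two letters;
the one from differentiating D_{-1} = t_0 occurs only for d = k = l = 0. *)
Lemma sym_vir d phi : sym phi -> sym (vir d phi).
Proof.
move=> s I; elim: I phi s => [|i I IH] phi s k l J /=.
  rewrite !vir_cons2 // (sym_derC k l s) -!addrA; congr (_ + _).
  by case: d => [|d]; case: k => [|k]; case: l => [|l] //=; ring.
by rewrite 2?(vir_cons d i _ s) (IH _ (sym_der i s)) (sym_lower0 _ s).
Qed.

(** [H_d, D_{n-1}] = - (2n-1) D_{d+n-2}.  For n > 0 this is [vir_cons].  For n = 0 it concerns the
multiplication by t_0, and a second derivative D_b D_c of H_d meets t_0 only for b or c
equal to 0. *)
Lemma vir_lower0 d n phi I : sym phi -> (0 < d + n)%N ->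
  vir d (lower0 n phi) I =
  lower0 n (vir d phi) I - (n.*2%:R - 1) * lower0 (d + n).-1 phi I.
Proof.
move=> s; case: n => [|n] dn; last first.
  rewrite -[lower0 n.+1 phi]/(der n phi) -[lower0 n.+1 _ I]/(vir d phi (n :: I)).
  by rewrite vir_cons // addnS /= doubleS -[n.*2.+2%:R]natr1; ring.
case: d dn => [|d] // _; rewrite addn0 double0 sub0r mulN1r opprK -[lower0 0 phi]/(mul_t0 phi) /=.
elim: I phi s => [|l I IH] phi s.
  rewrite vir_nil !mul_t0_nil mulr0 addr0 add0r.
  case: d => [|d]; first by rewrite big_ord0 /= mul_t0_nil mulr0.
  under eq_bigr => b _ do rewrite mul_t0_cons /mul_t0 !shuf_cons !shuf_nil !der_single1 /der.
  rewrite /single /=.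
  rewrite big_split /= [X in _ * (_ + X)](bigD1 ord_max) //= [X in _ * (X + _)](bigD1 ord0) //=
    !big1.
  - rewrite /= subn0 (_ : d.+2 - 2 - d = 0)%N; last lia.
    rewrite (_ : d.+2 - 2 = d)%N; last lia.
    by rewrite eqxx /=; move: (phi [:: d]) (phi [:: d; 0%N]) => x y; field.
  - move=> b nb; have -> : (d.+2 - 2 - b == 0)%N = false by move: nb; rewrite -val_eqE /=;
    have := ltn_ord b; lia.
    by rewrite !(mul0r, mulr0, addr0).
  - by move=> b nb; have -> : (nat_of_ord b == 0)%N = false; rewrite ?mul0r //; apply: negbTE nb.
rewrite vir_cons; last exact: sym_mul_t0.
have dm : der l (mul_t0 phi) = (fun J => (l == 0%N)%:R * phi J) \+ mul_t0 (der l phi).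
  by apply/funext => J; rewrite /der mul_t0_cons.
have sl : sym (der l phi) by apply: sym_der.
rewrite dm virD virZ mul_t0_cons der_vir // lower0_cons //.
rewrite (_ : mul_t0 (_ \+ _) I = mul_t0 (vir d.+1 (der l phi)) I +
  l.*2.+1%:R * mul_t0 (lower0 (d.+1 + l) phi) I); last first.
  by rewrite /mul_t0 shufDr; congr (_ + _); rewrite shufC shufZl shufC.
rewrite IH //= mul_t0_cons -[lower0 (d.+1 + l) phi]/(der (d + l) phi) addn_eq0.
move: (mul_t0 (der _ _) I) => x; case: l {dm sl} => [|l] /=; last first.
  by rewrite andbF !mul0r !add0r addr0; ring.
by rewrite andbT double0; ring.
Qed.

(** The indices e and n - 1 - e carry the same term, and their mean is (n - 1) / 2. *)
Lemma sum_ord_antisym n (y : nat -> C) :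
  (forall e, (e < n)%N -> y (n.-1 - e)%N = y e) ->
  \sum_(e < n) (2 * e%:R) * y e = (n%:R - 1) * \sum_(e < n) y e.
Proof.
move=> ys.
have h : \sum_(e < n) e%:R * y e = \sum_(e < n) (n%:R - 1 - e%:R) * y e.
  rewrite (reindex_inj rev_ord_inj) /=; apply: eq_bigr => e _.
  have le := ltn_ord e; rewrite -[in RHS](ys e le) (_ : (n - e.+1 = n.-1 - e)%N); last by lia.
  congr (_ * _); rewrite natrB; last by lia.
  by rewrite -subn1 natrB //; lia.
rewrite mulr_sumr; under eq_bigr => e _ do rewrite mulr2n mulrDl mul1r mulrDl.
by rewrite big_split /= {1}h -big_split; apply: eq_bigr => e _ /=; ring.
Qed.

(** Both sums on the left run over one symmetric sequence, split at q and read from both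
ends; this is where the factor d - k of the Virasoro relations comes from. *)
Lemma sum_ord_shift p q (y : nat -> C) :
  (forall e, (e < p + q)%N -> y ((p + q).-1 - e)%N = y e) ->
  \sum_(b < p) b.*2.+1%:R * y (q + b)%N - \sum_(b < q) b.*2.+1%:R * y (p + b)%N =
  (p%:R - q%:R) * \sum_(e < p + q) y e.
Proof.
move=> ys.
have -> : (p%:R - q%:R) * \sum_(e < p + q) y e = \sum_(e < p + q) (2 * e%:R - 2 * q%:R + 1) * y e.
  rewrite [RHS](eq_bigr (fun e : 'I__ => 2 * e%:R * y e + (1 - 2 * q%:R) * y e)); last first.
    by move=> e _; ring.
  by rewrite big_split /= sum_ord_antisym // -mulr_sumr natrD; ring.
rewrite [in RHS](addnC p) big_split_ord /= [LHS]addrC; congr (_ + _); last first.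
  apply: eq_bigr => b _; congr (_ * _); rewrite -addn1 -muln2 !natrD natrM; ring.
rewrite -sumrN (reindex_inj rev_ord_inj) /=; apply: eq_bigr => e _.
have le := ltn_ord e; rewrite -(ys e); last by lia.
rewrite (_ : p + (q - e.+1) = (p + q).-1 - e)%N; last by lia.
by rewrite -mulNr; congr (_ * _); rewrite -addn1 natrD -muln2 natrM natrB //;
  rewrite -[e.+1]addn1 natrD; ring.
Qed.

Lemma sum_ord_rev2 d (G : nat -> nat -> C) :
  \sum_(b < d.-1) G b (d - 2 - b)%N = \sum_(b < d.-1) G (d - 2 - b)%N b.
Proof.
rewrite (reindex_inj rev_ord_inj) /=; apply: eq_bigr => b _.
by have lb := ltn_ord b; congr G; lia.
Qed.
End VirasoroSymmetry.

(** * The Virasoro relations *)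

Section VirasoroRelations.
Variable C : numFieldType.
Implicit Types (phi psi chi : seq nat -> C) (I J : seq nat).

Lemma vir_two k phi b c : sym phi -> vir k phi [:: b; c] =
  vir k (der c (der b phi)) [::] + c.*2.+1%:R * lower0 (k + c) (der b phi) [::] +
  b.*2.+1%:R * (lower0 (k + b) (der c phi) [::] +
     ((k + b == 0)%N && (c == 0%N))%:R * phi [::]).
Proof. exact: vir_cons2. Qed.

(** The case k = 0 of [vir_comm_nil].  Every term of H_0 has a factor t_j, so H_0 vanishes at the
empty word, and only the derivatives of H_{d+1} that hit these factors count. *)
Lemma vir_vir0_nil d phi : sym phi ->
  vir d.+1 (vir 0 phi) [::] = 2 * d.+1%:R * vir d phi [::].
Proof.
move=> s; rewrite !vir_nil /= big_ord0 mulr0 add0r mul0r mul0r mulr0 addr0.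
under eq_bigr => b _ do rewrite vir_two // !add0n vir_nil /=
  big_ord0 mulr0 add0r mul0r mul0r add0r mulrDr addrA.
rewrite big_split big_split /=.
rewrite -(sum_ord_rev2 d.+1 (fun b c => b.*2.+1%:R * lower0 b (der c phi) [::])) /=.
case: d => [|d].
  by rewrite !big_ord0 /= ; ring.
have e0 : \sum_(i < d.+1) i.*2.+1%:R * (((nat_of_ord i == 0%N) && ((d.+2 - 2 - i)%N ==
  0%N))%:R * phi [::])
  = (d == 0%N)%:R * phi [::].
  rewrite (bigD1 ord0) //= big1 ?addr0 ?mul1r; last first.
    by move=> i ni; rewrite (_ : (nat_of_ord i == 0%N) = false) /= ?mul0r ?mulr0 //;
      apply: negbTE ni.
  by rewrite (_ : d.+2 - 2 - 0 = d)%N; last lia.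
rewrite e0 big_ord_recl /= mul_t0_nil mulr0 add0r.
pose y e := phi [:: e; (d.-1 - e)%N].
have e1 : \sum_(i < d) (bump 0 i).*2.+1%:R * der (d.+2 - 2 - bump 0 i) phi [:: nat_of_ord i] =
  \sum_(e < d) (2 * e%:R) * y e + 3 * \sum_(e < d) y e.
  rewrite mulr_sumr -big_split; apply: eq_bigr => e _ /=; rewrite /bump /= add1n /der symE // /y.
  rewrite (_ : d.+2 - 2 - e.+1 = d.-1 - e)%N; last by have := ltn_ord e; lia.
  by rewrite -mulrDl; congr (_ * _); rewrite doubleS -addn3 -muln2 natrD natrM; ring.
rewrite e1 sum_ord_antisym; last first.
  move=> e le; rewrite /y symE //; congr phi; congr [:: _; _]; lia.
rewrite (_ : \sum_(b < d) phi [:: nat_of_ord b; (d.+1 - 2 - b)%N] = \sum_(e < d) y e); last first.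
  by apply: eq_bigr => b _; rewrite /y; congr phi; congr [:: _; _]; have := ltn_ord b; lia.
rewrite -[d.+2]addn2 natrD eqSS; case: d y {e0 e1} => [|d] y /=; rewrite ?big_ord0.
  by field.
by rewrite !mul0r addr0; field.
Qed.

(** The value at the empty word of the part of H_d H_k without any t_j: products of the second
order and constant terms of the two operators, which commute. *)
Definition pairpart d k phi : C :=
  2^-1 * (\sum_(b < d.-1) (2^-1 * (\sum_(b' < k.-1)
     phi [:: nat_of_ord b; (d - 2 - b)%N; nat_of_ord b'; (k - 2 - b')%N]) +
     (k == 1%N)%:R / 8 * phi [:: nat_of_ord b; (d - 2 - b)%N]))
  + (d == 1%N)%:R / 8 * (2^-1 * (\sum_(b' < k.-1)
     phi [:: nat_of_ord b'; (k - 2 - b')%N]) + (k == 1%N)%:R / 8 * phi [::]).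

Lemma pairpartC d k phi : sym phi -> pairpart d k phi = pairpart k d phi.
Proof.
move=> s; rewrite /pairpart !big_split /= -!mulr_sumr exchange_big /=.
rewrite (_ : \sum_(j < k.-1) \sum_(i < d.-1) _ = \sum_(i < k.-1) \sum_(i0 < d.-1)
          phi [:: nat_of_ord i; (k - 2 - i)%N; nat_of_ord i0; (d - 2 - i0)%N]); first by ring.
apply: eq_bigr => i _; apply: eq_bigr => j _.
move: (nat_of_ord i) (k - 2 - i)%N (nat_of_ord j) (d - 2 - j)%N => x y z t.
have s1 a b c e : phi [:: a; b; c; e] = phi [:: a; c; b; e] by apply: (s [:: a]).
have s2 a b c e : phi [:: a; b; c; e] = phi [:: a; b; e; c] by apply: (s [:: a; b]).
by rewrite (s1 z t) (symE z x) // (s2 x z) (s1 x z).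
Qed.

(** At the empty word, all terms with a factor t_j on the left vanish; beyond [pairpart],
only the derivatives of H_d that hit the factors t_j of H_k contribute. *)
Lemma vir_vir_nil d k phi : sym phi ->
  vir d.+1 (vir k.+1 phi) [::] = pairpart d.+1 k.+1 phi +
  \sum_(b < d) b.*2.+1%:R * phi [:: (k + b)%N; (d.-1 - b)%N].
Proof.
move=> s; rewrite vir_nil /= /pairpart [vir k.+1 phi [::]]vir_nil.
rewrite [RHS]addrAC; congr (_ + _).
rewrite (eq_bigr (fun b : 'I_d => vir k.+1 (der (d.+1 - 2 - b) (der b phi)) [::] +
   (d.+1 - 2 - b)%N.*2.+1%:R * phi [:: nat_of_ord b; (k + (d.+1 - 2 - b))%N] +
   b.*2.+1%:R * phi [:: (d.+1 - 2 - b)%N; (k + b)%N])); last first.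
  by move=> b _; rewrite vir_two //= mul0r addr0.
rewrite [in LHS]big_split [X in _ * (X + _) = _]big_split /= -addrA mulrDr; congr (_ + _).
  congr (_ * _); apply: eq_bigr => b _.
  by rewrite vir_nil /der /=.
rewrite (sum_ord_rev2 d.+1 (fun b c => c.*2.+1%:R * phi [:: b; (k + c)%N])) /=.
have half (x : C) : 2^-1 * (x + x) = x by field.
rewrite half.
apply: eq_bigr => b _; rewrite symE //; congr (_ * phi [:: _; _]).
by have := ltn_ord b; lia.
Qed.

Lemma vir_comm_nil d k phi : sym phi ->
  vir d.+1 (vir k phi) [::] - vir k (vir d.+1 phi) [::] =
  2 * (d.+1%:R - k%:R) * vir (d + k) phi [::].
Proof.
move=> s; case: k => [|k].
  rewrite vir_vir0_nil // addn0 [vir 0 _ _]vir_nil /= big_ord0; ring.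
rewrite !vir_vir_nil // (pairpartC _ _ s) opprD addrACA subrr add0r.
pose y e := phi [:: e; ((d + k).-1 - e)%N].
rewrite (eq_bigr (fun b : 'I_d => b.*2.+1%:R * y (k + b)%N)); last first.
  by move=> b _; congr (_ * phi [:: _; _]); have := ltn_ord b; lia.
rewrite [X in _ - X](eq_bigr (fun b : 'I_k => b.*2.+1%:R * y (d + b)%N)); last first.
  by move=> b _; congr (_ * phi [:: _; _]); have := ltn_ord b; lia.
rewrite sum_ord_shift; last first.
  by move=> e le; rewrite /y symE //; congr phi; congr [:: _; _]; lia.
rewrite vir_nil addnS /= [in RHS](eq_bigr (fun b : 'I_(d + k) => y b)); last first.
  by move=> b _; congr (phi [:: _; _]); have := ltn_ord b; lia.
rewrite eqSS addn_eq0 -[d.+1]addn1 -[k.+1]addn1 !natrD.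
move: (\sum_(e < d + k) y e) => S.
case: d {y} => [|d]; case: k => [|k]; rewrite ?andbF ?andbT /= ?mul0r; by field.
Qed.

(** [H_{d+1}, H_k] = 2 (d + 1 - k) H_{d+k}.  Both sides satisfy the same commutation rule with
every D_l, by [vir_cons] and [vir_lower0], so the induction on the word reduces the claim to
the empty word. *)
Lemma vir_comm d k phi I : sym phi ->
  vir d.+1 (vir k phi) I - vir k (vir d.+1 phi) I =
  2 * (d.+1%:R - k%:R) * vir (d + k) phi I.
Proof.
elim: I phi => [|l I IH] phi s; first exact: vir_comm_nil.
have sl := sym_der l s.
rewrite (vir_cons d.+1 l _ (sym_vir k s)) (vir_cons k l _ (sym_vir d.+1 s)) !der_vir //.
rewrite (virD d.+1 (vir k (der l phi))) (virD k (vir d.+1 (der l phi))).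
rewrite (virZ d.+1 _ (lower0 (k + l) phi)) (virZ k _ (lower0 (d.+1 + l) phi)).
rewrite (vir_cons (d + k) l _ s).
rewrite [vir d.+1 (lower0 _ _) I]vir_lower0 //.
rewrite [vir k (lower0 _ _) I]vir_lower0 //; last by lia.
rewrite [RHS]mulrDr -(IH _ sl).
rewrite (_ : (d.+1 + (k + l)).-1 = d + k + l)%N; last lia.
rewrite (_ : (k + (d.+1 + l)).-1 = d + k + l)%N; last lia.
rewrite -![(_ + l).*2]muln2 !natrM !natrD -[d.+1]addn1 natrD. ring.
Qed.
End VirasoroRelations.

(** * Connected and disconnected correlators *)

Section Correlators.
Variable C : numFieldType.
Implicit Types (phi psi chi : seq nat -> C) (I J : seq nat).

(** H_d lowers the weight, counted with the letter d in front, by exactly 3. *)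
Lemma vir_local d phi psi I :
  (forall J, (wt J + 3)%N = wt (d :: I) -> phi J = psi J) ->
  vir d phi I = vir d psi I.
Proof.
move=> e; rewrite /vir; congr (_ + _ + _ + _).
- apply: eq_big_seq => -[j J] /picks_wt w; rewrite /lower /= in w *.
  case dp: (d + j)%N => [|n] //; congr (_ * _); apply: e.
  by rewrite !wt_cons -w; lia.
- congr (_ * _); apply: eq_bigr => b _; apply: e; rewrite !wt_cons.
  have := ltn_ord b; lia.
- case: d e => [|d] e; last by rewrite !mul0r.
  congr (_ * _); apply: eq_big_seq => -[X Y] /splits_wt w; rewrite /single /= in w *.
  case: eqP => [p1|]; rewrite ?mul0r //; congr (_ * _); apply: e.
  by rewrite wt_cons -w p1 !wt_cons [wt [::]]/wt /=; lia.
- case: d e => [|[|d]] e /=; rewrite ?mul0r //; congr (_ * _); apply: e.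
  by rewrite wt_cons; lia.
Qed.

Lemma vir0 d I : vir d (fun=> 0 : C) I = 0.
Proof.
rewrite -[RHS](mul0r (vir d (fun=> 0 : C) I)) -virZ.
by congr (vir d _ I); apply/funext => J; rewrite mul0r.
Qed.

Fixpoint wfix_fuel (n : nat) (c : C) (Phi : (seq nat -> C) -> nat -> seq nat -> C)
    (I : seq nat) : C :=
  if n is n'.+1 then
    if I is d :: I' then Phi (wfix_fuel n' c Phi) d I' else c
  else 0.

(** Solution of phi (d :: I) = Phi phi d I with value c at the empty word, when Phi looks only at
words of smaller weight.  The weight serves as fuel. *)
Definition wfix c Phi I : C := wfix_fuel (wt I).+1 c Phi I.

Lemma wfix_cons c Phi :
  (forall phi psi d I, (forall J, (wt J < wt (d :: I))%N -> phi J = psi J) ->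
     Phi phi d I = Phi psi d I) ->
  forall d I, wfix c Phi (d :: I) = Phi (wfix c Phi) d I.
Proof.
move=> loc.
have st n m I : (wt I < n)%N -> (wt I < m)%N ->
    wfix_fuel n c Phi I = wfix_fuel m c Phi I.
  elim: n m I => [|n IH] [|m] [|d I] // nI mI /=; apply: loc => J JI.
  by apply: IH; lia.
move=> d I; rewrite [LHS]/wfix -[LHS]/(Phi (wfix_fuel (wt (d :: I)) c Phi) d I).
by apply: loc => J JI; apply: st.
Qed.

(** The recursion for log Z that corresponds to D_d Z = H_d Z: D_b D_c Z / Z has the
extra term D_b log Z * D_c log Z, and the terms without derivative stand alone. *)
Definition conn phi d I : C :=
  linpart d phi I + 2^-1 * (\sum_(b < d.-1) phi [:: nat_of_ord b, (d - 2 - b)%N & I])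
  + 2^-1 * (\sum_(b < d.-1) shuf (der b phi) (der (d - 2 - b) phi) I)
  + (d == 0%N)%:R * single C [:: 0%N; 0%N] I + (d == 1%N)%:R / 8 * single C [::] I.

(** Connected correlators F(d_1, ..., d_n), of all genera together. *)
Definition corr : seq nat -> C := wfix 0 conn.

Lemma corr_nil : corr [::] = 0. Proof. by []. Qed.

Lemma conn_local phi psi d I :
  (forall J, (wt J < wt (d :: I))%N -> phi J = psi J) -> conn phi d I = conn psi d I.
Proof.
move=> e; rewrite /conn; congr (_ + _ + _ + _ + _).
- apply: eq_big_seq => -[j J] /picks_wt w; rewrite /lower /= in w *.
  case dp: (d + j)%N => [|n] //; congr (_ * _); apply: e.
  by rewrite !wt_cons -w; lia.
- congr (_ * _); apply: eq_bigr => b _; apply: e; rewrite !wt_cons.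
  have := ltn_ord b; lia.
- congr (_ * _); apply: eq_bigr => b _; apply: eq_shuf => -[X Y] /splits_wt /= w.
  by have := ltn_ord b; split; apply: e; rewrite !wt_cons; lia.
Qed.

Lemma corr_cons d I : corr (d :: I) = conn corr d I.
Proof. exact/wfix_cons/conn_local. Qed.

(** The relation \sum_i (2 d_i + 1) = 6g - 6 + 3n, written without subtraction. *)
Definition of_genus g I := (wt I + 6 == 6 * g + 3 * size I)%N.

Lemma corr_genus I : corr I != 0 -> exists g, of_genus g I.
Proof.
have [n] := ubnP (wt I); elim: n I => // n IH [|d I] In; first by rewrite corr_nil eqxx.
apply: contra_neqP => ng; rewrite corr_cons /conn.
have z J (P : (exists g, of_genus g J) -> exists g, of_genus g (d :: I)) :
    (wt J < wt (d :: I))%N -> corr J = 0.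
  by move=> JI; apply/eqP; apply: contra_notT ng => J0; apply: P; apply: IH => //; lia.
have -> : linpart d corr I = 0.
  rewrite /linpart big_seq big1 // => -[j J] pI; rewrite /lower /=.
  have /= w := picks_wt pI; have /= sp := picks_size pI.
  case dp: (d + j)%N => [|e]; rewrite ?mulr0 // z ?mulr0 //.
    move=> [g]; rewrite /of_genus !wt_cons /= => /eqP gJ; exists g; apply/eqP.
    rewrite ?wt_cons /=; lia.
  by rewrite !wt_cons; lia.
rewrite big1 ?mulr0; last first.
  move=> b _; have lb := ltn_ord b; apply: z; last by rewrite !wt_cons; lia.
  move=> [g]; rewrite /of_genus !wt_cons /= => /eqP gJ; exists g.+1; apply/eqP.
  rewrite ?wt_cons /=; lia.
rewrite big1 ?mulr0; last first.
  move=> b _; have lb := ltn_ord b; rewrite /shuf big_seq big1 // => -[X Y] pI.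
  have /= wp := splits_wt pI; have /= sp := splits_size pI; rewrite /der.
  apply/eqP; apply: contra_notT ng; rewrite mulf_eq0 negb_or => /andP[n1 n2].
  have [|g1 /eqP] := IH _ _ n1; first by rewrite !wt_cons in In *; lia.
  have [|g2 /eqP] := IH _ _ n2; first by rewrite !wt_cons in In *; lia.
  rewrite !wt_cons /= => e1 e2; exists (g1 + g2)%N; apply/eqP; rewrite ?wt_cons /=; lia.
rewrite /single; case: d {z} ng In => [|[|d]] ng In /=; rewrite ?mul0r ?add0r ?addr0 //.
- by rewrite mul1r; case: eqP => // I0; case: ng; exists 0%N; rewrite I0.
- by case: eqP => [I0|]; rewrite ?mulr0 //; case: ng; exists 1%N; rewrite I0.
Qed.

(** Z = exp F, defined through D_d Z = (D_d F) Z. *)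
Definition dcorr : seq nat -> C := wfix 1 (fun phi d => shuf (der d corr) phi).

Lemma dcorr_nil : dcorr [::] = 1. Proof. by []. Qed.

Lemma dcorr_cons d I : dcorr (d :: I) = shuf (der d corr) dcorr I.
Proof.
apply: wfix_cons => phi psi {}d {}I e; apply: eq_shuf => -[X Y] /splits_wt /= w; split=> //.
by apply: e; rewrite wt_cons; lia.
Qed.

Lemma der_dcorr d : der d dcorr = shuf (der d corr) dcorr.
Proof. by apply/funext => I; rewrite /der dcorr_cons. Qed.

Lemma linpart_dcorr d I : linpart d dcorr I = shuf (linpart d corr) dcorr I.
Proof.
pose G j X Y := j.*2.+1%:R * (lower (d + j) corr X * dcorr Y).
transitivity (\sum_(p <- splits I) \sum_(q <- picks p.1) G q.1 q.2 p.2); last first.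
  by apply: eq_bigr => p _; rewrite mulr_suml; apply: eq_bigr => q _; rewrite /G mulrA.
rewrite sum_splits_picks; apply: eq_bigr => q _; rewrite -mulr_sumr; congr (_ * _).
rewrite /lower; case: (d + _)%N => [|e]; last exact: dcorr_cons.
by rewrite big1 // => p _; rewrite mul0r.
Qed.

(** The product rule turns the quadratic recursion for F into a linear one for exp F. *)
Lemma dcorr_vir d I : dcorr (d :: I) = vir d dcorr I.
Proof.
rewrite dcorr_cons /vir linpart_dcorr.
rewrite (_ : der d corr = conn corr d); last by apply/funext => J; rewrite /der corr_cons.
pose F1 (b : 'I_d.-1) J := corr [:: nat_of_ord b, (d - 2 - b)%N & J].
pose F2 (b : 'I_d.-1) := shuf (der b corr) (der (d - 2 - b) corr).
rewrite (eq_bigr (fun b => shuf (F1 b) dcorr I + shuf (F2 b) dcorr I)); last first.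
  move=> b _; rewrite -[LHS]/(der (d - 2 - b) (der b dcorr) I) der_dcorr der_shuf der_dcorr.
  by rewrite /= shufA.
rewrite big_split /= -!shuf_suml mulrDr -!shufZl.
rewrite -(shuf1l dcorr I) -!shufZl -!shufDl.
by congr shuf; apply/funext => J; rewrite /= /conn /F1 /F2 addrA.
Qed.

(** The part of Z of weight 3m.  Since H_d lowers the weight by 3, the layers are computed from
one another by applications of H_d to the whole previous layer; the Virasoro
relations apply to these, whereas a single value of Z does not determine a
function to which they could be applied. *)
Fixpoint layer (m : nat) (I : seq nat) : C :=
  if m is m'.+1 then if I is d :: I' then vir d (layer m') I' else 0
  else single C [::] I.

Lemma natr_odd n : n.*2.+1%:R = 2 * n%:R + 1 :> C.
Proof. by rewrite -addn1 -muln2 natrD natrM mulrC. Qed.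

(** D_k D_d Z = D_k H_d Z = H_d H_k Z + (2k+1) H_{d+k-1} Z, and the antisymmetric part in d and k is
[H_d, H_k] Z - 2 (d - k) H_{d+k-1} Z = 0. *)
Lemma sym_layer m : sym (layer m).
Proof.
elim/ltn_ind: m => -[_|m IH]; first by move=> [|i I] k l J.
have s := IH m (leqnn _).
move=> [|i I] k l J /=; last exact: sym_vir.
rewrite !vir_cons //; case: m IH s => [|m] IH s.
  have d0 n : der n (layer 0) = fun=> 0 by [].
  rewrite !d0 !vir0.
  case: k => [|k]; case: l => [|l] //=; rewrite /single /=; ring.
have dv n : der n (layer m.+1) = vir n (layer m) by [].
have sm := IH m (leqW (leqnn _)).
rewrite !dv addnC; case: k => [|k].
  case: l => [|l] //; have := vir_comm l 0 J sm; rewrite !addn0 /= => e.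
  rewrite -[X in X + _](subrK (vir l.+1 (vir 0 (layer m)) J)) -opprB e.
  by rewrite !natr_odd; ring.
have := vir_comm k l J sm; rewrite !addnS /= => e.
rewrite -[X in X + _](subrK (vir l (vir k.+1 (layer m)) J)) e addnC.
by rewrite !natr_odd; ring.
Qed.

Lemma dcorr_layer I : dcorr I = if (3 %| wt I)%N then layer (wt I %/ 3) I else 0.
Proof.
have [n] := ubnP (wt I); elim: n I => // n IH [|d I] In; first by rewrite dcorr_nil.
rewrite dcorr_vir; case: ifP => [/dvdnP[[|m] wE]|nd].
- by move: wE; rewrite wt_cons; lia.
- rewrite wE mulnK //=; apply: vir_local => J JI.
  have wJ : wt J = (m * 3)%N by lia.
  by rewrite IH; [rewrite wJ dvdn_mull ?mulnK | lia].
- rewrite -(vir0 d I); apply: vir_local => J JI; rewrite IH; last by lia.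
  by case: ifP => // dJ; move: nd; rewrite -JI dvdn_addr ?dJ.
Qed.

Lemma wt_swap I k l J : wt (I ++ [:: k, l & J]) = wt (I ++ [:: l, k & J]).
Proof. by rewrite /wt !map_cat !sumn_cat /=; congr addn; rewrite addnCA. Qed.

Lemma sym_dcorr : sym dcorr.
Proof. by move=> I k l J; rewrite !dcorr_layer wt_swap sym_layer. Qed.

Lemma shuf_top chi psi I : (forall X, (size X < size I)%N -> chi X = 0) ->
  shuf chi psi I = chi I * psi [::].
Proof.
elim: I chi psi => [|k I IH] chi psi e; first by rewrite shuf_nil.
rewrite shuf_cons IH; last by move=> X XI; apply: e.
rewrite [X in _ + X](_ : _ = 0) ?addr0 // /shuf big_seq big1 // => -[X Y] /splits_size /= sp.
by rewrite e ?mul0r //=; lia.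
Qed.

(** A generating function with constant term 1 is not a zero divisor. *)
Lemma shuf_cancel chi psi : psi [::] = 1 -> (forall I, shuf chi psi I = 0) ->
  forall I, chi I = 0.
Proof.
move=> p1 e I; have [n] := ubnP (size I); elim: n I => // n IH I In.
rewrite -[chi I]mulr1 -p1 -shuf_top // => X XI; apply: IH; lia.
Qed.

(** D_l D_k Z = (D_l D_k F + D_k F D_l F) Z, so the symmetry of Z passes to the first two letters
of F after cancelling the factor Z. *)
Lemma corr_swap2 k l I : corr [:: k, l & I] = corr [:: l, k & I].
Proof.
apply/eqP; rewrite -subr_eq0; apply/eqP.
move: I; apply: (@shuf_cancel (fun I => corr [:: k, l & I] - corr [:: l, k & I]) _ dcorr_nil) => I.
have e a b : dcorr [:: a, b & I] = shuf (der b (der a corr)) dcorr I +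
    shuf (shuf (der a corr) (der b corr)) dcorr I.
  by rewrite -[LHS]/(der b (der a dcorr) I) der_dcorr der_shuf der_dcorr /= shufA.
have := symE k l I sym_dcorr; rewrite !e.
rewrite (_ : shuf (der l corr) (der k corr) = shuf (der k corr) (der l corr)); last first.
  by apply/funext => J; rewrite shufC.
move/addIr/eqP; rewrite -subr_eq0 => /eqP e0; rewrite -[RHS]e0.
rewrite -[X in _ = _ + X]mulN1r -shufZl -shufDl; congr shuf.
by apply/funext => J /=; rewrite mulN1r.
Qed.

(** In D_i Z = (D_i F) Z the values of F on shorter words are symmetric by induction, and the
longest word enters only through the constant term 1 of Z. *)
Lemma sym_corr : sym corr.
Proof.
suff h n I k l J : (size (I ++ [:: k, l & J]) <= n)%N ->
    corr (I ++ [:: k, l & J]) = corr (I ++ [:: l, k & J]).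
  by move=> I k l J; apply: h (leqnn _).
elim: n I k l J => [|n IH] [|i I] k l J //.
  by move=> _; apply: corr_swap2.
rewrite !cat_cons => sn0; have sn : (size (I ++ [:: k, l & J]) <= n)%N := sn0.
(* The truncation of corr to words of length at most n is symmetric by induction. *)
pose cut J := if (size J <= n)%N then corr J else 0.
have sz I' k' l' J' : size (I' ++ [:: k', l' & J']) = size (I' ++ [:: l', k' & J']).
  by rewrite !size_cat.
have sc : sym cut by move=> I' k' l' J'; rewrite /cut sz; case: ifP => // /IH ->; rewrite ?sz.
have top W : (size W <= n)%N -> corr (i :: W) = dcorr (i :: W) - shuf (der i cut) dcorr W +
    cut (i :: W).
  move=> Wn; rewrite dcorr_cons -mulN1r -shufZl -shufDl shuf_top.
    by rewrite dcorr_nil mulr1 /= /der; ring.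
  by move=> X XW; rewrite /= /der /cut /= (leq_trans XW Wn); ring.
have sn' := sn; rewrite sz in sn'.
rewrite (top _ sn) (top _ sn'); congr (_ - _ + _).
- exact: (sym_dcorr (i :: I)).
- exact: (sym_shuf (sym_der i sc) sym_dcorr).
- exact: (sc (i :: I)).
Qed.
End Correlators.

(** * Specialization to one variable *)

Section Specialization.
Variable C : numFieldType.
Implicit Types (phi psi chi : seq nat -> C) (I J : seq nat) (F G : nat -> nat -> C) (a : C).

Lemma sum_ord_widen (V : nmodType) n m (F : nat -> V) : (n <= m)%N ->
  (forall i, (n <= i)%N -> F i = 0) -> \sum_(i < n) F i = \sum_(i < m) F i.
Proof.
move=> nm F0; have [k mk] : exists k, (m = n + k)%N by exists (m - n)%N; lia.
rewrite mk big_split_ord /= [X in _ = _ + X]big1 ?addr0 //.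
by move=> i _; apply: F0; rewrite leq_addr.
Qed.

Lemma sum_ord_guard (V : nmodType) K c (g : nat -> V) :
  \sum_(i < K) (if (c <= i)%N then g (i - c)%N else 0) = \sum_(j < K - c) g j.
Proof.
have [cK|Kc] := leqP c K; last first.
  rewrite (_ : K - c = 0)%N ?big_ord0; last lia.
  by rewrite big1 // => i _; rewrite leqNgt (ltn_trans (ltn_ord i) Kc).
have [m Km] : exists m, (K = c + m)%N by exists (K - c)%N; lia.
rewrite {cK}Km addKn big_split_ord /= big1 ?add0r; last first.
  by move=> i _; rewrite leqNgt ltn_ord.
by apply: eq_bigr => i _; rewrite leq_addr addKn.
Qed.

Lemma sum_antidiag (V : nmodType) K (G : nat -> nat -> V) :
  (forall i j, (K <= i + j)%N -> G i j = 0) ->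
  \sum_(i < K) \sum_(j < K) G i j = \sum_(x < K) \sum_(i < x.+1) G i (x - i)%N.
Proof.
move=> G0; transitivity (\sum_(x < K) \sum_(i < K) if (i <= x)%N then G i (x - i)%N else 0).
  rewrite [RHS]exchange_big /=; apply: eq_bigr => i _.
  rewrite (sum_ord_guard K i (G i)); symmetry.
  apply: (sum_ord_widen (F := G i)); first exact: leq_subr.
  by move=> j Kj; apply: G0; lia.
apply: eq_bigr => x _; have xK := ltn_ord x.
rewrite -(@sum_ord_widen _ x.+1 K (fun i => if (i <= x)%N then G i (x - i)%N else 0)) //.
  by apply: eq_bigr => i _; rewrite -ltnS ltn_ord.
by move=> i xi; rewrite leqNgt xi.
Qed.

(** Coefficient of t^n in \sum_d t^(2d+1) F_d(t), where F d m is the coefficient of t^m in F_d. *)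
Definition osum (F : nat -> nat -> C) (n : nat) : C :=
  \sum_(d < n) if (d.*2.+1 <= n)%N then F d (n - d.*2.+1)%N else 0.

Lemma osumE N F n : (n <= N)%N ->
  osum F n = \sum_(d < N) if (d.*2.+1 <= n)%N then F d (n - d.*2.+1)%N else 0.
Proof.
move=> nN; apply: (sum_ord_widen
  (F := fun d => if (d.*2.+1 <= n)%N then F d (n - d.*2.+1)%N else 0)) => // i ni.
by case: ifP => //; lia.
Qed.

Lemma eq_osum F G n :
  (forall d m, (d.*2.+1 + m)%N = n -> F d m = G d m) -> osum F n = osum G n.
Proof. by move=> e; apply: eq_bigr => d _; case: ifP => // le; apply: e; lia. Qed.

Lemma osum_eq0 F n : (forall d m, F d m = 0) -> osum F n = 0.
Proof. by move=> e; rewrite /osum big1 // => d _; rewrite e; case: ifP. Qed.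

Lemma osumD F G n : osum (fun d m => F d m + G d m) n = osum F n + osum G n.
Proof. by rewrite /osum -big_split; apply: eq_bigr => d _ /=; case: ifP; rewrite ?addr0. Qed.

Lemma osumZ a F n : osum (fun d m => a * F d m) n = a * osum F n.
Proof. by rewrite /osum mulr_sumr; apply: eq_bigr => d _; case: ifP; rewrite ?mulr0. Qed.

Lemma osum_sum K (F : 'I_K -> nat -> nat -> C) n :
  osum (fun d m => \sum_(k < K) F k d m) n = \sum_(k < K) osum (F k) n.
Proof.
rewrite exchange_big; apply: eq_bigr => d _ /=.
by case: ifP => // _; rewrite big1.
Qed.

Lemma osum_osumE N (G : nat -> nat -> nat -> C) n : (n <= N)%N ->
  osum (fun d => osum (G d)) n = \sum_(d < N) \sum_(e < N)
    if (d.*2.+1 + e.*2.+1 <= n)%N then G d e (n - (d.*2.+1 + e.*2.+1))%N else 0.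
Proof.
move=> nN; rewrite (osumE _ nN); apply: eq_bigr => d _; case: ifP => dn; last first.
  by rewrite big1 // => e _; case: ifP => //; lia.
rewrite (@osumE N); last by lia.
by apply: eq_bigr => e _; rewrite leq_subRL // subnDA.
Qed.

Lemma osum_exch (G : nat -> nat -> nat -> C) n :
  osum (fun d => osum (G d)) n = osum (fun e => osum (fun d => G d e)) n.
Proof.
rewrite !(@osum_osumE n) // exchange_big /=.
by apply: eq_bigr => e _; apply: eq_bigr => d _; rewrite addnC.
Qed.

(** t d/dt acts on each factor t^(2d+1) and on each F_d. *)
Lemma osum_euler F n :
  n%:R * osum F n = osum (fun d m => d.*2.+1%:R * F d m) n + osum (fun d m => m%:R * F d m) n.
Proof.
rewrite -osumD -osumZ; apply: eq_osum => d m <-.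
by rewrite natrD mulrDl.
Qed.

Definition conv (a b : nat -> C) n : C := \sum_(i < n.+1) a i * b (n - i)%N.

Lemma conv_osum F b n : conv (osum F) b n = osum (fun d => conv (F d) b) n.
Proof.
rewrite /conv; under eq_bigr => i _ do
  rewrite (@osumE n) ?[(i <= n)%N]leq_ord // mulr_suml.
rewrite exchange_big; apply: eq_bigr => d _ /=.
case: ifP => dn; last first.
  rewrite big1 // => i _; have := ltn_ord i; case: ifP; rewrite ?mul0r //; lia.
rewrite -subSn // -(sum_ord_guard n.+1 d.*2.+1 (fun m => F d m * b (n - d.*2.+1 - m)%N)).
apply: eq_bigr => i _; case: ifP => [le|]; rewrite ?mul0r // -subnDA subnKC //.
Qed.

Lemma convC (a b : nat -> C) n : conv a b n = conv b a n.
Proof.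
rewrite /conv (reindex_inj rev_ord_inj); apply: eq_bigr => i _ /=.
by rewrite subSS subKn 1?mulrC // -ltnS.
Qed.

Lemma conv_euler (a b : nat -> C) n : n%:R * conv a b n =
  conv (fun i => i%:R * a i) b n + conv a (fun i => i%:R * b i) n.
Proof.
rewrite -big_split mulr_sumr; apply: eq_bigr => i _ /=.
rewrite [n%:R](_ : _ = i%:R + (n - i)%:R :> C); first by ring.
by rewrite -natrD subnKC // -ltnS.
Qed.

(** Coefficient of t^n in the terms of degree k in the times at t_d = t^(2d+1) / (2d+1), without
the factor 1 / k!. *)
Fixpoint diagk (k : nat) phi (n : nat) : C :=
  if k is k'.+1 then osum (fun d m => diagk k' (der d phi) m / d.*2.+1%:R) n
  else (n == 0%N)%:R * phi [::].

Lemma eq_diagk k phi psi n :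
  (forall I, size I = k -> wt I = n -> phi I = psi I) -> diagk k phi n = diagk k psi n.
Proof.
elim: k phi psi n => [|k IH] phi psi n e /=.
  by case: eqP => [n0|]; rewrite ?mul0r // e // n0.
apply: eq_osum => d m dm; congr (_ / _); apply: IH => I sI wI; apply: e => /=.
  by rewrite sI.
by rewrite wt_cons wI.
Qed.

Lemma diagk0 k n : diagk k (fun=> 0) n = 0.
Proof.
elim: k n => [|k IH] n /=; first by rewrite mulr0.
by apply: osum_eq0 => d m; rewrite IH mul0r.
Qed.

Lemma diagk_big k phi n : (n < k)%N -> diagk k phi n = 0.
Proof.
elim: k phi n => [|k IH] phi n //= nk.
by rewrite /osum big1 // => d _; case: ifP => // le; rewrite IH ?mul0r //; lia.
Qed.

Lemma diagkD k phi psi n : diagk k (phi \+ psi) n = diagk k phi n + diagk k psi n.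
Proof.
elim: k phi psi n => [|k IH] phi psi n /=; first by rewrite mulrDr.
by rewrite -osumD; apply: eq_osum => d m _; rewrite -mulrDl -IH.
Qed.

Lemma diagkZ k a phi n : diagk k (fun I => a * phi I) n = a * diagk k phi n.
Proof.
elim: k phi n => [|k IH] phi n /=; first by rewrite mulrCA.
by rewrite -osumZ; apply: eq_osum => d m _; rewrite mulrA -IH.
Qed.

Lemma oddn_neq0 d : d.*2.+1%:R != 0 :> C. Proof. by rewrite pnatr_eq0. Qed.

(** By symmetry the derivative t d/dt may act on the first of the k + 1 letters only. *)
Lemma diagk_euler k phi n : sym phi ->
  n%:R * diagk k.+1 phi n = k.+1%:R * osum (fun d => diagk k (der d phi)) n.
Proof.
elim: k phi n => [|k IH] phi n s.
  rewrite [LHS]osum_euler [X in _ + X](_ : _ = 0); last first.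
    by apply: osum_eq0 => d [|m] /=; rewrite ?mul0r ?mulr0.
  rewrite addr0 mul1r; apply: eq_osum => d m _ /=.
  by rewrite mulrC divfK ?oddn_neq0.
rewrite [LHS]osum_euler -natr1 mulrDl mul1r addrC; congr (_ + _); last first.
  by apply: eq_osum => d m _; rewrite mulrC divfK ?oddn_neq0.
pose G d e m := k.+1%:R * (diagk k (der e (der d phi)) m / d.*2.+1%:R).
transitivity (osum (fun d => osum (G d)) n).
  apply: eq_osum => d m _; rewrite mulrA (IH _ _ (sym_der d s)) mulrAC -osumZ.
  by apply: eq_osum => e i _; rewrite /G; ring.
rewrite osum_exch -osumZ; apply: eq_osum => e m _; rewrite /= -osumZ.
by apply: eq_osum => d i _; rewrite /G (sym_derC e d s).
Qed.

(** Coefficient of t^n in the generating function at t_d = t^(2d+1) / (2d+1); words longer than n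
have weight above n, so the truncation is exact. *)
Definition diag phi n : C := \sum_(k < n.+1) diagk k phi n / k`!%:R.

Lemma diagE N phi n : (n < N)%N -> diag phi n = \sum_(k < N) diagk k phi n / k`!%:R.
Proof.
by move=> nN; apply: (sum_ord_widen (F := fun k => diagk k phi n / k`!%:R)) => // i ni;
  rewrite diagk_big ?mul0r.
Qed.

Lemma diag0 phi : diag phi 0 = phi [::].
Proof. by rewrite /diag big_ord1 /= mul1r divr1. Qed.

Lemma diagD phi psi n : diag (phi \+ psi) n = diag phi n + diag psi n.
Proof. by rewrite -big_split; apply: eq_bigr => k _; rewrite diagkD mulrDl. Qed.

Lemma diagZ a phi n : diag (fun I => a * phi I) n = a * diag phi n.
Proof. by rewrite /diag mulr_sumr; apply: eq_bigr => k _; rewrite diagkZ mulrA. Qed.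

Lemma diag_zero n : diag (fun=> 0) n = 0.
Proof. by rewrite /diag big1 // => k _; rewrite diagk0 mul0r. Qed.

Lemma diag_sum K (F : 'I_K -> seq nat -> C) n :
  diag (fun I => \sum_(i < K) F i I) n = \sum_(i < K) diag (F i) n.
Proof.
elim: K F => [|K IH] F.
  rewrite big_ord0 -[RHS](diag_zero n); congr (diag _ n).
  by apply/funext => I; rewrite big_ord0.
rewrite big_ord_recl -(IH (fun i => F (lift ord0 i))) -diagD; congr (diag _ n).
by apply/funext => I; rewrite big_ord_recl.
Qed.

(** The chain rule t d/dt = \sum_d t^(2d+1) D_d on the specialization. *)
Lemma diag_euler phi n : sym phi ->
  n%:R * diag phi n = osum (fun d => diag (der d phi)) n.
Proof.
move=> s; rewrite /diag big_ord_recl mulrDr.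
rewrite [X in X + _](_ : _ = 0); last by case: n => [|n] /=; rewrite ?mul0r ?mul0r ?mulr0.
rewrite add0r mulr_sumr.
transitivity (osum (fun d m => \sum_(k < n) diagk k (der d phi) m / k`!%:R) n).
  rewrite osum_sum; apply: eq_bigr => k _; rewrite mulrA lift0 diagk_euler //.
  rewrite factS natrM invfM; under [RHS]eq_osum => d m _ do rewrite mulrC.
  rewrite osumZ -[k.+1]add1n natrD.
  have k1 : 1 + k%:R != 0 :> C by rewrite nat1r pnatr_eq0.
  have kf : k`!%:R != 0 :> C by rewrite pnatr_eq0 -lt0n fact_gt0.
  by field; rewrite k1 kf.
by apply: eq_osum => d m dm; rewrite -(@diagE n) //; lia.
Qed.

(** Specialization is multiplicative.  Both sides have the same value at t = 0, and t d/dt is a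
derivation of both products. *)
Lemma diag_shuf phi psi n : sym phi -> sym psi ->
  diag (shuf phi psi) n = conv (diag phi) (diag psi) n.
Proof.
elim/ltn_ind: n phi psi => -[_|n IH] phi psi sp sq.
  by rewrite /conv big_ord1 !diag0 shuf_nil.
apply: (@mulfI _ n.+1%:R); first by rewrite pnatr_eq0.
rewrite diag_euler; last exact: sym_shuf.
rewrite conv_euler.
rewrite (_ : (fun i => i%:R * diag phi i) = osum (fun d => diag (der d phi))); last first.
  by apply/funext => i; rewrite diag_euler.
rewrite (_ : (fun i => i%:R * diag psi i) = osum (fun d => diag (der d psi))); last first.
  by apply/funext => i; rewrite diag_euler.
rewrite [X in _ + X]convC !conv_osum -osumD; apply: eq_osum => d m dm.
have lm : (m < n.+1)%N by lia.
rewrite der_shuf diagD (IH _ lm _ _ (sym_der d sp) sq) (IH _ lm _ _ sp (sym_der d sq)).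
by congr (_ + _); apply: convC.
Qed.

Lemma sym_lower n phi : sym phi -> sym (lower n phi).
Proof. by case: n => [|n] s //; apply: sym_der. Qed.

Lemma sym_linpart d phi : sym phi -> sym (linpart d phi).
Proof.
move=> s I; elim: I phi s => [|i I IH] phi s k l J /=.
  rewrite (linpart_cons d k _ s) (linpart_cons d l _ s).
  rewrite (linpart_cons d l _ (sym_der k s)) (linpart_cons d k _ (sym_der l s)).
  rewrite (sym_derC k l s) !addrA; congr (_ + _).
  rewrite addrC; congr (_ * _ + _ * _); rewrite /lower /der.
    by case: (d + l)%N => // e; apply: symE.
  by case: (d + k)%N => // e; apply: symE.
by rewrite 2?(linpart_cons d i _ s) (IH _ (sym_der i s)) (sym_lower _ s).
Qed.

Lemma der_lower n k phi : sym phi -> der k (lower n phi) = lower n (der k phi).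
Proof.
by move=> s; apply/funext => I; rewrite /der /lower; case: n => // n; apply: symE.
Qed.

(** (2j+1) t_j specializes to t^(2j+1).  Again both sides are compared after t d/dt. *)
Lemma diag_linpart d phi n : sym phi ->
  diag (linpart d phi) n = osum (fun j => diag (lower (d + j) phi)) n.
Proof.
elim/ltn_ind: n phi => -[_|n IH] phi s.
  by rewrite diag0 /linpart /osum big_nil big_ord0.
apply: (@mulfI _ n.+1%:R); first by rewrite pnatr_eq0.
rewrite diag_euler; last exact: sym_linpart.
rewrite osum_euler.
rewrite (eq_osum (G := fun k m => k.*2.+1%:R * diag (lower (d + k) phi) m +
   osum (fun j => diag (der k (lower (d + j) phi))) m)).
  rewrite osumD; congr (_ + _).
  rewrite (osum_exch (fun k j => diag (der k (lower (d + j) phi)))).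
  apply: eq_osum => j m _.
  by rewrite diag_euler //; apply: sym_lower.
move=> k m km; have lm : (m < n.+1)%N by lia.
rewrite (eq_osum (G := fun j => diag (lower (d + j) (der k phi)))); last first.
  by move=> j i _; rewrite der_lower.
rewrite -(IH _ lm _ (sym_der k s)) -diagZ -diagD; congr (diag _ m).
by apply/funext => I; rewrite /der (linpart_cons d k I s).
Qed.

Lemma sym_singlen0 n : sym (single C (nseq n 0%N)).
Proof.
elim: n => [|n IH] [|i I] k l J //; rewrite /single.
  rewrite /= !eqseq_cons; case: n {IH} => [|n]; first by rewrite !andbF.
  by rewrite /= !eqseq_cons andbCA.
by rewrite !cat_cons /= !eqseq_cons; case: (i == _) => //=; apply: IH.
Qed.

Lemma diag_single n m : diag (single C (nseq n 0%N)) m = (m == n)%:R / n`!%:R.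
Proof.
elim: n m => [|n IH] [|m].
- by rewrite diag0 divr1.
- apply: (@mulfI _ m.+1%:R); first by rewrite pnatr_eq0.
  rewrite diag_euler /= ?mul0r ?mulr0; last exact: (@sym_singlen0 0).
  by apply: osum_eq0 => d i; rewrite (_ : der d _ = fun=> 0) ?diag_zero.
- by rewrite diag0 /single /= mul0r.
apply: (@mulfI _ m.+1%:R); first by rewrite pnatr_eq0.
rewrite diag_euler; last exact: sym_singlen0.
rewrite /osum big_ord_recl /= big1 ?addr0 => [|d _]; last first.
  by case: ifP => // _; rewrite (_ : der _ _ = fun=> 0) ?diag_zero.
have d0 : der 0 (single C (0%N :: nseq n 0%N)) = single C (nseq n 0%N).
  by apply/funext => I; rewrite /der /single eqseq_cons.
rewrite subn1 /= d0 IH eqSS; case: eqP => [->|_]; rewrite ?mul0r ?mulr0 // factS natrM !mul1r.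
by rewrite invfM mulrA divff ?mul1r ?pnatr_eq0.
Qed.

Lemma diag_vir d phi n : sym phi -> diag (vir d phi) n =
  osum (fun j => diag (lower (d + j) phi)) n +
  2^-1 * (\sum_(b < d.-1) diag (der (d - 2 - b) (der b phi)) n) +
  (d == 0%N)%:R * (if (2 <= n)%N then 2^-1 * diag phi (n - 2) else 0) +
  (d == 1%N)%:R / 8 * diag phi n.
Proof.
move=> s.
have -> : vir d phi = linpart d phi \+
   (fun I => 2^-1 * (\sum_(b < d.-1) (der (d - 2 - b) (der b phi)) I)) \+
   (fun I => (d == 0%N)%:R * shuf (single C (nseq 2 0%N)) phi I) \+
   (fun I => (d == 1%N)%:R / 8 * phi I) by [].
rewrite !diagD !diagZ diag_linpart // diag_sum diag_shuf //; last exact: sym_singlen0.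
congr (_ + _ * _ + _).
rewrite /conv; under eq_bigr do rewrite diag_single.
case: ifP => n2; last first.
  rewrite big1 // => i _; have := ltn_ord i => ?.
  by rewrite (_ : (nat_of_ord i == 2)%N = false) ?mul0r //; apply/eqP; lia.
have l2 : (2 < n.+1)%N by [].
rewrite (bigD1 (Ordinal l2)) //= big1 ?addr0 ?mul1r //.
move=> i; rewrite -val_eqE /= => /negbTE ->; by rewrite !mul0r.
Qed.
End Specialization.

(** * The Airy recursion *)

Section AiryRecursion.
Variable C : numFieldType.
Implicit Types (phi psi chi : seq nat -> C) (I J : seq nat) (F G : nat -> nat -> C) (a : C).

Lemma osum_delta c (F : nat -> C) n :
  osum (fun d m => (d == c)%:R * F m) n = if (c.*2.+1 <= n)%N then F (n - c.*2.+1)%N else 0.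
Proof.
rewrite (@osumE _ (n + c).+1); last by lia.
have lc : (c < (n + c).+1)%N by lia.
rewrite (bigD1 (Ordinal lc)) //= eqxx mul1r big1 ?addr0 // => d.
by rewrite -val_eqE /= => /negbTE ->; rewrite mul0r; case: ifP.
Qed.

(** In \sum_{d,j} t^(2d+1) t^(2j+1) D_{d+j-1} the derivative D_e occurs e + 2 times, with
t^(2e+4) = t^3 t^(2e+1). *)
Lemma osum_lower phi n :
  osum (fun d => osum (fun j => diag (lower (d + j) phi))) n.+3 =
  osum (fun e m => e.+2%:R * diag (der e phi) m) n.
Proof.
rewrite (@osum_osumE _ n.+4 (fun d j => diag (lower (d + j) phi))) //.
pose g x := if (x.*2.+2 <= n.+3)%N then diag (lower x phi) (n.+3 - x.*2.+2) else 0.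
transitivity (\sum_(d < n.+4) \sum_(e < n.+4) g (d + e)%N).
  apply: eq_bigr => d _; apply: eq_bigr => e _; rewrite /g doubleD addSn addnS.
  by [].
rewrite (sum_antidiag (G := fun i j => g (i + j)%N)); last first.
  by move=> i j ij; rewrite /g; case: ifP => //; lia.
rewrite big_ord_recl [X in X + _](_ : _ = 0) ?add0r; last first.
  by rewrite big_ord1 /g /= diag_zero.
rewrite (@osumE _ n.+3); last by lia.
apply: eq_bigr => x _; rewrite lift0.
rewrite (eq_bigr (fun=> g x.+1)); last by move=> i _; rewrite subnKC // -ltnS.
rewrite sumr_const card_ord -[LHS]mulr_natl /g doubleS.
rewrite (_ : (x.*2.+4 <= n.+3)%N = (x.*2.+1 <= n)%N) //.
by case: ifP; rewrite ?mulr0.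
Qed.

(** \sum_{b,c} t^(2(b+c+2)+1) D_b D_c = t^3 (\sum_b t^(2b+1) D_b) (\sum_c t^(2c+1) D_c). *)
Lemma osum_pairs phi n :
  osum (fun d m => \sum_(b < d.-1) diag (der (d - 2 - b) (der b phi)) m) n.+3 =
  osum (fun b => osum (fun c => diag (der c (der b phi)))) n.
Proof.
rewrite (@osum_osumE _ n.+1 (fun b c => diag (der c (der b phi)))) //.
rewrite (sum_antidiag (G := fun b c => if (b.*2.+1 + c.*2.+1 <= n)%N
   then diag (der c (der b phi)) (n - (b.*2.+1 + c.*2.+1)) else 0)); last first.
  by move=> i j ij; case: ifP => //; lia.
rewrite (@osumE _ n.+3) //.
rewrite [LHS]big_ord_recl [X in _ + X = _]big_ord_recl /bump /=.
rewrite !big_ord0 !add0r; apply: eq_bigr => x _; rewrite /=.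
rewrite -[bump 0 (bump 0 x)]/(x.+2) -[(0 + bump 0 x)%N]/(x.+1).
case: ifP => le; last first.
  by rewrite big1 // => b _; have := ltn_ord b; case: ifP => //; lia.
apply: eq_bigr => b _; have := ltn_ord b => ltb.
rewrite ifT; last by lia.
rewrite (_ : x.+2 - 2 - b = x - b)%N; last by lia.
by congr diag; lia.
Qed.

Lemma diag_dcorr_exp n : n%:R * diag (dcorr C) n =
  conv (fun i => i%:R * diag (corr C) i) (diag (dcorr C)) n.
Proof.
rewrite diag_euler; last exact: sym_dcorr.
rewrite (_ : (fun i => i%:R * diag (corr C) i) = osum (fun d => diag (der d (corr C)))).
  rewrite conv_osum; apply: eq_osum => d m _; rewrite der_dcorr diag_shuf //.
    exact/sym_der/sym_corr.
  exact: sym_dcorr.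
by apply/funext => i; rewrite diag_euler //; apply: sym_corr.
Qed.

(** The equation t d/dt Z = \sum_d t^(2d+1) H_d Z on the specialization.  With E = t d/dt the part
with derivatives is t^3 times a combination of E, E^2 and \sum_d (2d+1) t^(2d+1) D_d;
[E2] shows that the coefficients of the last sum cancel between [E3] and the pairs of
derivatives. *)
Lemma diag_dcorr_airy n : 8 * n.+3%:R * diag (dcorr C) n.+3 =
  (4 * n%:R ^+ 2 + 12 * n%:R + 5) * diag (dcorr C) n.
Proof.
have s := @sym_dcorr C; set M := dcorr C in s *.
have E1 : n%:R * diag M n = osum (fun d => diag (der d M)) n by apply: diag_euler.
have E2 : n%:R * (n%:R * diag M n) = osum (fun d m => d.*2.+1%:R * diag (der d M) m) n +
    osum (fun b => osum (fun c => diag (der c (der b M)))) n.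
  rewrite E1 osum_euler; congr (_ + _); apply: eq_osum => d m _.
  by apply: diag_euler; apply: sym_der.
have E3 : osum (fun e m => e.+2%:R * diag (der e M) m) n =
    2^-1 * (osum (fun d m => d.*2.+1%:R * diag (der d M) m) n + 3 * (n%:R * diag M n)).
  rewrite E1 -!osumZ -osumD -osumZ; apply: eq_osum => d m _.
  by rewrite natr_odd -addn2 natrD; field.
rewrite -mulrA diag_euler // (eq_osum (G := fun d m => osum (fun j => diag (lower (d + j) M)) m +
  2^-1 * (\sum_(b < d.-1) diag (der (d - 2 - b) (der b M)) m) +
  (d == 0%N)%:R * (if (2 <= m)%N then 2^-1 * diag M (m - 2) else 0) +
  (d == 1%N)%:R * (8^-1 * diag M m))); last first.
  move=> d m _; rewrite (_ : der d M = vir d M); last first.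
    by apply/funext => I; rewrite /der /M dcorr_vir.
  by rewrite diag_vir // mulrA.
rewrite !osumD osumZ osum_lower osum_pairs E3.
rewrite (osum_delta 0 (fun m => if (2 <= m)%N then 2^-1 * diag M (m - 2) else 0)).
rewrite (osum_delta 1 (fun m => 8^-1 * diag M m)) /= !subSS !subn0.
set x := osum _ n in E2 *; set y := osum _ n in E2 *.
have -> : y = n%:R * (n%:R * diag M n) - x by rewrite E2 addrC addKr.
by field.
Qed.

Lemma diag_corr_eq0 n : ~~ (3 %| n)%N -> diag (corr C) n = 0.
Proof.
move=> n3; rewrite /diag big1 // => k _.
rewrite (eq_diagk (psi := fun=> 0)) ?diagk0 ?mul0r // => I sI wI.
apply/eqP; apply: contraNT n3 => /corr_genus[g /eqP]; rewrite wI => e.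
rewrite -(@dvdn_addl 6) // e dvdn_add ?dvdn_mulr //; lia.
Qed.

(** Coefficients of the asymptotic series of the Airy function. *)
Definition airy_coef n : C := diag (dcorr C) (3 * n).

Lemma airy_coef0 : airy_coef 0 = 1.
Proof. by rewrite /airy_coef muln0 diag0. Qed.

Lemma airy_coefS n : 24 * n.+1%:R * airy_coef n.+1 = (6 * n%:R + 1) * (6 * n%:R + 5) * airy_coef n.
Proof.
have := diag_dcorr_airy (3 * n); rewrite /airy_coef (_ : (3 * n).+3 = 3 * n.+1)%N; last lia.
rewrite !natrM => e; transitivity (8 * (3 * n.+1%:R) * diag (dcorr C) (3 * n.+1)).
  by ring.
by rewrite e; ring.
Qed.

Lemma sum_mult3 (H : nat -> C) n : (forall i, ~~ (3 %| i)%N -> H i = 0) ->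
  \sum_(i < (3 * n).+1) H i = \sum_(j < n.+1) H (3 * j)%N.
Proof.
move=> H0; elim: n => [|n IH]; first by rewrite !big_ord1.
rewrite [RHS]big_ord_recr /= -IH (_ : (3 * n.+1).+1 = (3 * n).+4)%N; last by lia.
rewrite 3!big_ord_recr /= [H (3 * n).+1]H0 ?[H (3 * n).+2]H0; try lia.
by rewrite !addr0 (_ : (3 * n).+3 = 3 * n.+1)%N; last lia.
Qed.

(** The coefficients of the specialization of Z = exp F, in the form t z' = (t f') z; only powers
of t^3 occur. *)
Lemma airy_coef_exp n : n%:R * airy_coef n =
  \sum_(i < n.+1) (i%:R * diag (corr C) (3 * i)) * airy_coef (n - i).
Proof.
apply: (@mulfI _ 3); first by rewrite pnatr_eq0.
rewrite mulrA -natrM diag_dcorr_exp /conv.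
rewrite (@sum_mult3 (fun i => i%:R * diag (corr C) i * diag (dcorr C) (3 * n - i))).
  rewrite mulr_sumr; apply: eq_bigr => i _.
  by rewrite natrM /airy_coef mulnBr -!mulrA.
by move=> i i3; rewrite diag_corr_eq0 // mulr0 mul0r.
Qed.
End AiryRecursion.

(** * Laurent sums *)

Section LaurentSums.
Variable C : numFieldType.
Implicit Types (phi psi chi : seq nat -> C) (I J : seq nat) (a : C).
Implicit Types (z : C) (zs : seq C).

Definition corr_g g I : C := (of_genus g I)%:R * corr C I.

Lemma sym_corr_g g : sym (corr_g g).
Proof.
move=> I k l J; rewrite /corr_g (@sym_corr C) /of_genus wt_swap.
by rewrite !size_cat.
Qed.

(** At most one pair of genera contributes, since the genus is determined by the word. *)
Lemma corr_g_pair g X Y :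
  \sum_(g1 < g.+1) corr_g g1 X * corr_g (g - g1) Y =
  (wt X + wt Y + 12 == 6 * g + 3 * (size X + size Y))%N%:R * (corr C X * corr C Y).
Proof.
have [X0|/corr_genus[a /eqP aX]] := eqVneq (corr C X) 0.
  by rewrite X0 mul0r mulr0 big1 // => i _; rewrite /corr_g X0 mulr0 mul0r.
have [Y0|/corr_genus[b /eqP bY]] := eqVneq (corr C Y) 0.
  by rewrite Y0 !mulr0 big1 // => i _; rewrite /corr_g Y0 !mulr0.
have gX g1 : of_genus g1 X = (g1 == a) by apply/eqP/eqP; lia.
have gY g1 : of_genus g1 Y = (g1 == b) by apply/eqP/eqP; lia.
have -> : (wt X + wt Y + 12 == 6 * g + 3 * (size X + size Y))%N = (a + b == g)%N.
  by apply/eqP/eqP; lia.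
rewrite /corr_g; under eq_bigr do rewrite gX gY.
have [<-|ng] := eqVneq (a + b)%N g.
  have la : (a < (a + b).+1)%N by lia.
  rewrite (bigD1 (Ordinal la)) //= big1 ?addr0 => [|i].
    by rewrite addKn !eqxx !mul1r.
  by rewrite -val_eqE /= => /negbTE ->; rewrite !mul0r.
rewrite mul0r big1 // => i _; case: eqP => [ia|_]; last by rewrite !mul0r.
case: eqP => [ib|_]; last by rewrite mul0r mulr0.
by move: ng; rewrite -ib -ia subnKC ?eqxx // -ltnS.
Qed.

(** The recursion for correlators sorted by genus: two derivatives at one component raise
the genus by 1, two components add their genera. *)
Lemma corr_g_cons g d I : corr_g g (d :: I) =
  linpart d (corr_g g) I
  + 2^-1 * (\sum_(b < d.-1)
      if g is g'.+1 then corr_g g' [:: nat_of_ord b, (d - 2 - b)%N & I] else 0)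
  + 2^-1 * (\sum_(b < d.-1) \sum_(g1 < g.+1)
      shuf (der b (corr_g g1)) (der (d - 2 - b) (corr_g (g - g1))) I)
  + (g == 0%N)%:R * ((d == 0%N)%:R * single C [:: 0%N; 0%N] I)
  + (g == 1%N)%:R * ((d == 1%N)%:R / 8 * single C [::] I).
Proof.
set h := of_genus g (d :: I).
rewrite {1}/corr_g corr_cons /conn !mulrDr; congr (_ + _ + _ + _ + _).
- rewrite /linpart mulr_sumr; apply: eq_big_seq => -[j J] pI; rewrite /lower /=.
  have /= w := picks_wt pI; have /= sp := picks_size pI.
  case dp: (d + j)%N => [|e]; rewrite ?mulr0 // mulrCA; congr (_ * (_ * _)).
  by congr (nat_of_bool _)%:R; apply/eqP/eqP; rewrite !wt_cons /=; lia.
- rewrite mulrCA; congr (_ * _); rewrite mulr_sumr; apply: eq_bigr => b _.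
  have lb := ltn_ord b; rewrite -/h; case: g @h => [|g] h.
    case hE: h; last by rewrite mul0r.
    move/eqP: hE; rewrite wt_cons /= => hE; rewrite mul1r; apply/eqP.
    apply/negPn/negP => /corr_genus[g2 /eqP]; rewrite !wt_cons /=; lia.
  rewrite /corr_g; congr (_ * _).
  by congr (nat_of_bool _)%:R; apply/eqP/eqP; rewrite !wt_cons /=; lia.
- rewrite mulrCA; congr (_ * _); rewrite mulr_sumr; apply: eq_bigr => b _.
  have lb := ltn_ord b; rewrite /shuf exchange_big mulr_sumr /=.
  apply: eq_big_seq => -[X Y] pI; rewrite /= /der corr_g_pair; congr (_ * _).
  have /= w := splits_wt pI; have /= sp := splits_size pI.
  by congr (nat_of_bool _)%:R; apply/eqP/eqP; rewrite !wt_cons /=; lia.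
- case: d @h => [|d] h; last by rewrite !mul0r !mulr0.
  rewrite /single; have [I0|nI] := eqVneq I [:: 0%N; 0%N]; last by rewrite !mulr0.
  congr (_ * _); congr (nat_of_bool _)%:R.
  by apply/eqP/eqP; rewrite I0 !wt_cons /wt /=; lia.
- case: d @h => [|[|d]] h; try by rewrite !mul0r !mulr0.
  rewrite /single; have [I0|nI] := eqVneq I [::]; last by rewrite !mulr0.
  congr (_ * _); congr (nat_of_bool _)%:R.
  by apply/eqP/eqP; rewrite I0 !wt_cons /wt /=; lia.
Qed.

(** \sum_{d_1, ..., d_n < N} phi(d_1, ..., d_n) \prod_i z_i^(-2 (d_i + 1)) for zs = z_1, ..., z_n. *)
Fixpoint lsum (N : nat) zs phi : C :=
  if zs is z :: zs' then \sum_(d < N) (z ^+ 2) ^- d.+1 * lsum N zs' (der d phi)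
  else phi [::].

Lemma eq_lsum N zs phi psi : (forall I, size I = size zs -> phi I = psi I) ->
  lsum N zs phi = lsum N zs psi.
Proof.
elim: zs phi psi => [|z zs IH] phi psi e /=; first exact: e.
by apply: eq_bigr => d _; congr (_ * _); apply: IH => I sI; apply: e; rewrite /= sI.
Qed.

Lemma lsumD N zs phi psi : lsum N zs (phi \+ psi) = lsum N zs phi + lsum N zs psi.
Proof.
elim: zs phi psi => [|z zs IH] phi psi //=.
by rewrite -big_split; apply: eq_bigr => d _; rewrite /= -mulrDr -IH.
Qed.

Lemma lsumZ N zs a phi : lsum N zs (fun I => a * phi I) = a * lsum N zs phi.
Proof.
elim: zs phi => [|z zs IH] phi //=.
rewrite mulr_sumr; apply: eq_bigr => d _; rewrite mulrCA; congr (_ * _); exact: IH.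
Qed.

Lemma lsum0 N zs phi : (forall I, size I = size zs -> phi I = 0) -> lsum N zs phi = 0.
Proof.
move=> e; rewrite -(mul0r (lsum N zs phi)) -lsumZ; apply: eq_lsum => I /e ->.
by rewrite mulr0.
Qed.

Lemma lsum_sum N zs K (F : 'I_K -> seq nat -> C) :
  lsum N zs (fun I => \sum_(i < K) F i I) = \sum_(i < K) lsum N zs (F i).
Proof.
elim: zs F => [|z zs IH] F //=.
rewrite exchange_big; apply: eq_bigr => d _; rewrite /= -mulr_sumr -IH; congr (_ * _).
Qed.

Lemma lsum_shuf N zs phi psi : lsum N zs (shuf phi psi) =
  \sum_(p <- splits zs) lsum N p.1 phi * lsum N p.2 psi.
Proof.
elim: zs phi psi => [|z zs IH] phi psi; first by rewrite big_seq1 /= shuf_nil.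
rewrite (sum_splits_cons (fun s t => lsum N s phi * lsum N t psi)) /=.
under [X in _ = X + _]eq_bigr do rewrite mulr_suml.
under [X in _ = _ + X]eq_bigr do rewrite mulr_sumr.
rewrite exchange_big [X in _ = _ + X]exchange_big -big_split; apply: eq_bigr => d _ /=.
rewrite der_shuf lsumD !IH mulrDr !mulr_sumr; congr (_ + _); apply: eq_bigr => p _.
  by rewrite mulrA.
by rewrite mulrCA.
Qed.

(** Removing a letter j from the word corresponds to singling out a variable x together with
the factor x^(-2 (j + 1)). *)
Lemma lsum_linpart N zs d phi : sym phi -> lsum N zs (linpart d phi) =
  \sum_(p <- picks zs) \sum_(k < N)
     k.*2.+1%:R * (p.1 ^+ 2) ^- k.+1 * lsum N p.2 (lower (d + k) phi).
Proof.
elim: zs d phi => [|z zs IH] d phi s; first by rewrite big_nil /= /linpart big_nil.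
rewrite (sum_picks_cons (fun x r => \sum_(k < N)
     k.*2.+1%:R * (x ^+ 2) ^- k.+1 * lsum N r (lower (d + k) phi))) /=.
have dl k : der k (linpart d phi) =
    (fun I => k.*2.+1%:R * lower (d + k) phi I) \+ linpart d (der k phi).
  by apply/funext => I; rewrite /der (linpart_cons d k I s).
under eq_bigr => k _ do
  rewrite dl lsumD lsumZ (IH _ _ (sym_der k s)) mulrDr mulrA [_ * k.*2.+1%:R]mulrC.
rewrite big_split /=; congr (_ + _).
under [RHS]eq_bigr => p _ do under eq_bigr => k _ do rewrite mulr_sumr.
under [RHS]eq_bigr => p _ do rewrite exchange_big /=.
rewrite [RHS]exchange_big /=; apply: eq_bigr => k _; rewrite mulr_sumr.
apply: eq_bigr => p _; rewrite mulr_sumr; apply: eq_bigr => j _.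
by rewrite der_lower // mulrCA.
Qed.

Lemma lsum_single0 N n z zs : lsum N.+1 (z :: zs) (single C (nseq n.+1 0%N)) =
  (z ^+ 2)^-1 * lsum N.+1 zs (single C (nseq n 0%N)).
Proof.
rewrite /= big_ord_recl /= big1 ?addr0 => [|d _]; last first.
  by rewrite (_ : der _ _ = fun=> 0) // lsum0 ?mulr0.
have -> : der 0 (single C (0%N :: nseq n 0%N)) = single C (nseq n 0%N).
  by apply/funext => I; rewrite /der /single eqseq_cons.
by [].
Qed.

Lemma sum_pairs_antidiag N (w : nat -> C) (X : nat -> nat -> C) :
  (forall b c, (N <= b + c + 2)%N -> X b c = 0) ->
  \sum_(d < N) w d * \sum_(b < d.-1) X b (d - 2 - b)%N =
  \sum_(b < N) \sum_(c < N) w (b + c + 2)%N * X b c.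
Proof.
move=> X0; rewrite (sum_antidiag (G := fun b c => w (b + c + 2)%N * X b c)); last first.
  by move=> b c bc; rewrite X0 ?mulr0 //; lia.
rewrite (sum_ord_widen (m := N.+2) (F := fun d => w d * \sum_(b < d.-1) X b (d - 2 - b)%N)) ;
  last first.
- move=> i Ni; rewrite big1 ?mulr0 // => b _; apply: X0.
  by have := ltn_ord b; lia.
- by lia.
rewrite 2!big_ord_recl !big_ord0 !mulr0 !add0r; apply: eq_bigr => x _.
rewrite !lift0 /= mulr_sumr; apply: eq_bigr => b _; have := ltn_ord b => lb.
by congr (w _ * X _ _); lia.
Qed.

Lemma sum_lower_antidiag N (F : nat -> nat -> C) (X : nat -> C) :
  (forall e, (N <= e.+1)%N -> X e = 0) ->
  \sum_(d < N) \sum_(k < N) F d k * (if (d + k)%N is e.+1 then X e else 0) =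
  \sum_(e < N) (\sum_(k < e.+2) F (e.+1 - k)%N k) * X e.
Proof.
move=> X0; rewrite exchange_big /=.
rewrite (sum_antidiag (G := fun k d => F d k * (if (d + k)%N is e.+1 then X e else 0))); last first.
  move=> k d kd; case dk : (d + k)%N => [|e]; rewrite ?mulr0 // X0 ?mulr0 //.
  by rewrite -dk addnC.
pose H x := (\sum_(i < x.+1) F (x - i)%N i) * (if x is e.+1 then X e else 0).
rewrite (eq_bigr (fun x : 'I_N => H x)); last first.
  move=> x _; rewrite /H mulr_suml; apply: eq_bigr => i _.
  by rewrite subnK // -ltnS.
rewrite (sum_ord_widen (m := N.+1) (F := H)); last first.
- by case=> [|i] Ni; rewrite /H ?mulr0 // X0 ?mulr0.
- by [].
by rewrite big_ord_recl [X in X + _]mulr0 add0r.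
Qed.
End LaurentSums.

(** * The recursion for Laurent sums *)

Section LaurentRecursion.
Variable C : numFieldType.
Implicit Types (phi psi chi : seq nat -> C) (I J : seq nat) (a : C).
Implicit Types (z : C) (zs : seq C).

(** The recursion of [corr_g_cons] multiplied by the powers of the variables and summed.
The terms are ordered as the residue computation delivers them: W_{0,2} times a stable
factor, W_{g-1,n+2}, stable products, W_{0,2} times W_{0,2} (only in W_{0,3}), and
W_{0,2}(z,-z) (only in W_{1,1}). *)
Lemma corr_lsum_rec N g z0 zs : (6 * g + 3 * size zs < N)%N ->
  lsum N (z0 :: zs) (corr_g C g) =
  \sum_(p <- picks zs) \sum_(e < N)
    (\sum_(k < e.+2) (z0 ^+ 2) ^- (e.+1 - k).+1 * (k.*2.+1%:R * (p.1 ^+ 2) ^- k.+1)) *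
    lsum N p.2 (der e (corr_g C g))
  + 2^-1 * (\sum_(b < N) \sum_(c < N) (z0 ^+ 2) ^- (b + c + 2).+1 *
     (if g is g'.+1 then lsum N zs (der c (der b (corr_g C g'))) else 0))
  + 2^-1 * (\sum_(b < N) \sum_(c < N) (z0 ^+ 2) ^- (b + c + 2).+1 *
     (\sum_(g1 < g.+1) \sum_(p <- splits zs)
        lsum N p.1 (der b (corr_g C g1)) * lsum N p.2 (der c (corr_g C (g - g1)))))
  + (g == 0%N)%:R * ((z0 ^+ 2)^-1 * lsum N zs (single C [:: 0%N; 0%N]))
  + (g == 1%N)%:R * ((z0 ^+ 2)^-2 / 8 * lsum N zs (single C [::])).
Proof.
move=> Nbig /=.
pose X1 b c := if g is g'.+1 then lsum N zs (der c (der b (corr_g C g'))) else 0.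
pose X2 b c := \sum_(g1 < g.+1) lsum N zs (shuf (der b (corr_g C g1)) (der c (corr_g C (g - g1)))).
have dE d : lsum N zs (der d (corr_g C g)) = lsum N zs (linpart d (corr_g C g)) +
   2^-1 * (\sum_(b < d.-1) X1 b (d - 2 - b)%N) +
   2^-1 * (\sum_(b < d.-1) X2 b (d - 2 - b)%N) +
   (g == 0%N)%:R * ((d == 0%N)%:R * lsum N zs (single C [:: 0%N; 0%N])) +
   (g == 1%N)%:R * ((d == 1%N)%:R / 8 * lsum N zs (single C [::])).
  have -> : der d (corr_g C g) = linpart d (corr_g C g)
  \+ (fun I => 2^-1 * (\sum_(b < d.-1)
      if g is g'.+1 then corr_g C g' [:: nat_of_ord b, (d - 2 - b)%N & I] else 0))
  \+ (fun I => 2^-1 * (\sum_(b < d.-1) \sum_(g1 < g.+1)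
      shuf (der b (corr_g C g1)) (der (d - 2 - b) (corr_g C (g - g1))) I))
  \+ (fun I => (g == 0%N)%:R * ((d == 0%N)%:R * single C [:: 0%N; 0%N] I))
  \+ (fun I => (g == 1%N)%:R * ((d == 1%N)%:R / 8 * single C [::] I)).
    by apply/funext => I; rewrite /der corr_g_cons.
  rewrite !lsumD !lsumZ; congr (_ + _ * _ + _ * _ + _ + _).
    rewrite lsum_sum; apply: eq_bigr => b _; rewrite /X1; case: (g) => [|g'] //.
    by rewrite lsum0.
  rewrite lsum_sum; apply: eq_bigr => b _.
  by rewrite (lsum_sum N zs (fun (g1 : 'I_g.+1) => shuf (der b (corr_g C g1)) (der (d - 2 - b)
    (corr_g C (g - g1))))).
under eq_bigr => d _ do rewrite dE !mulrDr.
rewrite !big_split /=; congr (_ + _ + _ + _ + _).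
- under eq_bigr => d _ do rewrite (lsum_linpart _ _ _ (@sym_corr_g C g)) mulr_sumr.
  rewrite exchange_big /=; apply: eq_big_seq => -[x r] pI /=.
  have /= sr := picks_size pI.
  rewrite -(sum_lower_antidiag (fun d k => (z0 ^+ 2) ^- d.+1 * (k.*2.+1%:R * (x ^+ 2) ^- k.+1))
    (X := fun e => lsum N r (der e (corr_g C g)))).
    apply: eq_bigr => d _; rewrite mulr_sumr; apply: eq_bigr => k _.
    rewrite !mulrA /lower; congr (_ * _); case: (d + k)%N => // .
    by rewrite lsum0.
  move=> e Ne; apply: lsum0 => I sI; rewrite /der /corr_g /of_genus.
  case: eqP => [|_]; rewrite ?mul0r // wt_cons /=; lia.
- under eq_bigr => d _ do rewrite mulrCA.
  rewrite -mulr_sumr (sum_pairs_antidiag (fun d => (z0 ^+ 2) ^- d.+1)) //.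
  move=> b c bc; rewrite /X1; case: g Nbig {X1 X2 dE} => // g Nbig.
  apply: lsum0 => I sI; rewrite /der /corr_g /of_genus.
  case: eqP => [|_]; rewrite ?mul0r // !wt_cons /=; lia.
- under eq_bigr => d _ do rewrite mulrCA.
  rewrite -mulr_sumr (sum_pairs_antidiag (fun d => (z0 ^+ 2) ^- d.+1)) //; last first.
    move=> b c bc; rewrite /X2 big1 // => g1 _.
    apply: lsum0 => I sI; rewrite /shuf big_seq big1 // => -[U V] pI /=.
    have /= sp := splits_size pI; rewrite /der /corr_g /of_genus.
    have := ltn_ord g1 => lg.
    case: eqP => [e1|_]; last by rewrite !mul0r.
    case: eqP => [e2|_]; last by rewrite mul0r mulr0.
    by move: e1 e2; rewrite !wt_cons /=; lia.
  congr (_ * _); apply: eq_bigr => b _; apply: eq_bigr => c _; congr (_ * _).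
  by apply: eq_bigr => g1 _; rewrite lsum_shuf.
- have N0 : (0 < N)%N by lia.
  rewrite (bigD1 (Ordinal N0)) //= big1 ?addr0 => [|d].
    by rewrite mul1r mulrCA.
  by rewrite -val_eqE /= => /negbTE ->; rewrite mul0r !mulr0.
- case: eqP => g1; last by rewrite mul0r big1 // => d _; rewrite mul0r mulr0.
  have N1 : (1 < N)%N by lia.
  rewrite (bigD1 (Ordinal N1)) //= big1 ?addr0 => [|d].
    by rewrite !mul1r mulrA.
  by rewrite -val_eqE /= => /negbTE ->; rewrite !mul0r !mulr0.
Qed.
End LaurentRecursion.

(** * Sums over subsets as sums over splittings *)

Section Subsets.
Variable C : numFieldType.

(** Subsets of 'I_n.+1 are subsets of 'I_n together with the choice whether to contain 0. *)
Definition ext_set n (b : bool) (B : {set 'I_n}) : {set 'I_n.+1} :=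
  [set j | if unlift ord0 j is Some i then i \in B else b].

Lemma sum_set_ordS (V : nmodType) n (F : {set 'I_n.+1} -> V) :
  \sum_(A : {set 'I_n.+1}) F A =
  \sum_(B : {set 'I_n}) F (ext_set true B) + \sum_(B : {set 'I_n}) F (ext_set false B).
Proof.
have half b : \sum_(A : {set 'I_n.+1} | (ord0 \in A) == b) F A =
  \sum_(B : {set 'I_n}) F (ext_set b B).
  rewrite (reindex_onto (ext_set b) (fun A => [set i | lift ord0 i \in A])) /=.
    apply: eq_bigl => B; rewrite inE unlift_none eqxx /=.
    by apply/eqP/setP => i; rewrite !inE liftK.
  move=> A /eqP A0; apply/setP => j; rewrite inE.
  by case: unliftP => [i ->|->]; rewrite ?inE.
rewrite (bigID (fun A : {set 'I_n.+1} => ord0 \in A)) /=; congr (_ + _).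
  by rewrite -half; apply: eq_bigl => A; case: (_ \in _).
by rewrite -half; apply: eq_bigl => A; case: (_ \in _).
Qed.

Lemma setC_ext_set n b (B : {set 'I_n}) : ~: ext_set b B = ext_set (~~ b) (~: B).
Proof. by apply/setP => j; rewrite !inE; case: unliftP => [i _|_]; rewrite ?inE. Qed.

Lemma subtuple_ext_set (z : C) (zs : seq C) b (B : {set 'I_(size zs)}) :
  @subtuple C (z :: zs) (ext_set b B) = (if b then [:: z] else [::]) ++ subtuple B.
Proof.
have enumE (n : nat) (A : {set 'I_n}) : enum A = [seq i <- enum 'I_n | i \in A].
  by rewrite /enum_mem -!filter_predI; apply: eq_filter => i /=; rewrite andbT.
rewrite /subtuple !enumE enum_ordSl /= inE unlift_none filter_map.
have -> : [seq i <- enum 'I_(size zs) | preim (lift ord0) [in ext_set b B] i] =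
    [seq i <- enum 'I_(size zs) | i \in B].
  by apply: eq_filter => i /=; rewrite inE liftK.
by case: b; rewrite /= -map_comp.
Qed.

Lemma sum_subtuple (zs : seq C) (G : seq C -> seq C -> C) :
  \sum_(A : {set 'I_(size zs)}) G (subtuple A) (subtuple (~: A)) =
  \sum_(p <- splits zs) G p.1 p.2.
Proof.
have nil0 (A : {set 'I_(size (Nil C))}) : subtuple A = [::].
  by apply: size0nil; rewrite size_subtuple; apply: eq_card0; case.
elim: zs G => [|z zs IH] G.
  rewrite sum_splits_nil (big_pred1 finset.set0).
    by rewrite !nil0.
  by move=> A /=; apply/esym/eqP/setP; case.
rewrite (sum_splits_cons G) -(IH (fun a b => G (z :: a) b)) -(IH (fun a b => G a (z :: b))).
rewrite (@sum_set_ordS _ (size zs)); congr (_ + _); apply: eq_bigr => B _.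
  by rewrite setC_ext_set !subtuple_ext_set.
by rewrite setC_ext_set !subtuple_ext_set.
Qed.
End Subsets.

Local Open Scope classical_set_scope.
Local Open Scope ring_scope.

(** * Residues and even Taylor expansions *)

Section Residues.
Variable C : numFieldType.
Implicit Types (f g h : C -> C) (z : C).

Definition hol0 h := \forall z \near (0 : C), derivable h z 1.

Lemma hol0W h : (forall z, derivable h z 1) -> hol0 h.
Proof. by move=> dh; near=> z; exact: dh. Unshelve. all: by end_near. Qed.

Lemma hol0_cst (c : C) : hol0 (fun=> c).
Proof. by apply: hol0W => z; apply: derivable_cst. Qed.

Lemma hol0_id : hol0 id.
Proof. by apply: hol0W => z; apply: derivable_id. Qed.

Lemma hol0D f g : hol0 f -> hol0 g -> hol0 (fun z => f z + g z).
Proof. by rewrite /hol0; apply: filterS2 => z; apply: derivableD. Qed.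

Lemma hol0M f g : hol0 f -> hol0 g -> hol0 (fun z => f z * g z).
Proof. by rewrite /hol0; apply: filterS2 => z; apply: derivableM. Qed.

Lemma hol0X f n : hol0 f -> hol0 (fun z => f z ^+ n).
Proof.
elim: n => [|n IH] hf; first exact: hol0_cst.
rewrite (_ : (fun z => f z ^+ n.+1) = fun z => f z * f z ^+ n).
  by apply: hol0M => //; apply: IH.
by apply/funext => z; rewrite exprS.
Qed.

Lemma hol0_sum n (F : 'I_n -> C -> C) :
  (forall i, hol0 (F i)) -> hol0 (fun z => \sum_(i < n) F i z).
Proof.
elim: n F => [|n IH] F hF.
  by rewrite (_ : (fun z => _) = fun=> 0); [exact: hol0_cst|apply/funext => z; rewrite big_ord0].
rewrite (_ : (fun z => _) = fun z => F ord0 z + \sum_(i < n) F (lift ord0 i) z).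
  exact: (hol0D (hF ord0) (IH _ (fun i => hF (lift ord0 i)))).
by apply/funext => z; rewrite big_ord_recl.
Qed.

Lemma hol0_cvg f : hol0 f -> f @ (0 : C)^' --> f 0.
Proof.
move/nbhs_singleton/derivable1_diffP/differentiable_continuous => fc.
exact: cvg_trans (cvg_app f (cvg_within _)) fc.
Qed.

Lemma hol0_sqrV (X : C) : X != 0 -> hol0 (fun z => (X - z ^+ 2)^-1).
Proof.
move=> X0.
have h : hol0 (fun z => X - z ^+ 2).
  rewrite (_ : (fun z => _) = fun z => X + (-1) * (z * z)); last first.
    by apply/funext => z; ring.
  apply: hol0D; first exact: hol0_cst.
  exact: (hol0M (hol0_cst (-1)) (hol0M hol0_id hol0_id)).
have c : (fun z => X - z ^+ 2) @ (0 : C) --> X - 0 ^+ 2.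
  by have /nbhs_singleton/derivable1_diffP/differentiable_continuous := h.
rewrite expr0n subr0 in c.
have n0 : \forall z \near (0 : C), X - z ^+ 2 != 0 by apply: cvgr_neq0 c X0.
rewrite /hol0; apply: filterS2 n0 h => z zn zd.
exact: (@derivableV _ _ (fun z => X - z ^+ 2) z 1 zn zd).
Qed.

(** A function c + z f(z) that equals z g(z) near 0 tends both to c and to 0. *)
Lemma hol0_pole_zero (c : C) f g : hol0 f -> hol0 g ->
  (\forall z \near (0 : C)^', c + z * f z = z * g z) -> c = 0.
Proof.
move=> hf hg e.
pose F z := c + z * f z + (-1) * (z * g z).
have hF : hol0 F.
  exact: (hol0D (hol0D (hol0_cst c) (hol0M hol0_id hf)) (hol0M (hol0_cst (-1)) (hol0M hol0_id hg))).
have := hol0_cvg hF; rewrite {2}/F !mul0r mulr0 !addr0 => Fc.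
have F0 : F @ (0 : C)^' --> (0 : C).
  have c0 : (fun=> 0 : C) @ (0 : C)^' --> (0 : C) by exact: cvg_cst.
  apply: cvg_trans c0.
  apply: near_eq_cvg; apply: filterS e => z e.
  by rewrite /F e mulN1r subrr.
exact: (cvg_unique _ Fc F0).
Qed.

(** Multiplying by z^K leaves the coefficient of the highest pole as the value at 0. *)
Lemma principal_part_zero K (c : nat -> C) h : hol0 h ->
  (\forall z \near (0 : C)^', \sum_(k < K) c k * (z ^+ k.+1)^-1 = h z) ->
  forall k, (k < K)%N -> c k = 0.
Proof.
move=> hh; elim: K => [|K IH] e //.
have cK : c K = 0.
  apply: (@hol0_pole_zero _ (fun z => \sum_(k < K) c k * z ^+ (K.-1 - k))
                            (fun z => z ^+ K * h z)).
  - apply: hol0_sum => i; apply: hol0M; first exact: hol0_cst.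
    exact: hol0X hol0_id.
  - exact: (hol0M (hol0X K hol0_id) hh).
  have nz : \forall z \near (0 : C)^', z != 0 by exact: nbhs_dnbhs_neq.
  apply: filterS2 nz e => z z0 <-; rewrite mulrA -exprS big_ord_recr mulrDr /= addrC.
  congr (_ + _); last by rewrite mulrCA divff ?mulr1 // expf_neq0.
  rewrite !mulr_sumr; apply: eq_bigr => i _; rewrite mulrCA [RHS]mulrCA; congr (_ * _).
  have lt := ltn_ord i.
  have -> : K.+1 = ((K.-1 - i).+1 + i.+1)%N by lia.
  by rewrite exprD mulfK ?expf_neq0 // exprS.
move=> k; rewrite ltnS leq_eqVlt => /orP[/eqP -> //|]; apply: IH.
by apply: filterS e => z; rewrite big_ord_recr /= cK mul0r addr0.
Qed.

Definition truncate_at L (x : nat -> C) i : C := if (i < L.+1)%N then x i else 0.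

Lemma principal_part_widen L K (x : nat -> C) z : (L <= K)%N ->
  \sum_(i < L.+1) x i * (z ^+ i.+1)^-1 = \sum_(i < K.+1) truncate_at L x i * (z ^+ i.+1)^-1.
Proof.
move=> LK; rewrite (big_ord_widen K.+1 (fun i => x i * (z ^+ i.+1)^-1)) //.
rewrite big_mkcond; apply: eq_bigr => i _; rewrite /truncate_at; case: ifP => //.
by rewrite mul0r.
Qed.

Lemma residue0_unique f (r s : C) : is_residue0 f r -> is_residue0 f s -> r = s.
Proof.
move=> [N [a [h [<- hh fh]]]] [M [b [k [<- hk fk]]]].
apply/eqP; rewrite -subr_eq0; apply/eqP.
apply: (@principal_part_zero (N + M).+1 (fun i => truncate_at N a i - truncate_at M b i)
   (fun z => k z + (-1) * h z) _ _ 0%N) => //.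
  exact: (hol0D hk (hol0M (hol0_cst (-1)) hh)).
apply: filterS2 fh fk => z e1 e2.
under eq_bigr do rewrite mulrBl.
rewrite big_split sumrN /=
  -(principal_part_widen a z (leq_addr M N)) -(principal_part_widen b z (leq_addl N M)).
have := e2; rewrite e1 => /eqP; rewrite -subr_eq0 => /eqP E.
apply/eqP; rewrite -subr_eq0; apply/eqP; rewrite -[RHS]E; ring.
Qed.

Lemma residue0E f (r : C) : is_residue0 f r -> residue0 f = r.
Proof. by move=> fr; apply: (@residue0_unique f) => //; apply: (xgetI 0 fr). Qed.

Lemma is_residue0D f g (r s : C) :
  is_residue0 f r -> is_residue0 g s -> is_residue0 (fun z => f z + g z) (r + s).
Proof.
move=> [N [a [h [<- hh fh]]]] [M [b [k [<- hk fk]]]].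
exists (N + M)%N, (fun i => truncate_at N a i + truncate_at M b i), (fun z => h z + k z).
split; [by []|exact: (hol0D hh hk)|].
apply: filterS2 fh fk => z -> ->;
  rewrite (principal_part_widen a z (leq_addr M N)) (principal_part_widen b z (leq_addl N M)).
by rewrite addrACA -big_split; congr (_ + _); apply: eq_bigr => i _; rewrite mulrDl.
Qed.

Lemma is_residue0Z f (c r : C) : is_residue0 f r -> is_residue0 (fun z => c * f z) (c * r).
Proof.
move=> [N [a [h [<- hh fh]]]].
exists N, (fun i => c * a i), (fun z => c * h z); split; [by []|exact: (hol0M (hol0_cst c) hh)|].
apply: filterS fh => z ->; rewrite mulrDr mulr_sumr; congr (_ + _).
by apply: eq_bigr => i _; rewrite mulrA.
Qed.

Lemma is_residue00 : is_residue0 (fun=> 0 : C) 0.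
Proof.
exists 0%N, (fun=> 0), (fun=> 0); split; [by []|exact: hol0_cst|].
by near=> z; rewrite big_ord1 mul0r addr0.
Unshelve. all: by end_near. Qed.

Lemma is_residue0_sum (T : eqType) (s : seq T) (F : T -> C -> C) (r : T -> C) :
  (forall i, i \in s -> is_residue0 (F i) (r i)) ->
  is_residue0 (fun z => \sum_(i <- s) F i z) (\sum_(i <- s) r i).
Proof.
elim: s => [|x s IH] Fr.
  rewrite big_nil (_ : (fun z => _) = fun=> 0); first exact: is_residue00.
  by apply/funext => z; rewrite big_nil.
rewrite big_cons (_ : (fun z => _) = fun z => F x z + \sum_(i <- s) F i z).
  apply: is_residue0D; first by apply: Fr; rewrite mem_head.
  by apply: IH => i si; apply: Fr; rewrite inE si orbT.
by apply/funext => z; rewrite big_cons.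
Qed.

Lemma near_is_residue0 f g (r : C) : (\forall z \near (0 : C)^', f z = g z) ->
  is_residue0 f r -> is_residue0 g r.
Proof.
move=> e [N [a [h [ar hh fh]]]]; exists N, a, h; split; [exact: ar|exact: hh|].
by apply: filterS2 e fh => z <-.
Qed.

(** f is an even function with Taylor coefficients a, in the form of finite expansions with a
holomorphic remainder; this is all that a residue needs, and it avoids
any convergence question. *)
Definition etaylor f (a : nat -> C) := forall K, exists2 h, hol0 h &
  \forall z \near (0 : C)^', f z = \sum_(k < K) a k * (z ^+ 2) ^+ k + (z ^+ 2) ^+ K * h z.

Lemma hol0_sq : hol0 (fun z => z ^+ 2).
Proof. exact: hol0X hol0_id. Qed.

(** z^(-2m-1) times an even expansion has only odd powers of z; the exponents -1, -3, ... carry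
the coefficients a_m, a_(m-1), ... *)
Lemma even_laurent_split (a : nat -> C) m (z t : C) : z != 0 ->
  z^-1 * ((z ^+ 2) ^- m * (\sum_(k < m.+1) a k * (z ^+ 2) ^+ k + (z ^+ 2) ^+ m.+1 * t)) =
  \sum_(k < (2 * m).+1) (if odd k then 0 else a (m - k./2)%N) * (z ^+ k.+1)^-1 + z * t.
Proof.
move=> z0; rewrite !mulrDr; congr (_ + _); last first.
  rewrite [(z ^+ 2) ^+ m.+1]exprSr -[_ * t]mulrA mulKf ?expf_neq0 //.
  by rewrite expr2 -mulrA mulKf.
have -> : \sum_(k < (2 * m).+1) (if odd k then 0 else a (m - k./2)%N) * (z ^+ k.+1)^-1 =
          \sum_(k < m.+1) a (m - k)%N * (z ^+ (2 * k).+1)^-1.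
  pose G k := (if odd k then 0 else a (m - k./2)%N) * (z ^+ k.+1)^-1.
  have gen n : \sum_(k < (2 * n).+1) G k = \sum_(k < n.+1) G (2 * k)%N.
    elim: n => [|n IH]; first by rewrite !big_ord1.
    rewrite [RHS]big_ord_recr /= -IH (_ : (2 * n.+1).+1 = (2 * n).+3)%N; last by lia.
    rewrite 2!big_ord_recr /= [G (2 * n).+1](_ : _ = 0) ?addr0.
      by rewrite (_ : (2 * n).+2 = 2 * n.+1)%N; last by lia.
    by rewrite /G /= mul2n odd_double mul0r.
  rewrite (gen m); apply: eq_bigr => k _.
  by rewrite /G mul2n odd_double doubleK.
rewrite (reindex_inj rev_ord_inj) /= !mulr_sumr; apply: eq_bigr => k _.
rewrite subSS; have lk : (k <= m)%N by rewrite -ltnS.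
rewrite [LHS](_ : _ = a (m - k)%N * (z^-1 * ((z ^+ 2) ^- m * (z ^+ 2) ^+ (m - k)))); last by ring.
congr (_ * _); have -> : (z ^+ 2) ^+ m = (z ^+ 2) ^+ k * (z ^+ 2) ^+ (m - k).
  by rewrite -exprD subnKC.
by rewrite invfM -[_ * _ * _]mulrA mulVf ?expf_neq0 // mulr1 [z ^+ (2 * k).+1]exprS invfM exprM.
Qed.

Lemma etaylor_residue f a m : etaylor f a ->
  is_residue0 (fun z => z^-1 * ((z ^+ 2) ^- m * f z)) (a m).
Proof.
move=> /(_ m.+1)[h hh fh].
exists (2 * m)%N, (fun j => if odd j then 0 else a (m - j./2)%N), (fun z => z * h z); split.
- by rewrite /= subn0.
- exact: (hol0M hol0_id hh).
have nz : \forall z \near (0 : C)^', z != 0 by exact: nbhs_dnbhs_neq.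
by apply: filterS2 nz fh => z z0 ->; apply: even_laurent_split.
Qed.
End Residues.

(** * Expansions of the recursion kernel and of the initial values *)

Section Expansions.
Variable C : numFieldType.
Implicit Types (f g h : C -> C) (z : C).

Lemma near_sqr_neq (X : C) : X != 0 -> \forall z \near (0 : C)^', X - z ^+ 2 != 0.
Proof.
move=> X0; have c := hol0_cvg (hol0D (hol0_cst X) (hol0M (hol0_cst (-1)) (@hol0_sq C))).
rewrite /= expr0n mulr0 addr0 in c.
have n0 : \forall z \near (0 : C)^', X + -1 * z ^+ 2 != 0 by exact: cvgr_neq0 c X0.
by apply: filterS n0 => z; rewrite mulN1r.
Qed.

Lemma hol0_horner (p : {poly C}) : hol0 (fun z => p.[z ^+ 2]).
Proof.
rewrite (_ : (fun z => _) = fun z => \sum_(i < size p) p`_i * (z ^+ 2) ^+ i); last first.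
  by apply/funext => z; rewrite horner_coef.
apply: hol0_sum => i; exact: (hol0M (hol0_cst _) (hol0X i (@hol0_sq C))).
Qed.

(** Multiplying the truncations as polynomials in z^2: the part of degree at least K goes into the
remainder. *)
Lemma etaylorM f g a b : etaylor f a -> etaylor g b ->
  etaylor (fun z => f z * g z) (conv a b).
Proof.
move=> fa gb K; have [h hh fh] := fa K; have [k hk gk] := gb K.
pose p := \poly_(i < K) a i; pose q := \poly_(i < K) b i.
pose r := drop_poly K (p * q).
exists (fun z => r.[z ^+ 2] + p.[z ^+ 2] * k z + q.[z ^+ 2] * h z + (z ^+ 2) ^+ K * (h z * k z)).
  exact: (hol0D (hol0D (hol0D (hol0_horner r) (hol0M (hol0_horner p) hk))
    (hol0M (hol0_horner q) hh)) (hol0M (hol0X K (@hol0_sq C)) (hol0M hh hk))).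
apply: filterS2 fh gk => z -> ->; set x := z ^+ 2.
have -> : \sum_(i < K) a i * x ^+ i = p.[x] by rewrite horner_poly.
have -> : \sum_(i < K) b i * x ^+ i = q.[x] by rewrite horner_poly.
have -> : \sum_(i < K) conv a b i * x ^+ i = (take_poly K (p * q)).[x].
  rewrite /take_poly horner_poly; apply: eq_bigr => i _; congr (_ * _).
  rewrite coefM; apply: eq_bigr => j _; rewrite !coef_poly.
  by have := ltn_ord j; have := ltn_ord i => li lj; rewrite !ifT //; lia.
have -> : (take_poly K (p * q)).[x] = p.[x] * q.[x] - r.[x] * x ^+ K.
  have := congr1 (horner^~ x) (poly_take_drop K (p * q)).
  by rewrite /= hornerD !hornerM hornerXn => <-; rewrite addrK.
by ring.
Qed.

Lemma etaylorD f g a b : etaylor f a -> etaylor g b ->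
  etaylor (fun z => f z + g z) (fun k => a k + b k).
Proof.
move=> fa gb K; have [h hh fh] := fa K; have [k hk gk] := gb K.
exists (fun z => h z + k z); first exact: (hol0D hh hk).
apply: filterS2 fh gk => z -> ->.
by under [in RHS]eq_bigr do rewrite mulrDl; rewrite big_split /=; ring.
Qed.

Lemma etaylor_cst (c : C) : etaylor (fun=> c) (fun k => (k == 0%N)%:R * c).
Proof.
case=> [|K].
  exists (fun=> c); first exact: hol0_cst.
  by near=> z; rewrite big_ord0 add0r expr0 mul1r.
exists (fun=> 0); first exact: hol0_cst.
near=> z; rewrite big_ord_recl /= big1 ?mul1r ?mulr1 ?mulr0 ?addr0 // => i _.
by rewrite /= !mul0r.
Unshelve. all: by end_near. Qed.

Lemma etaylor_sq : etaylor (fun z : C => z ^+ 2) (fun k => (k == 1%N)%:R).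
Proof.
case=> [|[|K]].
- exists (fun z => z ^+ 2); first exact: hol0_sq.
  by near=> z; rewrite big_ord0 add0r expr0 mul1r.
- exists (fun=> 1); first exact: hol0_cst.
  by near=> z; rewrite big_ord1 mul0r add0r expr1 mulr1.
exists (fun=> 0); first exact: hol0_cst.
near=> z; rewrite 2!big_ord_recl /= big1 ?mul1r ?mul0r ?add0r ?mulr0 ?addr0 // => i _.
by rewrite /= !mul0r.
Unshelve. all: by end_near. Qed.

Lemma near_etaylor f g a : (\forall z \near (0 : C)^', f z = g z) ->
  etaylor f a -> etaylor g a.
Proof.
move=> e fa K; have [h hh fh] := fa K; exists h; first exact: hh.
by apply: filterS2 e fh => z <-.
Qed.

Lemma etaylor_geom (X : C) : X != 0 -> etaylor (fun z => (X - z ^+ 2)^-1) (fun k => X ^- k.+1).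
Proof.
move=> X0 K; exists (fun z => X ^- K * (X - z ^+ 2)^-1).
  exact: (hol0M (hol0_cst _) (hol0_sqrV X0)).
apply: filterS (near_sqr_neq X0) => z; set x := z ^+ 2 => xX.
elim: K => [|K IH]; first by rewrite big_ord0 add0r expr0 invr1 !mul1r.
rewrite [LHS]IH big_ord_recr /= -addrA; congr (_ + _).
have XK : X ^+ K != 0 by rewrite expf_neq0.
rewrite !exprSr; move: (X ^+ K) XK (x ^+ K) => A A0 B.
by field; rewrite X0 A0 xX.
Qed.

(** W_{0,2}(z,w) + W_{0,2}(-z,w) = 2 (w^2 + z^2) / (w^2 - z^2)^2 is even in z.  With the remainder in
closed form, the step from K to K + 1 is a rational identity. *)
Lemma etaylor_W02 (w : C) : w != 0 ->
  etaylor (fun z => ((z - w) ^+ 2)^-1 + ((- z - w) ^+ 2)^-1)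
    (fun k => 2 * (k.*2.+1%:R * (w ^+ 2) ^- k.+1)).
Proof.
move=> w0; set X := w ^+ 2; have X0 : X != 0 by rewrite expf_neq0.
move=> K; exists (fun z => 2 * X ^- K *
    ((2 * K%:R + 1) * X + (1 - 2 * K%:R) * z ^+ 2) * ((X - z ^+ 2)^-1 * (X - z ^+ 2)^-1)).
  exact: (hol0M (hol0M (hol0_cst _) (hol0D (hol0_cst _) (hol0M (hol0_cst _) (@hol0_sq C))))
    (hol0M (hol0_sqrV X0) (hol0_sqrV X0))).
apply: filterS (near_sqr_neq X0) => z xX.
have -> : ((z - w) ^+ 2)^-1 + ((- z - w) ^+ 2)^-1 =
   2 * (X + z ^+ 2) * ((X - z ^+ 2)^-1 * (X - z ^+ 2)^-1).
  have : (w - z) * (w + z) != 0 by rewrite -subr_sqr.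
  rewrite mulf_eq0 negb_or /X => /andP[n1 n2]; field.
  have -> : - z - w = - (w + z) by ring.
  by rewrite subr_sqr mulf_neq0 //= -[z - w]opprB !oppr_eq0 n2.
move: (z ^+ 2) xX => x xX.
elim: K => [|K IH]; first by rewrite big_ord0 add0r !expr0 invr1 mulr0 subr0 mul1r; ring.
rewrite [LHS]IH big_ord_recr /= -addrA; congr (_ + _).
have XK : X ^+ K != 0 by rewrite expf_neq0.
rewrite !exprSr natr_odd -[K.+1]addn1 natrD; move: (X ^+ K) XK (x ^+ K) => A A0 B.
by field; rewrite xX A0 X0.
Qed.

(** Symmetrized in z -> -z the product of the two W_{0,2} is even, a polynomial in z^2 divided by
(x^2 - z^2)^2 (y^2 - z^2)^2; the residue needs only its value at 0. *)
Lemma etaylor_W02_pair (x y : C) : x != 0 -> y != 0 ->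
  exists2 a, a 0%N = 2 * ((x ^+ 2)^-1 * (y ^+ 2)^-1) &
  etaylor (fun z => ((z - x) ^+ 2)^-1 * ((- z - y) ^+ 2)^-1 +
                    ((z - y) ^+ 2)^-1 * ((- z - x) ^+ 2)^-1) a.
Proof.
move=> x0 y0; set X := x ^+ 2; set Y := y ^+ 2.
have X0 : X != 0 by rewrite expf_neq0.
have Y0 : Y != 0 by rewrite expf_neq0.
have iX := etaylor_geom X0; have iY := etaylor_geom Y0.
have n := etaylorD (etaylor_cst (2 * (X * Y))) (etaylorM (@etaylor_sq)
  (etaylorD (etaylor_cst (2 * ((x - y) ^+
    2 - 2 * x * y))) (etaylorM (etaylor_cst 2) (@etaylor_sq)))).
have t := etaylorM (etaylorM n (etaylorM iX iX)) (etaylorM iY iY).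
eexists; last first.
  apply: near_etaylor t; apply: filterS2 (near_sqr_neq X0) (near_sqr_neq Y0) => z.
  rewrite {1}/X {1}/Y !subr_sqr !mulf_eq0 !negb_or => /andP[n1 n2] /andP[n3 n4].
  rewrite /X /Y; field.
  have -> : - z - y = - (y + z) by ring.
  have -> : - z - x = - (x + z) by ring.
  rewrite -[z - x]opprB -[z - y]opprB !oppr_eq0.
  by rewrite n1 n2 n3 n4.
rewrite /conv !big_ord1 /= !expr1; field.
by rewrite X0 Y0.
Qed.
End Expansions.

(** * Topological recursion in closed form *)

Section TopologicalRecursion.
Variable C : numFieldType.
Implicit Types (z w : C) (zs : seq C) (N g : nat).

Lemma sum_splits_nil1 (F : seq C -> C) zs :
  \sum_(p <- splits zs) (if p.1 is [::] then 1 else 0) * F p.2 = F zs.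
Proof.
elim: zs F => [|z zs IH] F; first by rewrite big_seq1 mul1r.
rewrite (sum_splits_cons (fun s t => (if s is [::] then 1 else 0) * F t)).
rewrite big1 ?add0r => [|p _]; last by rewrite mul0r.
exact: (IH (fun t => F (z :: t))).
Qed.

Lemma sum_splits_single (G : C -> C) (F : seq C -> C) zs :
  \sum_(p <- splits zs) (if p.1 is [:: w] then G w else 0) * F p.2 =
  \sum_(p <- picks zs) G p.1 * F p.2.
Proof.
elim: zs F => [|z zs IH] F; first by rewrite big_seq1 big_nil mul0r.
rewrite (sum_splits_cons (fun s t => (if s is [:: w] then G w else 0) * F t)).
rewrite (sum_picks_cons (fun w t => G w * F t)); congr (_ + _); last
  exact: (IH (fun t => F (z :: t))).
rewrite -(sum_splits_nil1 (fun t => G z * F t)); apply: eq_bigr => -[[|w s] t] _ /=.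
  by rewrite mul1r.
by rewrite !mul0r.
Qed.

Definition w02 z zs : C := if zs is [:: w] then ((z - w) ^+ 2)^-1 else 0.

(** The closed form of W_{g,n+1}(z, zs) to be established, with the unstable W_{0,1} and W_{0,2}
included. *)
Definition laurent_W N g z zs : C := lsum N (z :: zs) (corr_g C g) + (g == 0%N)%:R * w02 z zs.

(** The integrand whose residue at 0 is z0^(-2 (m + 1)), see [pole_kernel_residue]. *)
Definition pole_kernel z0 z (m : nat) : C := z^-1 * ((z ^+ 2) ^- m * (z0 ^+ 2 - z ^+ 2)^-1).

Lemma lsum_even N z zs phi : lsum N (- z :: zs) phi = lsum N (z :: zs) phi.
Proof. by rewrite /= sqrrN. Qed.

Arguments lsum : simpl never.

(** The products with W_{0,2} as one factor combine to W_{0,2}(z,w) + W_{0,2}(-z,w), because stable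
factors are even in z.  This is the combination that has an even Taylor expansion. *)
Lemma laurent_W_products N g z zs :
  \sum_(g1 < g.+1) \sum_(p <- splits zs) laurent_W N g1 z p.1 * laurent_W N (g - g1) (- z) p.2 =
  \sum_(g1 < g.+1) \sum_(p <- splits zs)
     lsum N (z :: p.1) (corr_g C g1) * lsum N (z :: p.2) (corr_g C (g - g1))
  + \sum_(p <- picks zs) (((z - p.1) ^+ 2)^-1 + ((- z - p.1) ^+
    2)^-1) * lsum N (z :: p.2) (corr_g C g)
  + (g == 0%N)%:R * \sum_(p <- splits zs) w02 z p.1 * w02 (- z) p.2.
Proof.
pose L g := fun t => lsum N (z :: t) (corr_g C g).
have -> : \sum_(p <- picks zs) (((z - p.1) ^+ 2)^-1 + ((- z - p.1) ^+
  2)^-1) * lsum N (z :: p.2) (corr_g C g)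
  = \sum_(p <- splits zs) w02 z p.1 * L g p.2 + \sum_(p <- splits zs) L g p.1 * w02 (- z) p.2.
  rewrite -(sum_splits_single (fun w => ((z - w) ^+ 2)^-1 + ((- z - w) ^+ 2)^-1) (L g)).
  rewrite [X in _ = _ + X](sum_splits_swap (fun s t => L g s * w02 (- z) t)) -big_split.
  apply: eq_bigr => -[[|w [|w' s]] t] _ /=; rewrite ?mul0r ?mulr0 ?addr0 //.
  by rewrite mulrDl [_ * L g t in RHS]mulrC; congr (_ + _); rewrite mulrC.
have -> : \sum_(p <- splits zs) w02 z p.1 * L g p.2 =
  \sum_(g1 < g.+1) \sum_(p <- splits zs) (nat_of_ord g1 == 0%N)%:R * w02 z p.1 * L (g - g1)%N p.2.
  rewrite [RHS]big_ord_recl [X in _ = _ + X]big1 ?addr0 => [|i _]; last first.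
    by rewrite big1 // => p _; rewrite !mul0r.
  by apply: eq_bigr => p _; rewrite mul1r subn0.
have -> : \sum_(p <- splits zs) L g p.1 * w02 (- z) p.2 =
  \sum_(g1 < g.+1) \sum_(p <- splits zs) L g1 p.1 * ((g - g1 == 0)%N%:R * w02 (- z) p.2).
  rewrite [RHS]big_ord_recr /= [X in _ = X + _]big1 ?add0r => [|i _]; last first.
    rewrite big1 // => p _; rewrite (_ : (g - i == 0)%N = false) ?mul0r ?mulr0 //.
    by have := ltn_ord i; lia.
  by apply: eq_bigr => p _; rewrite subnn mul1r.
have -> : (g == 0%N)%:R * \sum_(p <- splits zs) w02 z p.1 * w02 (- z) p.2 =
  \sum_(g1 < g.+1) \sum_(p <- splits zs)
   ((nat_of_ord g1 == 0%N)%:R * w02 z p.1) * ((g - g1 == 0)%N%:R * w02 (- z) p.2).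
  rewrite big_ord_recl [X in _ = _ + X]big1 ?addr0 => [|i _]; last first.
    by rewrite big1 // => p _; rewrite !mul0r.
  by rewrite mulr_sumr; apply: eq_bigr => p _; rewrite /= subn0; ring.
rewrite -!big_split; apply: eq_bigr => g1 _ /=.
rewrite -!big_split; apply: eq_bigr => p _ /=.
by rewrite /laurent_W /L lsum_even; ring.
Qed.

Lemma lsum_cons N z zs (phi : seq nat -> C) :
  lsum N (z :: zs) phi = \sum_(d < N) (z ^+ 2) ^- d.+1 * lsum N zs (der d phi).
Proof. by []. Qed.

Lemma lsum_nil N (phi : seq nat -> C) : lsum N [::] phi = phi [::].
Proof. by []. Qed.

Lemma expV_addS z b c : (z ^+ 2) ^- b.+1 * (z ^+ 2) ^- c.+1 = (z ^+ 2) ^- (b + c + 2).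
Proof. by rewrite -invfM -exprD; congr (_ ^- _); lia. Qed.

Lemma lsum_mul N z s t (phi psi : seq nat -> C) :
  lsum N (z :: s) phi * lsum N (z :: t) psi = \sum_(b < N) \sum_(c < N)
    (lsum N s (der b phi) * lsum N t (der c psi)) * (z ^+ 2) ^- (b + c + 2).
Proof.
rewrite !lsum_cons mulr_suml; apply: eq_bigr => b _; rewrite mulr_sumr; apply: eq_bigr => c _.
by rewrite -expV_addS; ring.
Qed.

Lemma pole_kernel_residue z0 m : z0 != 0 ->
  is_residue0 (fun z => pole_kernel z0 z m) ((z0 ^+ 2) ^- m.+1).
Proof.
move=> z00; have X0 : z0 ^+ 2 != 0 by rewrite expf_neq0.
exact: (etaylor_residue m (etaylor_geom X0)).
Qed.

Lemma picks_in (T : eqType) (s : seq T) p : p \in picks s -> p.1 \in s.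
Proof.
elim: s p => [|x s IH] p // pI.
have [->|] : p = (x, s) \/ p \in [seq (q.1, x :: q.2) | q <- picks s].
- by move: pI; rewrite in_cons => /orP[/eqP|]; [left|right].
- exact: mem_head.
by move=> /mapP[q qI ->]; rewrite in_cons (IH q qI) orbT.
Qed.

Lemma w02_pair_residue N z0 zs : (0 < N)%N -> z0 != 0 -> (forall w, w \in zs -> w != 0) ->
  is_residue0 (fun z => z^-1 * ((z ^+ 2) ^- 0 *
     ((\sum_(p <- splits zs) w02 z p.1 * w02 (- z) p.2) * (z0 ^+ 2 - z ^+ 2)^-1)))
   (2 * ((z0 ^+ 2)^-1 * lsum N zs (single C [:: 0%N; 0%N]))).
Proof.
move=> N0 z00 zs0; have X0 : z0 ^+ 2 != 0 by rewrite expf_neq0.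
(* Both sides vanish unless zs has two entries. *)
have off : size zs != 2 ->
  is_residue0 (fun z => z^-1 * ((z ^+ 2) ^- 0 *
     ((\sum_(p <- splits zs) w02 z p.1 * w02 (- z) p.2) * (z0 ^+ 2 - z ^+ 2)^-1)))
   (2 * ((z0 ^+ 2)^-1 * lsum N zs (single C [:: 0%N; 0%N]))).
  move=> s2; rewrite lsum0 ?mulr0; last first.
    by move=> I sI; rewrite /single; case: eqP => // I0; rewrite -sI I0 in s2.
  rewrite (_ : (fun z => _) = fun=> 0); first exact: is_residue00.
  apply/funext => z; rewrite big_seq big1 ?mul0r ?mulr0 // => -[s t] /splits_size /= st.
  move: s2; rewrite -st; case: s {st} => [|x [|x' s]]; rewrite ?mul0r //.
  by case: t => [|y [|y' t]]; rewrite ?mulr0.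
have [s2|/off //] := eqVneq (size zs) 2.
case: zs zs0 s2 {off} => [|x [|y [|? ?]]] // zs0 _.
have x0 : x != 0 by apply: zs0; rewrite !inE eqxx.
have y0 : y != 0 by apply: zs0; rewrite !inE eqxx orbT.
have [a a0 ta] := etaylor_W02_pair x0 y0.
have := etaylor_residue 0 (etaylorM ta (etaylor_geom X0)).
rewrite /conv big_ord1 a0 subnn expr1 => r.
rewrite [X in is_residue0 _ X](_ : _ = 2 * ((x ^+ 2)^-1 * (y ^+ 2)^-1) * (z0 ^+ 2)^-1); last first.
  case: N N0 => // N _.
  rewrite -[[:: 0%N; 0%N]]/(nseq 2 0%N) !lsum_single0 lsum_nil /single eqxx mulr1; ring.
rewrite (_ : (fun z => _) = (fun z => z^-1 * (z ^+ 2 ^- 0 *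
   ((((z - x) ^+ 2)^-1 * ((- z - y) ^+ 2)^-1 + ((z - y) ^+ 2)^-1 * ((- z - x) ^+ 2)^-1) *
     (z0 ^+ 2 - z ^+ 2)^-1)))) //.
apply/funext => z; congr (_ * (_ * (_ * _))).
by rewrite /= !big_cons big_nil /= !(mul0r, mulr0, add0r, addr0).
Qed.

(** The residue in the recursion with all W replaced by their closed form: each of the five
kinds of terms is an even expansion times z^(-2m-1), and the residues are the
terms of [corr_lsum_rec]. *)
Lemma laurent_W_residue N g z0 zs : (6 * g + 3 * size zs < N)%N -> z0 != 0 ->
  (forall w, w \in zs -> w != 0) ->
  is_residue0 (fun z => (z * (z0 ^+ 2 - z ^+ 2))^-1 *
    ((if g is g'.+1 then laurent_W N g' z (- z :: zs) else 0) +
     \sum_(g1 < g.+1) \sum_(p <- splits zs) laurent_W N g1 z p.1 * laurent_W N (g - g1) (- z) p.2))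
   (2 * lsum N (z0 :: zs) (corr_g C g)).
Proof.
move=> Nbig z00 zs0; have X0 : z0 ^+ 2 != 0 by rewrite expf_neq0.
have N0 : (0 < N)%N by lia.
rewrite (corr_lsum_rec z0 Nbig).
(* TC, TA, TB, TD, TE are the five kinds of terms of the recursion, in the order of
   [corr_lsum_rec]. *)
pose X1 b c := if g is g'.+1 then lsum N zs (der c (der b (corr_g C g'))) else 0.
pose X2 b c := \sum_(g1 < g.+1) \sum_(p <- splits zs)
        lsum N p.1 (der b (corr_g C g1)) * lsum N p.2 (der c (corr_g C (g - g1))).
pose W z w := ((z - w) ^+ 2)^-1 + ((- z - w) ^+ 2)^-1.
pose k z := (z0 ^+ 2 - z ^+ 2)^-1.
pose TA z := \sum_(b < N) \sum_(c < N) X1 b c * pole_kernel z0 z (b + c + 2).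
pose TB z := \sum_(b < N) \sum_(c < N) X2 b c * pole_kernel z0 z (b + c + 2).
pose TC z := \sum_(p <- picks zs) \sum_(e < N)
  lsum N p.2 (der e (corr_g C g)) * (z^-1 * ((z ^+ 2) ^- e.+1 * (W z p.1 * k z))).
pose TD z := (g == 0%N)%:R * (z^-1 * ((z ^+ 2) ^- 0 *
     ((\sum_(p <- splits zs) w02 z p.1 * w02 (- z) p.2) * k z))).
pose TE z := ((g == 1%N)%:R * (lsum N zs (single C [::]) / 4)) * pole_kernel z0 z 1.
rewrite (_ : (fun z => _) = fun z => TC z + TA z + TB z + TD z + TE z); last first.
  apply/funext => z; rewrite laurent_W_products invfM -/(k z).
  have eA : z^-1 * k z * (if g is g'.+1 then lsum N (z :: - z :: zs) (corr_g C g') else 0) = TA z.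
    rewrite /TA /X1; case: (g) => [|g'].
      by rewrite mulr0 big1 // => b _; rewrite big1 // => c _; rewrite mul0r.
    rewrite lsum_cons mulr_sumr; apply: eq_bigr => b _.
    rewrite lsum_even lsum_cons !mulr_sumr; apply: eq_bigr => c _.
    by rewrite /pole_kernel -expV_addS -/(k z); ring.
  have eE : z^-1 * k z * (if g is g'.+1 then (g' == 0%N)%:R * w02 z (- z :: zs) else 0) = TE z.
    rewrite /TE; case: (g) => [|[|g']]; rewrite ?mul0r ?mulr0 ?mul0r //.
    rewrite /pole_kernel expr1 -/(k z); case: (zs) => [|? ?] /=; last first.
      by rewrite lsum0 ?mul0r ?mulr0 ?mul0r // => -[].
    rewrite lsum_nil /single eqxx (_ : (z - - z) ^+ 2 = 4 * z ^+ 2); last by ring.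
    by rewrite invfM !mul1r; ring.
  have eB : z^-1 * k z * (\sum_(g1 < g.+1) \sum_(p <- splits zs)
     lsum N (z :: p.1) (corr_g C g1) * lsum N (z :: p.2) (corr_g C (g - g1))) = TB z.
    rewrite /TB /X2.
    under eq_bigr => g1 _ do under eq_bigr => p _ do rewrite lsum_mul.
    under eq_bigr => g1 _ do rewrite exchange_big /=.
    rewrite exchange_big mulr_sumr; apply: eq_bigr => b _ /=.
    under eq_bigr => g1 _ do rewrite exchange_big /=.
    rewrite exchange_big mulr_sumr; apply: eq_bigr => c _ /=.
    rewrite /pole_kernel -/(k z) mulr_suml mulr_sumr; apply: eq_bigr => g1 _.
    by rewrite mulr_suml mulr_sumr; apply: eq_bigr => p _; ring.
  have eC : z^-1 * k z * (\sum_(p <- picks zs) W z p.1 * lsum N (z :: p.2) (corr_g C g)) = TC z.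
    rewrite mulr_sumr; apply: eq_bigr => p _.
    by rewrite lsum_cons !mulr_sumr; apply: eq_bigr => e _; ring.
  rewrite -eA -eB -eC -eE /TD expr0 invr1 /laurent_W /W.
  by case: (g) => [|g']; ring.
pose Z m := (z0 ^+ 2) ^- m.+1.
have rA : is_residue0 TA (\sum_(b < N) \sum_(c < N) X1 b c * Z (b + c + 2)%N).
  apply: is_residue0_sum => b _; apply: is_residue0_sum => c _.
  by apply: is_residue0Z; apply: pole_kernel_residue.
have rB : is_residue0 TB (\sum_(b < N) \sum_(c < N) X2 b c * Z (b + c + 2)%N).
  apply: is_residue0_sum => b _; apply: is_residue0_sum => c _.
  by apply: is_residue0Z; apply: pole_kernel_residue.
have rD : is_residue0 TD ((g == 0%N)%:R * (2 * ((z0 ^+ 2)^-1 * lsum N zs (single C [:: 0%N;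
  0%N])))).
  by apply: is_residue0Z; apply: w02_pair_residue.
have rE : is_residue0 TE ((g == 1%N)%:R * (lsum N zs (single C [::]) / 4) * Z 1%N).
  by apply: is_residue0Z; apply: pole_kernel_residue.
have rC : is_residue0 TC (\sum_(p <- picks zs) \sum_(e < N)
  lsum N p.2 (der e (corr_g C g)) * conv (fun i => 2 * (i.*2.+1%:R * (p.1 ^+ 2) ^- i.+1)) Z e.+1).
  apply: is_residue0_sum => p pI; apply: is_residue0_sum => e _.
  apply: is_residue0Z; apply: etaylor_residue; apply: etaylorM (etaylor_geom X0).
  by apply: etaylor_W02; apply: zs0; apply: picks_in.
have := is_residue0D (is_residue0D (is_residue0D (is_residue0D rC rA) rB) rD) rE.
congr is_residue0; rewrite !mulrDr; congr (_ + _ + _ + _ + _).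
- rewrite mulr_sumr; apply: eq_bigr => p _; rewrite mulr_sumr; apply: eq_bigr => e _.
  rewrite mulrC mulrA; congr (_ * _); rewrite /conv mulr_sumr; apply: eq_bigr => i _.
  by rewrite /Z; ring.
- rewrite mulrA divff ?mul1r ?pnatr_eq0 //; apply: eq_bigr => b _; apply: eq_bigr => c _.
  exact: mulrC.
- rewrite mulrA divff ?mul1r ?pnatr_eq0 //; apply: eq_bigr => b _; apply: eq_bigr => c _.
  exact: mulrC.
- by rewrite mulrCA.
- by rewrite /Z; field.
Qed.
Lemma splits_in (T : eqType) (s : seq T) p (w : T) :
  p \in splits s -> (w \in p.1) || (w \in p.2) -> w \in s.
Proof.
elim: s p => [|x s IH] p /=; first by rewrite in_cons orbF => /eqP ->.
rewrite mem_cat => /orP[] /mapP[q qI ->]; rewrite !in_cons.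
  by rewrite -orbA => /orP[->//|/(IH q qI) ->]; rewrite orbT.
by rewrite orbCA => /orP[->//|/(IH q qI) ->]; rewrite orbT.
Qed.

Lemma lsum_unstable N z zs : (size zs < 2)%N -> lsum N (z :: zs) (corr_g C 0) = 0.
Proof.
move=> s2; apply: lsum0 => I sI; rewrite /corr_g /of_genus sI.
have -> : (wt I + 6 == 6 * 0 + 3 * size (z :: zs))%N = false; last by rewrite mul0r.
by apply/eqP => /=; case: I sI => [|i [|j I]] //=; rewrite ?wt_cons; lia.
Qed.

Lemma laurent_W01 N z : laurent_W N 0 z [::] = 0.
Proof. by rewrite /laurent_W lsum_unstable // mulr0 addr0. Qed.

(** Induction on 2g + n.  The integrand of the recursion agrees with that of the closed form at
all z different from 0; terms with W_{0,1} vanish on both sides. *)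
Lemma EO_W_lsum N g z0 zs : (1 < 2 * g + size zs)%N -> (6 * g + 3 * size zs < N)%N ->
  z0 != 0 -> (forall w, w \in zs -> w != 0) ->
  EO_W g (z0 :: zs) = lsum N (z0 :: zs) (corr_g C g).
Proof.
have [m] := ubnP (2 * g + size zs); elim: m g z0 zs => // m IH g z0 zs lm st Nbig z00 zs0.
have EO_W_laurent g' z zs' : (2 * g' + size zs' < 2 * g + size zs)%N -> (g' <= g)%N ->
    z != 0 -> (forall w, w \in zs' -> w != 0) -> EO_W g' (z :: zs') = laurent_W N g' z zs'.
  move=> lt lg zn zn'; rewrite /laurent_W; have [st'|] := leqP 2 (2 * g' + size zs').
    rewrite (IH g' z zs') //; [|lia|lia].
    case: g' {lt lg} st' => [|g'] st'; last by rewrite mul0r addr0.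
    by case: zs' zn' st' => [|? [|? ?]] //= _ _; rewrite mulr0 addr0.
  case: g' lt lg => [|g'] lt lg; last by lia.
  move=> s2; rewrite lsum_unstable // mul1r add0r.
  by case: zs' zn' lt s2 => [|w [|? ?]].
rewrite EO_W_rec // (residue0E (r := 2 * lsum N (z0 :: zs) (corr_g C g))).
  by rewrite mulKf ?pnatr_eq0.
apply: near_is_residue0 (laurent_W_residue Nbig z00 zs0).
have nz : \forall z \near (0 : C)^', z != 0 by exact: nbhs_dnbhs_neq.
apply: filterS nz => z zn; have nzn : - z != 0 by rewrite oppr_eq0.
rewrite /EO_integrand; congr (_ * (_ + _)).
  case: g {IH EO_W_laurent Nbig} lm st (EO_W_laurent) => [|g'] lm st EO_W_laurent //.
  rewrite EO_W_laurent //=; [lia|].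
  by move=> w; rewrite in_cons => /orP[/eqP -> //|/zs0].
apply: eq_bigr => g1 _; have lg1 : (g1 <= g)%N by rewrite -ltnS.
rewrite (@sum_subtuple C zs (fun a b => EO_W g1 (z :: a) * EO_W (g - g1)%N (- z :: b))).
apply: eq_big_seq => -[a b] pI /=; have sab : (size a + size b = size zs)%N := splits_size pI.
have a0 w : w \in a -> w != 0 by move=> wa; apply: zs0; apply: (splits_in pI); rewrite /= wa.
have b0 w : w \in b -> w != 0 by move=> wb; apply: zs0; apply: (splits_in pI); rewrite /= wb orbT.
have [e|ne] := posnP (2 * g1 + size a)%N.
  have [g10 sa0] : nat_of_ord g1 = 0%N /\ size a = 0%N by lia.
  by rewrite g10 (size0nil sa0) EO_W01 laurent_W01 !mul0r.
have [e|ne'] := posnP (2 * (g - g1) + size b)%N.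
  have [g10 sb0] : (g - g1 = 0)%N /\ size b = 0%N by lia.
  by rewrite g10 (size0nil sb0) EO_W01 laurent_W01 !mulr0.
have [l1 l2] : (2 * g1 + size a < 2 * g + size zs)%N /\
    (2 * (g - g1) + size b < 2 * g + size zs)%N.
  move: (nat_of_ord g1) lg1 ne ne' => k; move: (size a) (size b) (size zs) sab => x y t.
  by lia.
by rewrite !EO_W_laurent // leq_subr.
Qed.
End TopologicalRecursion.

(** * Uniqueness of the antiderivative from infinity *)

Section Antiderivatives.
Variable R : realType.
Local Notation C := (CC R).
Local Notation Re := (@complex.Re R).
Local Notation Im := (@complex.Im R).

Definition cplx (x y : R) : C := Complex x y.

Lemma normC_le (z : C) : `|z| <= cplx (`|Re z| + `|Im z|) 0.
Proof.
rewrite normc_def /cplx -[Complex _ 0]/((`|Re z| + `|Im z|)%:C)%C lecR.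
rewrite -[leRHS]ger0_norm ?addr_ge0 // -sqrtr_sqr ler_wsqrtr // sqrrD !real_normK ?num_real //.
by rewrite -addrA [_ *+ 2 + _]addrC addrA lerDl mulrn_wge0 ?mulr_ge0.
Qed.

Lemma normRe_le (z : C) : cplx `|Re z| 0 <= `|z|.
Proof. exact: normc_ge_Re. Qed.

Lemma normIm_le (z : C) : cplx `|Im z| 0 <= `|z|.
Proof.
rewrite normc_def /cplx -[Complex _ 0]/(`|Im z|%:C)%C lecR.
by rewrite -sqrtr_sqr ler_wsqrtr // lerDr sqr_ge0.
Qed.

Lemma cvg_complex (T : Type) (F : set_system T) {FF : Filter F} (f : T -> C) (l : C) :
  Re (f t) @[t --> F] --> Re l -> Im (f t) @[t --> F] --> Im l -> f @ F --> l.
Proof.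
move=> /cvgrPdist_lt fr /cvgrPdist_lt fi; apply/cvgrPdist_lt => -[e e'].
rewrite ltcE /= => /andP[/eqP -> e0].
have e2 : 0 < e / 2 by rewrite divr_gt0.
apply: filterS2 (fr _ e2) (fi _ e2) => t rt it.
apply: le_lt_trans (normC_le _) _; rewrite /cplx ltcE /= eqxx /=.
rewrite [ltRHS]splitr; apply: ltrD.
  by move: rt; case: (l) (f t) => [a b] [c d].
by move: it; case: (l) (f t) => [a b] [c d].
Qed.

Lemma cvg_Re (T : Type) (F : set_system T) {FF : Filter F} (f : T -> C) (l : C) :
  f @ F --> l -> Re (f t) @[t --> F] --> Re l.
Proof.
move=> /cvgrPdist_lt fl; apply/cvgrPdist_lt => e e0.
have e0' : 0 < cplx e 0 by rewrite ltcE /= eqxx.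
apply: filterS (fl _ e0') => t; move/(le_lt_trans (normRe_le _)).
by rewrite ltcE /= => /andP[_]; case: (l) (f t) => [a b] [c d].
Qed.

Lemma cvg_Im (T : Type) (F : set_system T) {FF : Filter F} (f : T -> C) (l : C) :
  f @ F --> l -> Im (f t) @[t --> F] --> Im l.
Proof.
move=> /cvgrPdist_lt fl; apply/cvgrPdist_lt => e e0.
have e0' : 0 < cplx e 0 by rewrite ltcE /= eqxx.
apply: filterS (fl _ e0') => t; move/(le_lt_trans (normIm_le _)).
by rewrite ltcE /= => /andP[_]; case: (l) (f t) => [a b] [c d].
Qed.

Lemma cvg_cplx (T : Type) (F : set_system T) {FF : Filter F} (f : T -> R) (l : R) :
  f @ F --> l -> cplx (f t) 0 @[t --> F] --> cplx l 0.
Proof. by move=> fl; apply: cvg_complex => //=; apply: cvg_cst. Qed.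

Lemma expC_continuous (T : Type) (F : set_system T) {FF : Filter F} (f : T -> C) (l : C) :
  f @ F --> l -> expC (f t) @[t --> F] --> expC l.
Proof.
move=> fl; have fr := @cvg_Re _ _ FF _ _ fl; have fi := @cvg_Im _ _ FF _ _ fl.
have er : expR (Re (f t)) @[t --> F] --> expR (Re l).
  exact: (continuous_cvg FF (@continuous_expR R _) fr).
have ec : cos (Im (f t)) @[t --> F] --> cos (Im l).
  exact: (continuous_cvg FF (@continuous_cos R _) fi).
have es : sin (Im (f t)) @[t --> F] --> sin (Im l).
  exact: (continuous_cvg FF (@continuous_sin R _) fi).
have reE z : Re (expC z) = expR (Re z) * cos (Im z) by case: z.
have imE z : Im (expC z) = expR (Re z) * sin (Im z) by case: z.
apply: cvg_complex; [rewrite reE|rewrite imE].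
  rewrite (_ : (fun t => _) = (fun t => expR (Re (f t)) * cos (Im (f t)))); first exact: cvgM.
  by apply/funext => t; rewrite reE.
rewrite (_ : (fun t => _) = (fun t => expR (Re (f t)) * sin (Im (f t)))); first exact: cvgM.
by apply/funext => t; rewrite imE.
Qed.

Lemma expCD (z w : C) : expC (z + w) = expC z * expC w.
Proof.
case: z w => [a b] [c d] /=; rewrite expRD cosD sinD.
by apply/eqP; rewrite eq_complex /=; apply/andP; split; apply/eqP; ring.
Qed.

Lemma expC0 : expC (0 : C) = 1.
Proof. by rewrite /expC /= expR0 cos0 sin0 mulr1 mulr0. Qed.

(** Along the path t |-> p (1 + t^2), which avoids 0 and goes from p to infinity, the real and
imaginary parts of D are real functions with zero derivative, hence constant; the
constant is the limit 0.  The square avoids any restriction on t. *)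
Lemma derive0_vanish (D : C -> C) (p : C) : p != 0 ->
  (forall z : C, z != 0 -> is_derive z (1 : C) D 0) -> D x^-1 @[x --> (0 : C)^'] --> (0 : C) ->
  D p = 0.
Proof.
move=> p0 dD Dinf.
have cD (a b : R) : cplx (a + b) 0 = cplx a 0 + cplx b 0 by rewrite /cplx; simpc.
have cM (a b : R) : cplx (a * b) 0 = cplx a 0 * cplx b 0 by rewrite /cplx; simpc.
(* gam is the path from p to infinity, and q z the difference quotient of D at z. *)
pose gam (t : R) : C := p * cplx (1 + t ^+ 2) 0.
have gam0 t : gam t != 0.
  rewrite mulf_neq0 // eq_complex /= negb_and; apply/orP; left.
  by rewrite gt_eqF // ltr_wpDr ?sqr_ge0.
pose q (z h : C) := h^-1 * (D (z + h) - D z).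
have qE z h : D (z + h) - D z = h * q z h.
  have [->|h0] := eqVneq h 0; first by rewrite addr0 subrr mul0r.
  by rewrite /q mulrA divff ?mul1r.
have q0 z : z != 0 -> q z h @[h --> (0 : C)] --> (0 : C).
  move=> z0; have [dz Dz] := dD z z0.
  have qc : (fun h : C => h^-1 *: ((D \o shift z) (h *: (1 : C)) - D z)) @ (0 : C)^'
      --> 'D_(1 : C) D z := dz.
  rewrite Dz in qc.
  rewrite (_ : (fun h : C => _) = q z) in qc; last first.
    apply/funext => h; rewrite /q; congr (h^-1 * (D _ - D z)).
    by transitivity (h * 1 + z); [|rewrite mulr1 addrC].
  apply/(@cvgrPdist_lt _ _ _ (nbhs (0 : C)) _ (q z) 0) => e e0.
  move/cvgrPdist_lt: qc => /(_ e e0).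
  rewrite near_withinE; apply: filterS => h hq.
  by have [->|/hq//] := eqVneq h 0; rewrite /q invr0 mul0r subrr normr0.
have const (pr : C -> R) : (forall a b, pr (a - b) = pr a - pr b) ->
    (forall (s : R) a, pr (cplx s 0 * a) = s * pr a) ->
    (forall w : R -> C, w @ (0 : R)^' --> (0 : C) -> pr (w s) @[s --> (0 : R)^'] --> (0 : R)) ->
    forall t, pr (D (gam t)) = pr (D (gam 0)).
  move=> prB prZ prc t; apply: (@is_derive_0_is_cst R (fun t => pr (D (gam t)))) => {}t.
  pose w (s : R) : C := p * cplx (t + t + s) 0 * q (gam t) (p * cplx ((t + t) * s + s * s) 0).
  have wc : w @ (0 : R)^' --> (0 : C).
    have idc : (fun s : R => s) @ (0 : R)^' --> (0 : R) by exact: cvg_within.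
    have c1 : p * cplx (t + t + s) 0 @[s --> (0 : R)^'] --> p * cplx (t + t + 0) 0.
      apply: cvgM; first exact: cvg_cst.
      by apply: cvg_cplx; apply: cvgD => //; exact: cvg_cst.
    have c2 : p * cplx ((t + t) * s + s * s) 0 @[s --> (0 : R)^'] --> (0 : C).
      rewrite (_ : 0 = p * cplx ((t + t) * 0 + 0 * 0) 0); last first.
        by rewrite !mulr0 addr0 /cplx -[Complex 0 0]/(0 : C) mulr0.
      apply: cvgM; first exact: cvg_cst.
      apply: cvg_cplx; apply: cvgD; last exact: cvgM.
      by apply: cvgM => //; exact: cvg_cst.
    have c3 : q (gam t) (p * cplx ((t + t) * s + s * s) 0) @[s --> (0 : R)^'] --> (0 : C).
      exact: cvg_comp c2 (q0 _ (gam0 t)).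
    have l0 : p * cplx (t + t + 0) 0 * 0 = 0 :> C by rewrite mulr0.
    by rewrite -l0; exact: (cvgM c1 c3).
  have quo : (fun s : R => s^-1 *: (((fun t => pr (D (gam t))) \o shift t) (s *: (1 : R))
      - pr (D (gam t)))) @ (0 : R)^' --> (0 : R).
    apply: cvg_trans (prc _ wc); apply: near_eq_cvg.
    have nz : \forall s \near (0 : R)^', s != 0 by exact: nbhs_dnbhs_neq.
    apply: filterS nz => s s0; rewrite /= /GRing.scale /= mulr1 -prB.
    have -> : gam (s + t) = gam t + p * cplx ((t + t) * s + s * s) 0.
      by rewrite /gam -mulrDr -cD; congr (_ * cplx _ _); ring.
    rewrite qE (_ : _ * q _ _ = cplx s 0 * w s) ?prZ ?mulKf //.
    rewrite /w; set Q := q _ _; rewrite [cplx _ 0](_ : _ = cplx s 0 * cplx (t + t + s) 0).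
      by ring.
    by rewrite -cM; congr cplx; ring.
  split; first exact: cvgP quo.
  exact: cvg_lim quo.
have Dcst t : D (gam t) = D p.
  have -> : p = gam 0 by rewrite /gam expr0n addr0 mulr1.
  apply/eqP; rewrite eq_complex; apply/andP; split; apply/eqP.
    apply: const => [[a b] [c d]|s [a b]|w wc] //=; first by rewrite mul0r subr0.
    exact: (@cvg_Re _ _ _ _ 0).
  apply: const => [[a b] [c d]|s [a b]|w wc] //=; first by rewrite mul0r addr0.
  exact: (@cvg_Im _ _ _ _ 0).
(* The reciprocals of the points gam (sqrt n) tend to 0. *)
pose x (n : nat) : C := p^-1 * cplx (harmonic n) 0.
have xE n : (x n)^-1 = gam (Num.sqrt n%:R).
  rewrite /gam sqr_sqrtr // /x invfM invrK; congr (_ * _).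
  rewrite /harmonic /= (_ : cplx _ 0 = (cplx (1 + n%:R) 0)^-1) ?invrK //.
  by rewrite nat1r; exact: (fmorphV (real_complex R) n.+1%:R).
have xc : x @ \oo --> (0 : C).
  rewrite (_ : 0 = p^-1 * cplx 0 0); last by rewrite mulr0.
  by apply: cvgM; [exact: cvg_cst|apply: cvg_cplx; exact: cvg_harmonic].
have x0 n : x n != 0 by rewrite -invr_eq0 xE gam0.
have xd : x @ \oo --> (0 : C)^'.
  move=> A /xc xA; suff : \forall n \near \oo, A (x n) by [].
  have xA' : \forall n \near \oo, x n != 0 -> A (x n) := xA.
  by apply: filterS xA' => n; apply; exact: x0.
have : D (x n)^-1 @[n --> \oo] --> (0 : C) by exact: cvg_comp xd Dinf.
rewrite (_ : (fun n => _) = fun=> D p); last by apply/funext => n; rewrite xE Dcst.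
move=> h; have h0 : (fun _ : nat => D p) @ \oo --> D p by exact: cvg_cst.
exact: (cvg_unique _ h0 h).
Qed.
End Antiderivatives.

(** * Iterated antiderivatives *)

Section DeriveRules.
Variable K : numFieldType.
Implicit Types (f g : K -> K) (x a b c : K).

Lemma is_derive_add f g x a b : is_derive x 1 f a -> is_derive x 1 g b ->
  is_derive x 1 (fun y => f y + g y) (a + b).
Proof. exact: is_deriveD. Qed.

Lemma is_derive_mul f g x a b : is_derive x 1 f a -> is_derive x 1 g b ->
  is_derive x 1 (fun y => f y * g y) (f x * b + g x * a).
Proof. exact: is_deriveM. Qed.

Lemma is_derive_scale c f x a : is_derive x 1 f a -> is_derive x 1 (fun y => c * f y) (c * a).
Proof. exact: is_deriveZ. Qed.

Lemma is_derive_inv f x a : f x != 0 -> is_derive x 1 f a ->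
  is_derive x 1 (fun y => (f y)^-1) (- (f x) ^- 2 * a).
Proof.
move=> fx [df Df]; apply: DeriveDef; first exact: derivableV.
by rewrite deriveV // Df.
Qed.

Lemma is_derive_pow f n x a : is_derive x 1 f a ->
  is_derive x 1 (fun y => f y ^+ n) (n%:R * f x ^+ n.-1 * a).
Proof.
move=> df; rewrite (_ : (fun y => f y ^+ n) = f ^+ n); first exact: is_deriveX.
by apply/funext => y; rewrite exprfctE.
Qed.

Lemma is_derive_big n (F : 'I_n -> K -> K) x (a : 'I_n -> K) :
  (forall i, is_derive x 1 (F i) (a i)) ->
  is_derive x 1 (fun y => \sum_(i < n) F i y) (\sum_(i < n) a i).
Proof.
elim: n F a => [|n IH] F a dF.
  rewrite big_ord0 (_ : (fun y => _) = cst 0); first exact: is_derive_cst.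
  by apply/funext => y; rewrite big_ord0.
rewrite big_ord_recl (_ : (fun y => _) = fun y => F ord0 y + \sum_(i < n) F (lift ord0 i) y).
  apply: is_derive_add => //; exact: IH.
by apply/funext => y; rewrite big_ord_recl.
Qed.

Lemma is_derive_oddpowV (d : nat) x : x != 0 ->
  is_derive x 1 (fun y : K => (y ^+ d.*2.+1)^-1) (- (d.*2.+1%:R * (x ^+ 2) ^- d.+1)).
Proof.
move=> x0; apply: is_derive_eq.
  apply: (@is_derive_inv (fun y => y ^+ d.*2.+1)); first by rewrite expf_neq0.
  exact: is_derive_pow (is_derive_id x 1).
rewrite /= mulr1 -mulrN mulrCA mulNr; congr (_ * _); congr (- _).
have e : x ^+ d.*2.+1 ^+ 2 = x ^+ d.*2 * (x ^+ 2) ^+ d.+1.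
  by rewrite -!exprM -exprD; congr (_ ^+ _); lia.
by rewrite e invfM mulrAC mulVf ?mul1r ?expf_neq0.
Qed.
End DeriveRules.

Section Integration.
Variable R : realType.
Local Notation C := (CC R).
Implicit Types (f F G : C -> C) (p : C).

Lemma int_from_inftyE f F p : p != 0 -> is_int_from_infty f F -> int_from_infty f p = F p.
Proof.
move=> p0 fF; have [G fG <-] : [set y | exists2 G, is_int_from_infty f G & G p =
  y] (int_from_infty f p).
  by apply: (@xgetI _ _ _ (F p)); exists F.
pose D z := G z + (-1) * F z.
case: fF => dF cF; case: fG => dG cG.
have D0 : D p = 0.
  apply: (derive0_vanish p0) => [z z0|].
    have e : f z + (-1) * f z = 0 by ring.
    rewrite -e; exact: (is_derive_add (dG z z0) (is_derive_scale (-1) (dF z z0))).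
  have cN : (-1) * F x^-1 @[x --> (0 : C)^'] --> (-1) * (0 : C).
    by apply: cvgM cF; exact: cvg_cst.
  have lim l : l = (0 : C) -> D x^-1 @[x --> (0 : C)^'] --> l ->
      D x^-1 @[x --> (0 : C)^'] --> (0 : C) by move=> ->.
  apply: lim (cvgD cG cN); ring.
apply/eqP; rewrite -subr_eq0 -D0 /D; apply/eqP; ring.
Qed.

(** The k-fold antiderivative of [lsum] at (p, ..., p), up to the sign (-1)^k: each z^(-2 (d + 1))
is replaced by p^-(2d+1) / (2d+1). *)
Fixpoint polar_int (N k : nat) (phi : seq nat -> C) (p : C) : C :=
  if k is k'.+1 then
    \sum_(d < N) (p ^+ d.*2.+1)^-1 / d.*2.+1%:R * polar_int N k' (der d phi) p
  else phi [::].

Lemma int_from_infty_lsum N (c : nat -> C) f p : p != 0 ->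
  (forall x, x != 0 -> f x = \sum_(d < N) (x ^+ 2) ^- d.+1 * c d) ->
  int_from_infty f p = - \sum_(d < N) (p ^+ d.*2.+1)^-1 / d.*2.+1%:R * c d.
Proof.
move=> p0 fE.
pose F x : C := \sum_(d < N) (- (d.*2.+1%:R^-1 * c d)) * (x ^+ d.*2.+1)^-1.
rewrite (@int_from_inftyE f F p p0).
  by rewrite /F -sumrN; apply: eq_bigr => d _; ring.
split=> [x x0|].
  rewrite fE //.
  have dF i : is_derive x 1 (fun y : C => - (i.*2.+1%:R^-1 * c i) * (y ^+ i.*2.+1)^-1)
      ((x ^+ 2) ^- i.+1 * c i).
    apply: is_derive_eq (is_derive_scale _ (is_derive_oddpowV i x0)) _.
    have i0 : i.*2.+1%:R != 0 :> C by rewrite pnatr_eq0.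
    by rewrite mulrNN mulrA -[_ * _ * i.*2.+1%:R]mulrA [c i * _]mulrC mulKf // mulrC.
  exact: (is_derive_big (fun i : 'I_N => dF i)).
have h : hol0 (fun x : C => \sum_(d < N) (- (d.*2.+1%:R^-1 * c d)) * x ^+ d.*2.+1).
  by apply: hol0_sum => d; apply: hol0M; [exact: hol0_cst|exact: hol0X (@hol0_id C)].
have := hol0_cvg h; rewrite big1 => [|d _]; last by rewrite expr0n mulr0.
rewrite (_ : (fun x : C => F x^-1) = fun x : C => \sum_(d < N) (- (d.*2.+1%:R^-1 * c d)) * x ^+
  d.*2.+1) //.
by apply/funext => x; apply: eq_bigr => d _; rewrite exprVn invrK.
Qed.

Lemma polar_intZ N k a (phi : seq nat -> C) p :
  polar_int N k (fun I => a * phi I) p = a * polar_int N k phi p.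
Proof.
elim: k phi => [|k IH] phi //=.
by rewrite mulr_sumr; apply: eq_bigr => d _; rewrite mulrCA; congr (_ * _); exact: IH.
Qed.

Lemma polar_int_sum N k n (F : 'I_n -> seq nat -> C) p :
  polar_int N k (fun I => \sum_(i < n) F i I) p = \sum_(i < n) polar_int N k (F i) p.
Proof.
elim: k F => [|k IH] F //=.
rewrite exchange_big; apply: eq_bigr => d _; rewrite /= -mulr_sumr; congr (_ * _); exact: IH.
Qed.

Lemma eq_polar_int N k (phi psi : seq nat -> C) p :
  (forall I, size I = k -> phi I = psi I) -> polar_int N k phi p = polar_int N k psi p.
Proof.
elim: k phi psi => [|k IH] phi psi e /=; first exact: e.
by apply: eq_bigr => d _; congr (_ * _); apply: IH => I sI; apply: e; rewrite /= sI.
Qed.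

Lemma polar_int0 N k (phi : seq nat -> C) p :
  (forall I, size I = k -> phi I = 0) -> polar_int N k phi p = 0.
Proof.
move=> e; rewrite -(mul0r (polar_int N k phi p)) -polar_intZ.
by apply: eq_polar_int => I sI; rewrite e // mulr0.
Qed.

(** Each integration replaces one variable by p, so that the remaining integrand is again a Laurent
sum, for the word function psi with one letter summed out. *)
Lemma iterated_int_lsum N k (W : seq C -> C) (phi : seq nat -> C) p : p != 0 ->
  (forall s, size s = k -> (forall w, w \in s -> w != 0) -> W s = lsum N s phi) ->
  iterated_int k W p = (-1) ^+ k * polar_int N k phi p.
Proof.
move=> p0; elim: k W phi => [|k IH] W phi WE /=; first by rewrite mul1r WE.
pose psi I := \sum_(d < N) (- ((p ^+ d.*2.+1)^-1 / d.*2.+1%:R)) * phi (nat_of_ord d :: I).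
rewrite (IH _ psi) => [|s sk s0].
  rewrite /psi polar_int_sum exprS mulN1r mulNr -mulrN -sumrN; congr (_ * _).
  by apply: eq_bigr => d _; rewrite polar_intZ mulNr.
rewrite (@int_from_infty_lsum N (fun d => lsum N s (der d phi))) //.
  rewrite /psi lsum_sum -sumrN; apply: eq_bigr => d _.
  by rewrite lsumZ mulNr.
move=> x x0; rewrite WE //=; first by rewrite sk.
by move=> w; rewrite in_cons => /orP[/eqP -> //|/s0].
Qed.

(** If only words of weight w contribute, p^-w factors out and leaves the specialization. *)
Lemma polar_int_diagk N k w (phi : seq nat -> C) p : p != 0 -> (w <= N)%N ->
  (forall I, size I = k -> wt I != w -> phi I = 0) ->
  polar_int N k phi p = diagk k phi w / p ^+ w.
Proof.
move=> p0; elim: k w phi => [|k IH] w phi wN phi0 /=.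
  have [->|w0] := eqVneq w 0%N; first by rewrite mul1r expr0 divr1.
  by rewrite mul0r mul0r phi0 // eq_sym.
rewrite (osumE _ wN) mulr_suml; apply: eq_bigr => d _; case: ifP => dw; last first.
  rewrite polar_int0 ?mulr0 ?mul0r // => I sI; apply: phi0; first by rewrite /= sI.
  by rewrite wt_cons; apply/eqP => e; rewrite -e in dw; lia.
rewrite (IH (w - d.*2.+1)%N); [|lia|].
  have -> : p ^+ w = p ^+ d.*2.+1 * p ^+ (w - d.*2.+1) by rewrite -exprD subnKC.
  by rewrite invfM; ring.
move=> I sI wI; apply: phi0; first by rewrite /= sI.
by rewrite wt_cons; apply: contra_neq wI => <-; lia.
Qed.

Lemma iterated_int_EO g k w p : p != 0 -> (2 < 2 * g + k)%N -> (0 < k)%N ->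
  (w + 6 = 6 * g + 3 * k)%N ->
  iterated_int k (EO_W g) p = (-1) ^+ k * (diagk k (corr C) w / p ^+ w).
Proof.
move=> p0 st k0 wE; pose N := (6 * g + 3 * k + w)%N.
rewrite (@iterated_int_lsum N _ _ (corr_g C g)) //.
  congr (_ * _); rewrite (@polar_int_diagk _ _ w) //; last first.
  - move=> I sI wI; rewrite /corr_g /of_genus sI -wE eqn_add2r (negbTE wI).
    by rewrite mul0r.
  - by rewrite /N; lia.
  congr (_ / _); apply: eq_diagk => I sI wI.
  by rewrite /corr_g /of_genus sI wI wE eqxx mul1r.
case=> [|z0 s] /= sk s0; first by rewrite -sk in k0.
apply: EO_W_lsum.
- by move: st; rewrite -sk addnS ltnS.
- rewrite /N -sk; have gen n : (6 * g + 3 * n < 6 * g + 3 * n.+1 + w)%N by lia.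
  exact: gen.
- by apply: s0; rewrite mem_head.
- by move=> v vs; apply: s0; rewrite in_cons vs orbT.
Qed.
End Integration.

(** * Exponentials and the functions S_n *)

Section FpsExp.
Variable C : numFieldType.

Lemma fps_exp0 (a : nat -> C) : fps_exp a 0 = 1.
Proof. by rewrite /fps_exp big_ord1 expr0 coefZ coef1 fact0 invr1 mulr1. Qed.

Lemma coef_exp_low (P : {poly C}) m i : P`_0 = 0 -> (i < m)%N -> (P ^+ m)`_i = 0.
Proof.
move=> P0; elim: m i => [|m IH] i // im.
rewrite exprS coefM big1 // => j _; have [->|j0] := eqVneq (nat_of_ord j) 0%N.
  by rewrite P0 mul0r.
by rewrite IH ?mulr0 //; have := ltn_ord j; lia.
Qed.

Lemma coef_exp_trunc (P Q : {poly C}) n m : (forall i, (i <= n)%N -> P`_i = Q`_i) ->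
  forall i, (i <= n)%N -> (P ^+ m)`_i = (Q ^+ m)`_i.
Proof.
move=> PQ; elim: m => [|m IH] i ni //.
rewrite !exprS !coefM; apply: eq_bigr => j _; have := ltn_ord j => lj.
by rewrite PQ ?IH //; lia.
Qed.

Lemma fps_expE L M (a : nat -> C) n : a 0%N = 0 -> (n <= L)%N -> (n < M)%N ->
  fps_exp a n = (\sum_(m < M) m`!%:R^-1 *: (\poly_(j < L.+1) a j) ^+ m)`_n.
Proof.
move=> a0 nL nM; rewrite /fps_exp !coef_sum.
rewrite (sum_ord_widen (F := fun m => (m`!%:R^-1 *: (\poly_(j < n.+1) a j) ^+ m)`_n) nM);
  last first.
  by move=> i ni; rewrite coefZ coef_exp_low ?mulr0 // coef_poly /= a0.
apply: eq_bigr => m _; rewrite !coefZ; congr (_ * _).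
apply: (coef_exp_trunc (n := n)) => // i ni; rewrite !coef_poly.
by rewrite !ltnS ni (leq_trans ni nL).
Qed.

(** The derivative of exp a is a' exp a; on truncations this holds in low degrees. *)
Lemma fps_expS (a : nat -> C) n : a 0%N = 0 -> n.+1%:R * fps_exp a n.+1 =
  \sum_(i < n.+1) (i.+1%:R * a i.+1) * fps_exp a (n - i).
Proof.
move=> a0; set P := \poly_(j < n.+2) a j.
have -> : n.+1%:R * fps_exp a n.+1 = ((\sum_(m < n.+2) m`!%:R^-1 *: P ^+ m)^`())`_n.
  by rewrite coef_deriv -[RHS]mulr_natl -(@fps_expE n.+1 n.+2).
have -> : (\sum_(m < n.+2) m`!%:R^-1 *: P ^+ m)^`() = P^`() * \sum_(m < n.+1) m`!%:R^-1 *: P ^+ m.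
  rewrite raddf_sum big_ord_recl /= derivZ expr0 -polyC1 derivC scaler0 add0r mulr_sumr.
  apply: eq_bigr => m _; rewrite -[bump 0 m]/(m.+1) derivZ deriv_exp /= -[X in _ *: X =
    _]scaler_nat scalerA -scalerAr.
  congr (_ *: _); rewrite factS natrM invfM mulrAC mulVf ?mul1r ?pnatr_eq0 //.
rewrite coefM; apply: eq_bigr => i _; have := ltn_ord i => li.
rewrite coef_deriv coef_poly ltnS li -[_ *+ i.+1]mulr_natl; congr (_ * _).
by rewrite -(@fps_expE n.+1 n.+1) //; lia.
Qed.

(** Both sides are the solution of n z_n = \sum_i i f_i z_(n-i) with z_0 = 1. *)
Lemma fps_exp_airy (x : C) (a : nat -> C) : a 0%N = 0 ->
  (forall j, (0 < j)%N -> a j = diag (corr C) (3 * j) * x ^+ (3 * j)) ->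
  forall n, fps_exp a n = airy_coef C n * x ^+ (3 * n).
Proof.
move=> a0 aE; elim/ltn_ind => -[_|n IH]; first by rewrite fps_exp0 airy_coef0 mul1r.
apply: (@mulfI _ n.+1%:R); first by rewrite pnatr_eq0.
rewrite fps_expS // mulrA airy_coef_exp [X in _ = X * _]big_ord_recl mul0r mul0r add0r mulr_suml.
apply: eq_bigr => i _; have := ltn_ord i => li; rewrite lift0 subSS aE // IH ?ltnS ?leq_subr //.
have -> : (3 * n.+1 = 3 * i.+1 + 3 * (n - i))%N by lia.
by rewrite exprD; ring.
Qed.
End FpsExp.

Section AiryS.
Variable R : realType.
Local Notation C := (CC R).

Lemma diagk_corr_genus k j : diagk k (corr C) (3 * j) != 0 ->
  exists g, (2 * g + k = j.+2)%N.
Proof.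
apply: contra_neqP => ng; rewrite (eq_diagk (psi := fun=> 0)) ?diagk0 // => I sI wI.
apply/eqP; apply: contra_notT ng => /corr_genus[g /eqP]; rewrite wI sI => e.
by exists g; lia.
Qed.

(** The sum over g and k with 2g - 1 + k = j + 1 is the whole coefficient of t^(3j) in F, because
the genus and the number of letters determine the weight. *)
Lemma airy_SE (p logp : C) j : p != 0 -> (0 < j)%N ->
  airy_S p logp j.+1 = diag (corr C) (3 * j) / p ^+ (3 * j).
Proof.
move=> p0; case: j => // j _; rewrite /airy_S.
set n := j.+2.
pose D k := diagk k (corr C) (3 * j.+1) / k`!%:R.
pose M := (3 * j.+1 + 3)%N.
have D0 k : (forall g, (2 * g + k)%N <> n.+1) -> D k = 0.
  move=> ng; rewrite /D; have [->|/diagk_corr_genus[g gE]] :=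
    eqVneq (diagk k (corr C) (3 * j.+1)) 0.
    by rewrite mul0r.
  by case: (ng g).
transitivity (\sum_(1 <= k < n.+2) D k / p ^+ (3 * j.+1)).
  rewrite (exchange_big_dep_nat xpredT) //=; apply: eq_big_nat => k /andP[k0 kn].
  have [[g gE]|ng] := pselect (exists g, (2 * g + k)%N = n.+1); last first.
    rewrite D0 ?mul0r; last by move=> g gE; apply: ng; exists g.
    by rewrite big1_seq // => g /andP[/eqP gE _]; case: ng; exists g.
  rewrite big_mkcond (bigD1_seq g) /=; [|by rewrite mem_index_iota; lia|exact: (iota_uniq 0 j.+4)].
  rewrite gE eqxx big1_seq ?addr0; last first.
    by move=> g' /andP[/eqP ne _]; rewrite ifF //; apply/eqP => e1; apply: ne; lia.
  rewrite (@iterated_int_EO R g k (3 * j.+1)) //; [|lia|lia].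
  have s1 : (-1) ^+ k * (-1) ^+ k = 1 :> C by rewrite -exprMn mulrNN mul1r expr1n.
  transitivity ((-1) ^+ k * (-1) ^+ k * (D k / p ^+ (3 * j.+1))); last by rewrite s1 mul1r.
  by rewrite /D; ring.
rewrite -mulr_suml; congr (_ / _).
rewrite (@diagE _ M); last by rewrite /M; lia.
rewrite -(big_mkord xpredT D) [RHS](@big_cat_nat _ _ _ n.+2) //=; last by rewrite /M /n; lia.
rewrite [X in _ = _ + X]big_nat [X in _ = _ + X]big1 ?addr0; last first.
  move=> k /andP[nk _]; apply: D0 => g; rewrite /n in nk *; lia.
rewrite [RHS]big_ltn // [D 0%N](_ : _ = 0) ?add0r //.
by rewrite /D mulnS /= !mul0r.
Qed.
End AiryS.

(** * The Airy equation *)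

(** A continuous square root f of g is differentiable where it is nonzero, because
f(y) - f(x) = (g(y) - g(x)) / (f(y) + f(x)). *)
Lemma is_derive_sqrt (K : numFieldType) (f g : K -> K) (x b : K) :
  {for x, continuous f} -> f x != 0 -> (\forall y \near x, f y ^+ 2 = g y) ->
  is_derive x 1 g b -> is_derive x 1 f ((2 * f x)^-1 * b).
Proof.
move=> fc fx0 fg [dg Dg].
have qg : (fun h : K => h^-1 *: ((g \o shift x) (h *: (1 : K)) - g x)) @ (0 : K)^' --> b.
  by rewrite -Dg.
have sh : (fun h : K => h *: (1 : K) + x) @ (0 : K)^' --> x.
  have c0 : (fun h : K => h *: (1 : K) + x) @ (0 : K)^' --> (0 : K) * 1 + x.
    by apply: cvgD; [apply: cvgM; [exact: cvg_within|exact: cvg_cst]|exact: cvg_cst].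
  by rewrite mul0r add0r in c0.
have fsh : f (h *: (1 : K) + x) @[h --> (0 : K)^'] --> f x by exact: cvg_comp sh fc.
have den : (fun h : K => f (h *: (1 : K) + x) + f x) @ (0 : K)^' --> f x + f x.
  by apply: cvgD => //; exact: cvg_cst.
have fx2 : f x + f x != 0 by rewrite -mulr2n mulrn_eq0 negb_or.
have dn0 : \forall h \near (0 : K)^', f (h *: (1 : K) + x) + f x != 0 by exact: cvgr_neq0 den fx2.
have fgs : \forall h \near (0 : K)^', f (h *: (1 : K) + x) ^+ 2 = g (h *: (1 : K) + x) := sh _ fg.
have quo : (fun h : K => h^-1 *: ((f \o shift x) (h *: (1 : K)) - f x)) @ (0 : K)^' --> (2 * f
  x)^-1 * b.
  have -> : (2 * f x)^-1 * b = (f x + f x)^-1 * b by congr (_^-1 * _); ring.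
  (* The difference quotient of f, written with that of g. *)
  pose w (h : K) := (f (h *: (1 : K) + x) +
    f x)^-1 * (h^-1 *: ((g \o shift x) (h *: (1 : K)) - g x)).
  have c : w @ (0 : K)^' --> (f x + f x)^-1 * b by apply: cvgM qg; exact: cvgV.
  suff ne : \forall h \near (0 : K)^', w h = h^-1 *: ((f \o shift x) (h *: (1 : K)) - f x).
    by apply: cvg_trans c; exact: near_eq_cvg ne.
  apply: filterS2 dn0 fgs => h dh e.
  have ex : f x ^+ 2 = g x := nbhs_singleton fg.
  rewrite /w /= -e -ex; move: (f (h *: (1 : K) + x)) dh => y dh.
  rewrite -[h^-1 *: (y - f x)]/(h^-1 * (y - f x)) -[h^-1 *: _]/(h^-1 * (y ^+ 2 - f x ^+ 2)).
  by rewrite subr_sqr mulrCA [_ * (_ + _)]mulrC mulKf.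
split; first exact: cvgP quo.
exact: cvg_lim quo.
Qed.

Section AiryEquation.
Variable R : realType.
Local Notation C := (CC R).
Variables (U : set C) (p logp : C -> C).
Hypothesis branch : airy_branch U p logp.

Let q (u : C) : C := expC (- (2^-1 * logp u)).

Lemma branch_p_neq0 u : U u -> p u != 0.
Proof.
move=> Uu; have := branch_sqr branch Uu; apply: contra_eq_neq => ->.
by rewrite expr0n eq_sym mulf_neq0 ?pnatr_eq0 ?(branch_neq0 branch).
Qed.

Lemma branch_near u : U u -> \forall v \near u, U v.
Proof. by move=> Uu; apply: open_nbhs_nbhs; split=> //; exact: branch_open branch. Qed.

Lemma branch_dp u : U u -> is_derive u 1 p (p u)^-1.
Proof.
move=> Uu; have p0 := branch_p_neq0 Uu.
apply: is_derive_eq.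
  apply: (@is_derive_sqrt C p (fun v => 2 * v) u (2 * 1)) => //.
  - exact: branch_continuous branch _ Uu.
  - by apply: filterS (branch_near Uu) => v Uv; exact: branch_sqr branch _ Uv.
by field.
Qed.

Lemma branch_q_sqr u : U u -> q u ^+ 2 = (p u)^-1.
Proof.
move=> Uu; have p0 := branch_p_neq0 Uu.
apply: (mulIf p0); rewrite mulVf // -(branch_exp branch Uu) expr2 /q -!expCD.
by rewrite (_ : _ + _ = 0) ?expC0 //; field.
Qed.

Lemma branch_q_neq0 u : U u -> q u != 0.
Proof.
move=> Uu; have := branch_q_sqr Uu; apply: contra_eq_neq => ->.
by rewrite expr0n eq_sym invr_eq0 branch_p_neq0.
Qed.

Lemma branch_dq u : U u -> is_derive u 1 q (- (2^-1 * q u * (p u) ^- 2)).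
Proof.
move=> Uu; have p0 := branch_p_neq0 Uu; have q0 := branch_q_neq0 Uu.
apply: is_derive_eq.
  apply: (@is_derive_sqrt C q (fun v => (p v)^-1) u) => //.
  - have lc : logp v @[v --> u] --> logp u := branch_log_continuous branch Uu.
    have c1 : 2^-1 * logp v @[v --> u] --> 2^-1 * logp u by apply: cvgM lc; exact: cvg_cst.
    have c2 : - (2^-1 * logp v) @[v --> u] --> - (2^-1 * logp u) by exact: cvgN c1.
    exact: (@expC_continuous R _ _ _ (fun v => - (2^-1 * logp v)) _ c2).
  - by apply: filterS (branch_near Uu) => v Uv; exact: branch_q_sqr.
  - exact: is_derive_inv p0 (branch_dp Uu).
have qq := branch_q_sqr Uu.
by rewrite -[(p u)^-1]qq; field; rewrite p0 q0.
Qed.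

Let qpV (m : nat) (u : C) : C := q u * (p u ^+ m)^-1.

(** u-derivatives of the functions q p^-m are multiples of one another, as p p' = 1 and
q^2 p = 1. *)
Lemma branch_dqpV m u : U u -> is_derive u 1 (qpV m) (- (m%:R + 2^-1) * qpV m.+2 u).
Proof.
move=> Uu; have p0 := branch_p_neq0 Uu.
have pm0 : p u ^+ m != 0 by rewrite expf_neq0.
apply: is_derive_eq.
  apply: is_derive_mul (branch_dq Uu) _.
  by apply: (@is_derive_inv C (fun v => p v ^+ m)) => //; exact: is_derive_pow (branch_dp Uu).
rewrite /qpV; case: m pm0 => [|m] pm0 /=; first by rewrite mul0r !mul0r !mulr0 !expr0; field.
by rewrite !exprS; rewrite exprS in pm0; move: (p u ^+ m) pm0 => y;
  rewrite mulf_eq0 negb_or => /andP[_ y0]; field; rewrite p0 y0.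
Qed.

Let S (n : nat) (u : C) : C := airy_S (p u) (logp u) n.
Let Z := wkb_amplitude S.

Lemma is_derive_on f g u (b : C) : U u -> (forall v, U v -> g v = f v) ->
  is_derive u 1 f b -> is_derive u 1 g b.
Proof.
move=> Uu fg; apply: near_eq_is_derive.
by apply: filterS (branch_near Uu) => v Uv; rewrite fg.
Qed.

Lemma derive1_on f g u (b : C) : U u -> (forall v, U v -> g v = f v) ->
  is_derive u 1 f b -> derive1 g u = b.
Proof.
by move=> Uu fg df; have [_ <-] := is_derive_on Uu fg df; rewrite derive1E.
Qed.

(** Closed form of Z: its coefficient of hbar^n is the n-th Airy coefficient times q p^(-3n). *)
Lemma wkbE n u : U u -> Z n u = airy_coef C n * qpV (3 * n) u.
Proof.
move=> Uu; rewrite /Z /wkb_amplitude (@fps_exp_airy C (p u)^-1) //.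
  by rewrite exprVn /qpV mulrCA.
by case=> // j _; rewrite /S airy_SE ?branch_p_neq0 // exprVn.
Qed.

Lemma wkb_derive n u : U u ->
  is_derive u 1 (Z n) (airy_coef C n * (- ((3 * n)%:R + 2^-1) * qpV (3 * n).+2 u)).
Proof.
move=> Uu; apply: (is_derive_on (f := fun v => airy_coef C n * qpV (3 * n) v) Uu).
  exact: wkbE.
exact: is_derive_scale (branch_dqpV _ Uu).
Qed.

Lemma S0_derive u : U u -> is_derive u 1 (S 0) (p u).
Proof.
move=> Uu; have p0 := branch_p_neq0 Uu.
apply: is_derive_eq.
  exact: (@is_derive_scale C 3^-1 (fun v => p v ^+ 3) u _ (is_derive_pow 3 (branch_dp Uu))).
by rewrite /=; field.
Qed.

Let vamp (n : nat) (u : C) : C :=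
  if n is m.+1 then
    (airy_coef C m.+1 - ((3 * m)%:R + 2^-1) * airy_coef C m) * qpV (3 * m).+2 u
  else p u * q u.

Lemma qpV_shift m u : U u -> p u * qpV m.+1 u = qpV m u.
Proof.
move=> Uu; have p0 := branch_p_neq0 Uu.
by rewrite /qpV mulrCA exprS invfM mulVKf.
Qed.

Lemma vhatE n u : U u -> vhat (S 0) Z n u = vamp n u.
Proof.
move=> Uu; rewrite /vhat (derive1_on Uu (fun _ _ => erefl) (S0_derive Uu)).
case: n => [|m] /=.
  by rewrite add0r wkbE // airy_coef0 mul1r /qpV expr0 invr1 mulr1.
rewrite (derive1_on Uu (fun _ _ => erefl) (wkb_derive m Uu)) wkbE //.
rewrite [p u * (_ * _)]mulrCA (_ : 3 * m.+1 = (3 * m).+3)%N; last by rewrite mulnS.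
by rewrite qpV_shift //; ring.
Qed.

Lemma vamp_derive n u : U u -> is_derive u 1 (vamp n)
  (if n is m.+1 then (airy_coef C m.+1 - ((3 * m)%:R + 2^-1) * airy_coef C m) *
      (- ((3 * m).+2%:R + 2^-1) * qpV (3 * m).+4 u)
   else 2^-1 * qpV 1 u).
Proof.
move=> Uu; case: n => [|m].
  apply: is_derive_eq; first exact: is_derive_mul (branch_dp Uu) (branch_dq Uu).
  have p0 := branch_p_neq0 Uu.
  by rewrite /qpV expr1; field.
exact: is_derive_scale (branch_dqpV _ Uu).
Qed.

Lemma vhat_derivable n u : U u -> derivable (vhat (S 0) Z n) u 1.
Proof. by move=> Uu; have [] := is_derive_on Uu (@vhatE n) (vamp_derive n Uu). Qed.

(** In order hbar^0 the equation is p^2 = 2u, in order hbar^1 it is the transport equation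
solved by q, and in the higher orders it is the recursion [airy_coefS]. *)
Lemma Ahat_eq0 n u : U u -> Ahat (S 0) Z n u = 0.
Proof.
move=> Uu; have p2 : u = 2^-1 * p u ^+ 2 by rewrite (branch_sqr branch Uu) mulKf ?pnatr_eq0.
have u_qpV m : u * qpV m.+2 u = 2^-1 * qpV m u.
  by rewrite {1}p2 -mulrA expr2 -mulrA !qpV_shift.
rewrite /Ahat /uhat wkbE // {1}/vhat (derive1_on Uu (fun _ _ => erefl) (S0_derive Uu)).
rewrite vhatE //; case: n => [|m].
  rewrite muln0 add0r airy_coef0 mul1r /qpV expr0 invr1 mulr1 /=.
  rewrite [u * q u](_ : _ = 2^-1 * p u ^+ 2 * q u); last by rewrite {1}p2.
  by ring.
rewrite (derive1_on Uu (@vhatE m) (vamp_derive m Uu)) /vamp.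
rewrite [p u * (_ * _)]mulrCA qpV_shift // [u * (_ * _)]mulrCA.
rewrite (_ : 3 * m.+1 = (3 * m).+3)%N; last by rewrite mulnS.
rewrite u_qpV; case: m => [|m].
  by rewrite airy_coef0 muln0; field.
have := airy_coefS C m; rewrite (_ : 3 * m.+1 = (3 * m).+3)%N; last by rewrite mulnS.
move: (qpV _ u) (airy_coef C m.+2) (airy_coef C m.+1) (airy_coef C m) => b a2 a1 a0.
have cast k : ((3 * m) + k)%:R = 3 * m%:R + k%:R :> C by rewrite natrD natrM.
rewrite -[(3 * m).+3]addn3 -[(3 * m).+2]addn2 !cast natrM -[m.+1%:R]natr1 => e.
have m1 : m%:R + 1 != 0 :> C by rewrite natr1 pnatr_eq0.
have -> : a1 = (24 * (m%:R + 1))^-1 * ((6 * m%:R + 1) * (6 * m%:R + 5) * a0).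
  by rewrite -e mulKf // mulf_neq0 ?pnatr_eq0.
by field; rewrite m1.
Qed.
End AiryEquation.

Theorem theorem1p1 (R : realType) (U : set (CC R)) (p logp : CC R -> CC R)
    (branch : airy_branch U p logp) :
  let S := fun (n : nat) (u : CC R) => airy_S (p u) (logp u) n in
  let Z := wkb_amplitude S in
  (* the derivatives in the equation exist *)
  [/\ holomorphic_on U (S 0%N),
      forall n, holomorphic_on U (Z n) &
      forall n, holomorphic_on U (vhat (S 0%N) Z n)] /\
  forall n u, U u -> Ahat (S 0%N) Z n u = 0.
Proof.
move=> S Z; split; last by move=> n u Uu; exact: (Ahat_eq0 branch n Uu).
split=> [u Uu|n u Uu|n u Uu]; last exact: (vhat_derivable branch Uu).
  by have [] := S0_derive branch Uu.
by have [] := wkb_derive branch n Uu.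
Qed.
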